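(* Let $\Lambda$ be a hyperbolic set for a $C^{1+\beta}$ diffeomorphism $f:M\to M$ of a compact Riemannian manifold, with hyperbolicity exponent $\lambda\in(0,1)$ and with $Df$ having H\''older exponent $\beta$. Then the stable distribution $x\mapsto E^s_x$ is H\''older continuous on $\Lambda$ with exponent $$\alpha_s=\frac{\beta\log\lambda^{-1}}{\log\|Df\|_\infty+\beta\log\lambda^{-1}}$$ and the unstable distribution $x\mapsto E^u_x$ is H\''older continuous on $\Lambda$ with exponent $$\alpha_u=\frac{\beta\log\lambda^{-1}}{\log\|Df^{-1}\|_\infty+\beta\log\lambda^{-1}}.$$ Explicitly, there exists $C>0$ such that $d_G(E^s_x,E^s_y)\le C\,d(x,y)^{\alpha_s}$ for all $x,y\in\Lambda$ (and similarly for $E^u$ with exponent $\alpha_u$).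
   Context: A compact set $\Lambda\subset M$ with $f(\Lambda)=\Lambda$ is hyperbolic if there is a continuous splitting $T_\Lambda M=E^s\oplus E^u$ with $Df_x(E^s_x)=E^s_{f(x)}$, $Df_x(E^u_x)=E^u_{f(x)}$, and constants $c>0$, $\lambda\in(0,1)$ ($\lambda$ is the hyperbolicity exponent) such that for all $x\in\Lambda$, $n\ge0$: $\|Df^n_x v\|\le c\lambda^n\|v\|$ for $v\in E^s_x$ and $\|Df^{-n}_x v\|\le c\lambda^n\|v\|$ for $v\in E^u_x$. $\|Df\|_\infty=\sup_x\|Df_x\|$, $\|Df^{-1}\|_\infty=\sup_x\|Df_x^{-1}\|$. For subspaces $E,F$ of equal dimension of an inner product space, $d_G(E,F)=\|P_E-P_F\|$, where $P_E,P_F$ are the orthogonal projections. Subspaces of $T_xM$ and $T_yM$ are compared by identifying $T_xM$ with $T_yM$ through parallel transport along a minimal geodesic from $x$ to $y$. *)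

(* Defs.v *)
From HB Require Import structures.
From mathcomp Require Import all_boot all_order all_algebra.
From mathcomp Require Import all_classical all_reals all_analysis.

Set Implicit Arguments.
Unset Strict Implicit.
Unset Printing Implicit Defensive.

Import Order.TTheory GRing.Theory Num.Theory.
Import numFieldNormedType.Exports.

Local Open Scope classical_set_scope.
Local Open Scope ring_scope.

(** * Smooth manifolds *)

(* [C^k] and [C^oo] on an open set of a finite-dimensional space *)
Fixpoint Ck_on (R : realType) (V W : normedModType R) (k : nat) (U : set V)
    (f : V -> W) : Prop :=
  if k is k'.+1 then
    (forall x, U x -> differentiable f x) /\ (forall v, Ck_on k' U ('D_v f))
  else forall x, U x -> {for x, continuous f}.

Definition smooth_on (R : realType) (V W : normedModType R) (U : set V)
    (f : V -> W) : Prop := forall k, Ck_on k U f.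

(* The smooth atlas is indexed by the points: [chart p] is a chart around [p],
   defined on [dom p], and [ichart p] is its inverse.  Every smooth structure
   is given by such an atlas (choose one chart around each point). *)
Record smoothManifold (R : realType) (n : nat) := SmoothManifold {
  pt :> topologicalType;
  manifold_hausdorff : hausdorff_space pt;
  manifold_countable : @second_countable pt;
  dom : pt -> set pt;
  chart : pt -> pt -> 'rV[R]_n;
  ichart : pt -> 'rV[R]_n -> pt;
  dom_self : forall p, dom p p;
  dom_open : forall p, open (dom p);
  chart_open : forall p, open (chart p @` dom p);
  chart_continuous : forall p q, dom p q -> {for q, continuous (chart p)};
  ichart_continuous :
    forall p u, (chart p @` dom p) u -> {for u, continuous (ichart p)};
  chartK : forall p q, dom p q -> ichart p (chart p q) = q;
  transition_smooth : forall p q,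
    smooth_on (chart p @` (dom p `&` dom q)) (chart q \o ichart p)
}.

(* The tangent space at [p] is ['rV[R]_n]: a tangent vector at [p] is
   represented by its coordinates in the chart [chart p] attached to that very
   point.  Linear maps act on row vectors from the right.
   [tchange p q x] turns the coordinates, in [chart p], of a vector tangent at
   [x] into its coordinates in [chart q]. *)
Definition tchange (R : realType) (n : nat) (M : smoothManifold R n)
    (p q x : M) : 'M[R]_n :=
  'J (chart q \o ichart p) (chart p x).

(* the metric tensor in the coordinates of [chart p], as a function of the
   coordinates; [g q] is the Gram matrix at [q] in the coordinates [chart q] *)
Definition local_metric (R : realType) (n : nat) (M : smoothManifold R n)
    (g : M -> 'M[R]_n) (p : M) (u : 'rV[R]_n) : 'M[R]_n :=
  let q := ichart p u in tchange p q q *m g q *m (tchange p q q)^T.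

Record riemannianManifold (R : realType) (n : nat) := RiemannianManifold {
  underlying :> smoothManifold R n;
  metric : underlying -> 'M[R]_n;
  metric_sym : forall p, (metric p)^T = metric p;
  metric_pos : forall p (v : 'rV[R]_n), v != 0 ->
    0 < (v *m metric p *m v^T) 0 0;
  metric_smooth : forall p : underlying,
    smooth_on (chart p @` dom p) (local_metric metric p)
}.

Section Riemannian.
Context {R : realType} {n : nat} {M : riemannianManifold R n}.
Implicit Types (p q x y : M) (v w : 'rV[R]_n) (E F : 'M[R]_n) (gam : R -> M).

(** * Linear algebra in the tangent spaces *)

Definition tnorm p v : R := Num.sqrt ((v *m metric p *m v^T) 0 0).

(* operator norm of a linear map from [T_p M] to [T_q M] *)
Definition opnorm p q (A : 'M[R]_n) : R :=
  sup [set tnorm q (v *m A) | v in [set v | tnorm p v <= 1]].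

(* Subspaces are row spaces.  [oproj p E] is the orthogonal projection of
   [T_p M] onto [E]: the kernel below is the orthogonal complement of [E]. *)
Definition oproj p E : 'M[R]_n := proj_mx E (kermx (metric p *m E^T)).

Definition dG p E F : R := opnorm p p (oproj p E - oproj p F).

(** * Differentiable maps *)

Definition local_rep (f : M -> M) p : 'rV[R]_n -> 'rV[R]_n :=
  chart (f p) \o f \o ichart p.

(* the matrix of [Df_p : T_p M -> T_(f p) M] *)
Definition D (f : M -> M) p : 'M[R]_n := 'J (local_rep f p) (chart p p).

Definition C1holder (beta : R) (f : M -> M) : Prop :=
  continuous f /\
  forall p, exists K : R, exists2 U : set 'rV[R]_n, nbhs (chart p p) U &
    (forall u, U u -> differentiable (local_rep f p) u) /\
    (forall u u', U u -> U u' ->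
      `|'J (local_rep f p) u - 'J (local_rep f p) u'| <= K * `|u - u'| `^ beta).

Definition diffeo_C1holder (beta : R) (f finv : M -> M) : Prop :=
  [/\ cancel f finv, cancel finv f, C1holder beta f & C1holder beta finv].

(* ‖Df‖_oo and ‖Df^-1‖_oo *)
Definition Dnorm (f : M -> M) : R :=
  sup [set opnorm p (f p) (D f p) | p in [set: M]].

Definition Dinvnorm (f : M -> M) : R :=
  sup [set opnorm (f p) p (invmx (D f p)) | p in [set: M]].

(** * Curves and Riemannian distance *)

Definition velocity gam (t : R) : 'rV[R]_n :=
  (chart (gam t) \o gam)^`()%classic t.

Definition C1_at gam (t : R) : Prop :=
  [/\ {for t, continuous gam},
      \forall s \near t, derivable (chart (gam t) \o gam) s 1 &
      {for t, continuous ((chart (gam t) \o gam)^`()%classic)}].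

(* [gam] coincides, on each interval of a subdivision of [0, 1], with a curve
   that is C^1 around that (closed) interval *)
Definition piecewise_C1 gam : Prop :=
  exists ts : seq R,
    [/\ sorted <%R ts, head 0 ts = 0, last 0 ts = 1 &
      forall i, (i.+1 < size ts)%N -> exists2 eta : R -> M,
        (forall t, ts`_i <= t <= ts`_i.+1 -> C1_at eta t) &
        (forall t, ts`_i <= t <= ts`_i.+1 -> gam t = eta t)].

Definition length gam : \bar R :=
  (\int[lebesgue_measure]_(t in `[0%R, 1%R])
    (tnorm (gam t) (velocity gam t))%:E)%E.

(* [+oo] between distinct connected components *)
Definition dist x y : \bar R :=
  ereal_inf [set length gam | gam in
    [set gam | [/\ piecewise_C1 gam, gam 0 = x & gam 1 = y]]].

(** * Levi-Civita connection, parallel transport, geodesics *)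

(* [Gamma^k_ij] in the coordinates [chart p], at the point of coordinates [u] *)
Definition christoffel p (u : 'rV[R]_n) (k i j : 'I_n) : R :=
  let G := local_metric (@metric R n M) p in
  let d (a b c : 'I_n) : R := 'D_(delta_mx 0 a) (fun w => G w b c) u in
  2^-1 * \sum_l invmx (G u) k l * (d i j l + d j i l - d l i j).

(* The field [V] along [gam] has vanishing covariant derivative at time [t];
   [V s] is given in the coordinates [chart (gam s)], so it is first read in
   the fixed chart [chart (gam t)]. *)
Definition parallel_at gam (V : R -> 'rV[R]_n) (t : R) : Prop :=
  is_derive t 1 (fun s => V s *m tchange (gam s) (gam t) (gam s))
    (- \row_k \sum_i \sum_j
         christoffel (gam t) (chart (gam t) (gam t)) k i j
         * velocity gam t 0 i * V t 0 j).

Definition parallel gam (V : R -> 'rV[R]_n) : Prop :=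
  forall t, 0 <= t <= 1 -> parallel_at gam V t.

(* [A] is the matrix of the parallel transport along [gam], from the tangent
   space at [gam 0] to the tangent space at [gam 1] *)
Definition parallel_transport gam (A : 'M[R]_n) : Prop :=
  forall v, exists V : R -> 'rV[R]_n,
    [/\ parallel gam V, V 0 = v & V 1 = v *m A].

Definition geodesic gam : Prop :=
  (forall t, 0 <= t <= 1 -> C1_at gam t) /\ parallel gam (velocity gam).

Definition minimal_geodesic gam x y : Prop :=
  [/\ geodesic gam, gam 0 = x, gam 1 = y & length gam = dist x y].

(** * Hyperbolic sets *)

(* The orthogonal projections onto the subspaces [E y], read in a fixed
   chart, depend continuously on the base point [y] in [Lam]. *)
Definition continuous_distribution (Lam : set M) (E : M -> 'M[R]_n) : Prop :=
  forall x, Lam x ->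
    (fun y => tchange x y y *m oproj y (E y) *m tchange y x y)
      @ within Lam (nbhs x) --> oproj x (E x).

Record hyperbolic_set (f finv : M -> M) (lam : R) (Lam : set M)
    (Es Eu : M -> 'M[R]_n) : Prop := HyperbolicSet {
  hyp_compact : compact Lam;
  hyp_invariant : f @` Lam = Lam;
  hyp_splitting : forall x, Lam x ->
    (Es x + Eu x :=: 1%:M)%MS /\ (Es x :&: Eu x = 0)%MS;
  hyp_cts_s : continuous_distribution Lam Es;
  hyp_cts_u : continuous_distribution Lam Eu;
  hyp_inv_s : forall x, Lam x -> (Es x *m D f x :=: Es (f x))%MS;
  hyp_inv_u : forall x, Lam x -> (Eu x *m D f x :=: Eu (f x))%MS;
  hyp_exponent : 0 < lam < 1;
  hyp_rates : exists2 c : R, 0 < c &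
    forall x, Lam x -> forall (k : nat) v,
      ((v <= Es x)%MS ->
        tnorm (iter k f x) (v *m D (iter k f) x) <= c * lam ^+ k * tnorm x v) /\
      ((v <= Eu x)%MS ->
        tnorm (iter k finv x) (v *m D (iter k finv) x)
          <= c * lam ^+ k * tnorm x v)
}.

(* The subspace at [x] is carried to the tangent space at [y] along a minimal
   geodesic, and compared there with the subspace at [y]. *)
Definition holder_distribution (Lam : set M) (E : M -> 'M[R]_n) (alpha : R) :
    Prop :=
  exists2 C : R, 0 < C &
    forall x y, Lam x -> Lam y ->
    forall gam (A : 'M[R]_n), minimal_geodesic gam x y ->
    parallel_transport gam A ->
    ((dG y (E x *m A) (E y))%:E <= C%:E * dist x y `^ alpha)%E.

End Riemannian.

(* Main.v *)
Require Import Defs.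
From mathcomp Require Import all_boot all_order all_algebra.
From mathcomp Require Import all_classical all_reals all_analysis.
From mathcomp Require Import ring lra.
Set Implicit Arguments.
Unset Strict Implicit.
Unset Printing Implicit Defensive.

Import Order.TTheory GRing.Theory Num.Theory.
Import numFieldNormedType.Exports.
Local Open Scope classical_set_scope.
Local Open Scope ring_scope.

(** The stable distribution at [x] can be recognized dynamically: a tangent
    vector lies close to [E^s_x] as soon as its iterates stay bounded for a long
    time, because a component along [E^u_x] would be expanded exponentially.
    Let [x] and [y] be two points of the hyperbolic set at distance [d], and
    let [v] be a unit vector of [E^s_y], transported to [x].  As long as the
    orbits of [x] and [y] stay close, the iterates of [v] under the derivatives
    along the two orbits differ, after [m] steps, by at most a constant times
    [|Df|^m d^beta]: the derivatives at the [k]-th points differ by a multiple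
    of [(|Df|^k d)^beta], this error acts on a vector of size [lam^k], and it is
    then propagated by at most [|Df|^(m-k-1)].  Hence if [|Df|^m d^beta <= 1], the
    transported vector is bounded for [m] steps, and its unstable component has
    size at most a constant times [lam^m] ([stable_near]).  Taking
    [m = beta ln (1/d) / (ln |Df| + beta ln (1/lam))] makes this [d^alpha_s]
    ([iteration_count]).  The argument is symmetric in [x] and [y], so it bounds
    both gaps between the two subspaces, hence the distance of the orthogonal
    projections ([dG_gap]).  It also yields the angle between [E^s] and [E^u]
    from the rates alone ([splitting_angle]).  The unstable distribution of [f]
    is the stable distribution of its inverse.

    The geometric part makes sense of these comparisons.  A curve from [x] to [y]
    is carried by the iterates of [f], with speed multiplied by at most [|Df|]
    at each step, and every curve that is short enough lies in a piece of a chart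
    with uniformly bounded geometry ([short_curve_piece]).  In such a piece,
    tangent spaces along the curve are identified through the coordinates
    ([chart_transport]).  This identification differs from parallel transport by
    an error of the order of the length ([parallel_transport_near]), which is
    harmless as [alpha_s <= 1], and it almost commutes with the derivative of [f]
    ([chart_transport_holder]).  The charts being arbitrary, both facts rest on
    the transformation law of the Christoffel symbols ([koszul_transition]): it
    gives the equation of parallel transport in a fixed chart, and it bounds the
    second derivatives of transition maps by first derivatives of the metric. *)

(** * Matrix norms and derivatives of matrix-valued maps *)

Lemma mx_norm_entry (R : realType) m n (A : 'M[R]_(m, n)) i j : `|A i j| <= `|A|.
Proof.
rewrite [leRHS]/Num.Def.normr/= mx_normrE.
exact: (le_bigmax _ (fun ij : 'I_m * 'I_n => `|A ij.1 ij.2|) (i, j)).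
Qed.

Lemma mx_norm_le (R : realType) m n (A : 'M[R]_(m, n)) e : 0 <= e ->
  (forall i j, `|A i j| <= e) -> `|A| <= e.
Proof.
move=> e0 Ae; rewrite [leLHS]/Num.Def.normr/= mx_normrE.
by apply: bigmax_le => // -[i j] _; exact: Ae.
Qed.

Lemma mx_norm_mul (R : realType) m n p (A : 'M[R]_(m, n)) (B : 'M[R]_(n, p)) :
  `|A *m B| <= n%:R * `|A| * `|B|.
Proof.
apply: mx_norm_le => [|i j]; first by rewrite !mulr_ge0.
rewrite mxE (le_trans (ler_norm_sum _ _ _))//.
rewrite -mulrA mulr_natl -[n in _ *+ n]card_ord -sumr_const ler_sum// => k _.
by rewrite normrM ler_pM// mx_norm_entry.
Qed.

Lemma mx_norm_tr (R : realType) m n (A : 'M[R]_(m, n)) : `|A^T| = `|A|.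
Proof.
apply/eqP; rewrite eq_le; apply/andP; split.
  by apply: mx_norm_le => // i j; rewrite mxE mx_norm_entry.
by apply: mx_norm_le => // i j; rewrite -[A]trmxK mxE trmxK mx_norm_entry.
Qed.

Lemma is_derive_mxP (R : realType) (V : normedModType R) m n
    (M : V -> 'M[R]_(m, n)) t v (dM : 'M[R]_(m, n)) :
  is_derive t v M dM <-> forall i j, is_derive t v (fun x => M x i j) (dM i j).
Proof.
split=> [[dMt <-] i j|H].
  by rewrite derive_mx// mxE; apply: derivableP; exact: (derivable_mxP _ _ _).1.
have dMt : derivable M t v by apply/derivable_mxP => i j; have [] := H i j.
apply: DeriveDef => //; rewrite derive_mx//; apply/matrixP => i j.
by rewrite mxE; apply: derive_val.
Qed.

Lemma is_derive_mulmx (R : realType) (V : normedModType R) m n p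
    (A : V -> 'M[R]_(m, n)) (B : V -> 'M[R]_(n, p)) t v dA dB :
  is_derive t v A dA -> is_derive t v B dB ->
  is_derive t v (fun x => A x *m B x) (dA *m B t + A t *m dB).
Proof.
move=> /is_derive_mxP HA /is_derive_mxP HB; apply/is_derive_mxP => i j.
rewrite (_ : (fun x => _) = \sum_(k < n) (fun x => A x i k * B x k j)); last first.
  by apply/funext => x; rewrite mxE fct_sumE.
have H k : is_derive t v (fun x => A x i k * B x k j)
    (dA i k * B t k j + A t i k * dB k j).
  have h := @is_deriveM R V (fun x => A x i k) (fun x => B x k j) t v _ _
    (HA i k) (HB k j).
  apply: (is_derive_eq h).
  by rewrite addrC /GRing.scale/= [B t k j * _]mulrC.
have h := @is_derive_sum R V R n _ t v _ H.
apply: (is_derive_eq h).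
by rewrite !mxE -big_split.
Qed.

Lemma is_derive_trmx (R : realType) (V : normedModType R) m n
    (A : V -> 'M[R]_(m, n)) t v dA :
  is_derive t v A dA -> is_derive t v (fun x => (A x)^T) dA^T.
Proof.
move=> /is_derive_mxP HA; apply/is_derive_mxP => i j.
by rewrite mxE; under eq_fun do rewrite mxE; exact: HA.
Qed.

Lemma is_derive_comp_curve (R : realType) (V W : normedModType R)
    (F : V -> W) (g : R -> V) (t : R) dg :
  is_derive t 1 g dg -> differentiable F (g t) ->
  is_derive t 1 (F \o g) ('D_dg F (g t)).
Proof.
move=> [/derivable1_diffP dgt <-] dF; apply: DeriveDef.
  by apply/derivable1_diffP; exact: differentiable_comp.
rewrite deriveE; last exact: differentiable_comp.
by rewrite diff_comp//= deriveE// deriveE.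
Qed.

Lemma is_derive_comp_dir (R : realType) (U V W : normedModType R)
    (F : V -> W) (g : U -> V) u a :
  differentiable g u -> differentiable F (g u) ->
  is_derive u a (F \o g) ('D_('D_a g u) F (g u)).
Proof.
move=> dg dF; apply: DeriveDef.
  by apply/diff_derivable; exact: differentiable_comp.
rewrite deriveE; last exact: differentiable_comp.
by rewrite diff_comp//= deriveE// deriveE.
Qed.

Lemma jacobian_comp (R : realType) n m p (F : 'rV[R]_m -> 'rV[R]_p)
    (g : 'rV[R]_n -> 'rV[R]_m) u :
  differentiable g u -> differentiable F (g u) ->
  'J (F \o g) u = 'J g u *m 'J F (g u).
Proof.
move=> dg dF; apply/row_matrixP => i; rewrite row_mul !rowE.
rewrite -deriveEjacobian; last exact: differentiable_comp.
have [_ ->] := is_derive_comp_dir (delta_mx 0 i) dg dF.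
by rewrite deriveEjacobian// deriveEjacobian.
Qed.

Lemma jacobian_id (R : realType) n (u : 'rV[R]_n) : 'J id u = 1%:M.
Proof.
apply/row_matrixP => i; rewrite !rowE -deriveEjacobian//.
by rewrite derive_id mulmx1.
Qed.

Lemma near_eq_differentiable (R : realType) (V W : normedModType R)
    (f g : V -> W) a : {near a, f =1 g} -> differentiable f a ->
  differentiable g a.
Proof.
move=> fg df; have /diff_locallyP[dfc dfo] := df.
have gdfo : g \o shift a = cst (g a) + 'd f a +o_ 0 id.
  apply/eqaddoP => e e0; move/eqaddoP : dfo => /(_ e e0).
  have : \forall x \near (0 : V), f (x + a) = g (x + a).
    by move: fg; rewrite (near_shift 0)/= subr0.
  apply: filterS2 => x /= fgx; rewrite -[(_ - _) x]/(f (x + a) - (f a + 'd f a x)).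
  by rewrite -[(_ - _) x]/(g (x + a) - (g a + 'd f a x)) fgx (nbhs_singleton fg).
have dgE := diff_unique dfc gdfo.
by apply/diff_locallyP; split; rewrite dgE.
Qed.

Lemma near_eq_jacobian (R : realType) n m (f g : 'rV[R]_n -> 'rV[R]_m) u :
  {near u, f =1 g} -> differentiable f u -> 'J f u = 'J g u.
Proof.
move=> fg df; have dg := near_eq_differentiable fg df.
apply/row_matrixP => i; apply: (etrans (rowE _ _)).
apply: (etrans (esym (deriveEjacobian _ df))).
apply: (etrans (near_eq_derive _ fg)).
exact: (etrans (deriveEjacobian _ dg) (esym (rowE _ _))).
Qed.

(** * Symmetry of second derivatives *)

Local Opaque derive jacobian.

Lemma is_derive_line (R : realType) (V W : normedModType R) (F : V -> W)
    (u a : V) (x : R) : differentiable F (x *: a + u) ->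
  is_derive x 1 (fun y : R => F (y *: a + u)) ('D_a F (x *: a + u)).
Proof.
move=> dF; apply: (@is_derive_comp_curve _ _ _ F (fun y : R => y *: a + u)) => //.
have H : (fun h : R => h^-1 *: (((fun y : R => y *: a + u) \o shift x) (h *: 1) -
    (x *: a + u))) @ 0^' --> a.
  apply: cvg_near_cst; near=> k.
  rewrite /= opprD addrACA subrr addr0 -scalerBl addrK scaler1 scalerA.
  by rewrite mulVf ?scale1r//; near: k; exact: nbhs_dnbhs_neq.
by apply: DeriveDef; [apply/cvg_ex; exists a|exact/cvg_lim].
Unshelve. all: by end_near.
Qed.

(** The mean value theorem, applied in the direction [a] and then in the
    direction [b], turns the symmetric second difference of [h] into a value of
    a mixed second derivative. *)
Lemma second_difference (R : realType) (V : normedModType R) (h : V -> R)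
    (u a b : V) (s : R) : 0 < s ->
  (forall x y, 0 <= x <= s -> 0 <= y <= s ->
     differentiable h (x *: a + (y *: b + u)) /\
     differentiable ('D_a h) (x *: a + (y *: b + u))) ->
  exists x y, [/\ 0 < x < s, 0 < y < s &
    h (s *: a + (s *: b + u)) - h (s *: a + u) - (h (s *: b + u) - h u) =
    s ^+ 2 * 'D_b ('D_a h) (x *: a + (y *: b + u))].
Proof.
move=> s0 H.
pose p (x : R) := h (x *: a + (s *: b + u)) - h (x *: a + (0 *: b + u)).
pose dp (x : R) := 'D_a h (x *: a + (s *: b + u)) - 'D_a h (x *: a + (0 *: b + u)).
have s1 : 0 <= s <= s by rewrite (ltW s0) lexx.
have s2 : (0 : R) <= 0 <= s by rewrite (ltW s0) lexx.
have Hp x : 0 <= x <= s -> is_derive x 1 p (dp x).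
  move=> xs; apply: is_deriveB; apply: is_derive_line.
    by have [] := H x s xs s1.
  by have [] := H x 0 xs s2.
have cp : {within `[0, s], continuous p}.
  apply: derivable_within_continuous => x; rewrite in_itv/= => xs.
  by have [] := Hp x xs.
have Hp' x : x \in `]0, s[ -> is_derive x 1 p (dp x).
  by rewrite in_itv/= => /andP[/ltW x0 /ltW xs]; apply: Hp; rewrite x0.
have [x + pE] := MVT s0 Hp' cp; rewrite in_itv/= => xs.
have xs' : 0 <= x <= s by case/andP: xs => /ltW -> /ltW.
have Hq y : 0 <= y <= s ->
  is_derive y 1 (fun y : R => 'D_a h (x *: a + (y *: b + u)))
     ('D_b ('D_a h) (x *: a + (y *: b + u))).
  move=> ys; rewrite addrCA; under eq_fun do rewrite addrCA.
  apply: is_derive_line; rewrite addrCA.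
  by have [] := H x y xs' ys.
have cq : {within `[0, s], continuous (fun y : R => 'D_a h (x *: a + (y *: b + u)))}.
  apply: derivable_within_continuous => y; rewrite in_itv/= => ys.
  by have [] := Hq y ys.
have Hq' (y : R) : y \in `]0, s[ ->
  is_derive y 1 (fun y : R => 'D_a h (x *: a + (y *: b + u)))
     ('D_b ('D_a h) (x *: a + (y *: b + u))).
  by rewrite in_itv/= => /andP[/ltW y0 /ltW ys]; apply: Hq; rewrite y0.
have [y + qE] := MVT s0 Hq' cq; rewrite in_itv/= => ys.
exists x, y; split => //.
move: pE; rewrite /p /dp qE !scale0r !add0r !subr0 => ->.
by ring.
Qed.

(** Both mixed derivatives at [u] are limits of values produced by the same
    second difference, which is symmetric in [a] and [b]. *)
Lemma derive_comm (R : realType) (V : normedModType R) (h : V -> R) (u a b : V) :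
  (\forall z \near u, differentiable h z) ->
  (\forall z \near u, differentiable ('D_a h) z) ->
  (\forall z \near u, differentiable ('D_b h) z) ->
  {for u, continuous ('D_b ('D_a h))} ->
  {for u, continuous ('D_a ('D_b h))} ->
  'D_b ('D_a h) u = 'D_a ('D_b h) u.
Proof.
move=> dh dah dbh cba cab; apply/subr0_eq/eqP; rewrite -normr_le0.
apply/ler_addgt0Pr => e e0; rewrite add0r.
have e20 : 0 < e / 2 by rewrite divr_gt0.
have /cvgrPdist_lt/(_ _ e20) Hba := cba.
have /cvgrPdist_lt/(_ _ e20) Hab := cab.
have : \forall z \near u, [/\ differentiable h z, differentiable ('D_a h) z,
   differentiable ('D_b h) z, `|'D_b ('D_a h) u - 'D_b ('D_a h) z| < e / 2 &
   `|'D_a ('D_b h) u - 'D_a ('D_b h) z| < e / 2].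
  apply: filterS (filterI (filterI dh dah) (filterI dbh (filterI Hba Hab))).
  by move=> z [[h1 h2] [h3 [h4 h5]]]; exact: And5 h1 h2 h3 h4 h5.
move=> /nbhs_ballP[r /= r0 Hr].
pose s := r / (`|a| + `|b| + 1).
have k0 : 0 < `|a| + `|b| + 1 by rewrite ltr_wpDl ?addr_ge0.
have s0 : 0 < s by rewrite divr_gt0.
have Hin x y : 0 <= x <= s -> 0 <= y <= s -> ball u r (x *: a + (y *: b + u)).
  move=> /andP[x0 xs] /andP[y0 ys]; rewrite -ball_normE/= addrA distrC addrK.
  rewrite (le_lt_trans (ler_normD _ _))// !normrZ !ger0_norm//.
  rewrite (@le_lt_trans _ _ (s * (`|a| + `|b|)))//.
    by rewrite mulrDr lerD// ler_wpM2r.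
  by rewrite /s mulrAC ltr_pdivrMr// ltr_pM2l// ltrDl.
have [x1 [y1 [xs1 ys1 E1]]] : exists x y, [/\ 0 < x < s, 0 < y < s &
    h (s *: a + (s *: b + u)) - h (s *: a + u) - (h (s *: b + u) - h u) =
    s ^+ 2 * 'D_b ('D_a h) (x *: a + (y *: b + u))].
  apply: second_difference => // x y xs ys.
  by have [] := Hr _ (Hin x y xs ys).
have [y2 [x2 [ys2 xs2 E2]]] : exists x y, [/\ 0 < x < s, 0 < y < s &
    h (s *: b + (s *: a + u)) - h (s *: b + u) - (h (s *: a + u) - h u) =
    s ^+ 2 * 'D_a ('D_b h) (x *: b + (y *: a + u))].
  apply: second_difference => // y x ys xs; rewrite addrCA.
  by have [] := Hr _ (Hin x y xs ys).
have w t : 0 < t < s -> 0 <= t <= s by move=> /andP[/ltW -> /ltW].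
have [_ _ _ B1 _] := Hr _ (Hin _ _ (w _ xs1) (w _ ys1)).
have [_ _ _ _ B2] := Hr _ (Hin _ _ (w _ xs2) (w _ ys2)).
move: E1 E2 B1 B2; rewrite [s *: b + (s *: a + u)]addrCA [y2 *: b + _]addrCA.
move: ('D_b ('D_a h) (x1 *: a + _)) ('D_a ('D_b h) (x2 *: a + _)).
move: ('D_b ('D_a h) u) ('D_a ('D_b h) u) => p q p1 q1.
move: (h _) (h _) (h _) (h _) => h1 h2 h3 h4 E1 E2 B1 B2.
have E : p1 = q1.
  apply: (@mulfI _ (s ^+ 2)); first by rewrite expf_neq0// gt_eqF.
  by rewrite -E1 -E2; ring.
rewrite -(subrK p1 p) -addrA {2}E (le_trans (ler_normD _ _))//.
by rewrite (splitr e) lerD ?ltW// distrC.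
Qed.

(** * Maps of class C^2 *)

Lemma differentiable_mx (R : realType) (V : normedModType R) m n
    (M : V -> 'M[R]_(m, n)) u :
  (forall i j, differentiable (fun z => M z i j) u) -> differentiable M u.
Proof.
move=> H.
rewrite (_ : M = \sum_(i < m) \sum_(j < n) (fun z => M z i j *: delta_mx i j)); last first.
  apply/funext => z; rewrite {1}[M z]matrix_sum_delta fct_sumE.
  by apply: eq_bigr => i _; rewrite fct_sumE.
apply: differentiable_sum => i; apply: differentiable_sum => j.
exact: differentiableZl.
Qed.

Lemma differentiable_entry (R : realType) (V : normedModType R) m n
    (M : V -> 'M[R]_(m, n)) u i j :
  differentiable M u -> differentiable (fun z => M z i j) u.
Proof.
move=> dM.
exact: (differentiable_comp dM (differentiable_coord (M u) i j)).
Qed.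

Lemma continuous_entry_near (R : realType) (V : normedModType R) m n
    (G : V -> 'M[R]_(m, n)) (F : V -> R) u i j :
  {for u, continuous G} -> (\forall z \near u, G z i j = F z) ->
  {for u, continuous F}.
Proof.
move=> cG GF; rewrite /prop_for /continuous_at -(nbhs_singleton GF).
apply: (cvg_trans (near_eq_cvg GF)).
exact: (continuous_comp cG (@coord_continuous _ _ _ _ _ _)).
Qed.

(** The form in which smoothness is consumed below: everything geometric in the
    proof involves at most two derivatives of the transition maps and one of
    the metric. *)
Definition C2_near (R : realType) (V W : normedModType R) (f : V -> W) (u : V) :=
  \forall z \near u, [/\ differentiable f z, forall v, differentiable ('D_v f) z &
    forall v w, {for z, continuous ('D_w ('D_v f))}].

Lemma smooth_on_C2_near (R : realType) (V W : normedModType R) (U : set V)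
  (f : V -> W) u : nbhs u U -> smooth_on U f -> C2_near f u.
Proof.
move=> Uu /(_ 2)/= [df d2f]; apply: filterS Uu => z Uz; split.
- exact: df.
- by move=> v; have [+ _] := d2f v; exact.
- by move=> v w; have [_ /(_ w) +] := d2f v; exact.
Qed.

Lemma C2_near_nbhs (R : realType) (V W : normedModType R) (f : V -> W) u :
  C2_near f u -> \forall z \near u, C2_near f z.
Proof. exact: near_join. Qed.

Lemma C2_near_comm (R : realType) (V : normedModType R) m n
    (f : V -> 'M[R]_(m, n)) u a b :
  C2_near f u -> 'D_b ('D_a f) u = 'D_a ('D_b f) u.
Proof.
move=> Cf.
have Df i j v : \forall z \near u, 'D_v f z i j = 'D_v (fun x => f x i j) z.
  apply: filterS Cf => z [df _ _].
  by rewrite derive_mx ?mxE//; exact: diff_derivable.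
have DDf i j v w : \forall z \near u, 'D_w ('D_v f) z i j =
    'D_w ('D_v (fun x => f x i j)) z.
  have := C2_near_nbhs Cf; have := near_join (Df i j v).
  apply: filterS2 => z Dz /nbhs_singleton[_ d2f _].
  rewrite derive_mx ?mxE; last exact: diff_derivable.
  exact: near_eq_derive.
apply/matrixP => i j; apply: (etrans (nbhs_singleton (DDf i j a b))).
apply: (etrans _ (esym (nbhs_singleton (DDf i j b a)))).
have DifD v : \forall z \near u, differentiable ('D_v (fun x => f x i j)) z.
  have := Cf; have := near_join (Df i j v).
  apply: filterS2 => z Dz [_ d2f _].
  apply: (near_eq_differentiable Dz); exact: differentiable_entry.
have ContD v w : {for u, continuous ('D_w ('D_v (fun x => f x i j)))}.
  have [_ _ /(_ v w) c2] := nbhs_singleton Cf.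
  exact: (continuous_entry_near c2 (DDf i j v w)).
apply: derive_comm; [|exact: DifD|exact: DifD|exact: ContD|exact: ContD].
by apply: filterS Cf => z [df _ _]; exact: differentiable_entry.
Qed.

(** This identifies the derivative of a Jacobian with a second derivative of
    the map, so that the symmetry of second derivatives can be applied to it. *)
Lemma C2_near_jacobian (R : realType) n m (f : 'rV[R]_n -> 'rV[R]_m) u :
  C2_near f u -> differentiable (jacobian f) u /\
    forall a b, b *m 'D_a (jacobian f) u = 'D_a ('D_b f) u.
Proof.
move=> Cf.
have dJ : differentiable (jacobian f) u.
  apply: differentiable_mx => i j.
  have [_ /(_ (delta_mx 0 i)) d2f _] := nbhs_singleton Cf.
  have := differentiable_entry 0 j d2f; apply: near_eq_differentiable.
  apply: filterS Cf => z [df _ _].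
  by rewrite deriveEjacobian// -rowE mxE.
split=> // a b.
have cb : is_derive u a (fun _ : 'rV[R]_n => b) 0 by exact: is_derive_cst.
have dJ' : is_derive u a (jacobian f) ('D_a (jacobian f) u).
  by apply: derivableP; exact: diff_derivable.
have [_] := is_derive_mulmx cb dJ'; rewrite mul0mx add0r => <-.
apply: near_eq_derive; apply: filterS Cf => z [df _ _].
by rewrite deriveEjacobian.
Qed.

(** * Mean value inequality against a primitive *)

(** The function [h] bounds a speed and [H] measures length: estimates along a
    curve are all stated against [H 1 - H 0], and the integral is met only
    once, when the length of a geodesic is computed. *)
Definition primitive01 (R : realType) (h H : R -> R) :=
  (forall t : R, 0 < t < 1 -> is_derive t 1 H (h t)) /\
  {within `[0, 1], continuous H}.

Lemma primitive01_le (R : realType) (h H : R -> R) : primitive01 h H ->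
  (forall t, 0 < t < 1 -> 0 <= h t) ->
  forall s t, 0 <= s -> s <= t -> t <= 1 -> H s <= H t.
Proof.
move=> [dH cH] h0 s t s0 st t1.
apply: (@ger0_derive1_le_cc R H 0 1) => //.
- by move=> x; rewrite in_itv/= => x01; have [] := dH _ x01.
- move=> x; rewrite in_itv/= => x01; rewrite derive1E.
  by have [_ ->] := dH _ x01; exact: h0.
- by rewrite in_itv/= s0 (le_trans st).
- by rewrite in_itv/= t1 (le_trans s0).
Qed.

(** For each entry [g_ij] and each sign, [+/- g_ij - K H] has nonpositive
    derivative, hence is nonincreasing. *)
Lemma mvt_primitive_mono (R : realType) m n (g dg : R -> 'M[R]_(m, n))
    (h H : R -> R) K :
  primitive01 h H -> 0 <= K -> (forall t, 0 < t < 1 -> 0 <= h t) ->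
  (forall t : R, 0 <= t <= 1 -> is_derive t 1 g (dg t)) ->
  (forall t, 0 < t < 1 -> `|dg t| <= K * h t) ->
  forall s t, 0 <= s -> s <= t -> t <= 1 -> `|g t - g s| <= K * (H t - H s).
Proof.
move=> pH K0 h0 Dg gK s t s0 st t1.
have [dH cH] := pH.
have main i j (e : R) : `|e| = 1 ->
    e * g t i j - K * H t <= e * g s i j - K * H s.
  move=> e1.
  pose p (x : R) := e * g x i j - K * H x.
  have dgE (x : R) : 0 <= x <= 1 -> is_derive x 1 (fun x => e * g x i j) (e * dg x i j).
    move=> x01; have /is_derive_mxP/(_ i j) D := Dg x x01.
    exact: (@is_deriveZ R R R (fun x => g x i j) e x 1 _ D).
  have dp (x : R) : 0 < x < 1 -> is_derive x 1 p (e * dg x i j - K * h x).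
    move=> x01.
    have D1 : is_derive x 1 (fun x => e * g x i j) (e * dg x i j).
      by apply: dgE; case/andP: x01 => /ltW -> /ltW ->.
    have D2 := @is_deriveZ R R R H K x 1 _ (dH x x01).
    exact: (@is_deriveB R R R _ _ x 1 _ _ D1 D2).
  apply: (@ler0_derive1_le_cc R p 0 1) => //.
  - by move=> x; rewrite in_itv/= => x01; have [] := dp _ x01.
  - move=> x; rewrite in_itv/= => x01; rewrite derive1E.
    have [_ ->] := dp _ x01; rewrite subr_le0 (le_trans (ler_norm _))//.
    rewrite normrM e1 mul1r (le_trans (mx_norm_entry _ _ _))//; exact: gK.
  - have c1 : {within `[0, 1], continuous (fun x => e * g x i j)}.
      apply: derivable_within_continuous => x; rewrite in_itv/= => x01.
      by have [] := dgE x x01.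
    move=> x; apply: cvgB; first exact: c1.
    by apply: cvgM; [exact: cvg_cst|exact: cH].
  - by rewrite in_itv/= t1 (le_trans s0).
  - by rewrite in_itv/= s0 (le_trans st).
apply: mx_norm_le => [|i j].
  by rewrite mulr_ge0// subr_ge0 (primitive01_le pH).
rewrite !mxE ler_norml; apply/andP; split.
  by have := main i j (-1); rewrite normrN1 => /(_ erefl); lra.
by have := main i j 1; rewrite normr1 => /(_ erefl); lra.
Qed.

Lemma mvt_primitive (R : realType) m n (g dg : R -> 'M[R]_(m, n))
    (h H : R -> R) K :
  primitive01 h H -> 0 <= K -> (forall t, 0 < t < 1 -> 0 <= h t) ->
  (forall t : R, 0 <= t <= 1 -> is_derive t 1 g (dg t)) ->
  (forall t, 0 < t < 1 -> `|dg t| <= K * h t) ->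
  forall s t, 0 <= s <= 1 -> 0 <= t <= 1 -> `|g t - g s| <= K * (H 1 - H 0).
Proof.
move=> pH K0 h0 Dg gK s t; wlog st : s t / s <= t.
  move=> W s01 t01; have [st|/ltW ts] := leP s t; first exact: W.
  by rewrite distrC; exact: W.
move=> /andP[s0 s1] /andP[t0 t1].
apply: le_trans (mvt_primitive_mono pH K0 h0 Dg gK s0 st t1) _.
by rewrite ler_wpM2l// lerB// (primitive01_le pH).
Qed.

Lemma primitive01_integral (R : realType) (h : R -> R) :
  (forall t, 0 <= t <= 1 -> {for t, continuous h}) ->
  exists2 H, primitive01 h H &
    (\int[lebesgue_measure]_(t in `[0%R, 1%R]) (h t)%:E = (H 1 - H 0)%:E)%E.
Proof.
move=> ch.
have cw : {within `[0, 1], continuous h}.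
  apply: continuous_in_subspaceT => x; rewrite inE/= in_itv/=; exact: ch.
have ih : lebesgue_measure.-integrable `[(0 : R), 1] (EFin \o h).
  by apply: continuous_compact_integrable => //; exact: segment_compact.
pose H x := parameterized_integral lebesgue_measure 0 x h.
exists H; first split.
- move=> t /andP[t0 t1].
  have [] := @continuous_FTC1_closed R h 0 t 1 t1 ih t0.
    by apply: ch; rewrite !ltW.
  by move=> dH HE; exact: (DeriveDef dH (etrans (esym (derive1E _ _)) HE)).
- exact: parameterized_integral_continuous ler01 ih.
rewrite /H /parameterized_integral set_itv1 Rintegral_set1 subr0.
by rewrite /Rintegral fineK//; apply: integrable_fin_num.
Qed.

(** * Charts and coordinate changes *)

Section SmoothManifold.
Context {R : realType} {n : nat} {M : smoothManifold R n}.
Implicit Types (p q r z : M) (gam : R -> M).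

(** Near [chart p z] the maps [chart p] and [ichart p] are inverse to each
    other because the image of the chart is open. *)
Lemma near_ichart p z : dom p z -> \forall u \near chart p z,
  dom p (ichart p u) /\ chart p (ichart p u) = u.
Proof.
move=> pz; have : nbhs (chart p z) (chart p @` dom p).
  by apply: open_nbhs_nbhs; split; [exact: chart_open|exists z].
by apply: filterS => u [w pw <-]; rewrite chartK.
Qed.

Lemma near_ichart_pred p z (P : set M) : dom p z -> nbhs z P ->
  \forall u \near chart p z, P (ichart p u).
Proof.
move=> pz zP.
have : {for chart p z, continuous (ichart p)} by apply: ichart_continuous; exists z.
by rewrite /prop_for /continuous_at chartK//; exact.
Qed.

Lemma nbhs_dom p z : dom p z -> nbhs z (dom p).
Proof. by move=> pz; apply: open_nbhs_nbhs; split => //; exact: dom_open. Qed.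

Lemma near_ichart2 p q z : dom p z -> dom q z -> \forall u \near chart p z,
  [/\ dom p (ichart p u), dom q (ichart p u) & chart p (ichart p u) = u].
Proof.
move=> pz qz; apply: filterS2 (near_ichart pz) (near_ichart_pred pz (nbhs_dom qz)).
by move=> u [].
Qed.

Lemma transition_C2 p q z : dom p z -> dom q z ->
  C2_near (chart q \o ichart p) (chart p z).
Proof.
move=> pz qz; apply: (@smooth_on_C2_near _ _ _ (chart p @` (dom p `&` dom q))).
  apply: filterS (near_ichart2 pz qz) => u [pu qu uE].
  by exists (ichart p u).
exact: transition_smooth.
Qed.

Lemma transition_differentiable p q z : dom p z -> dom q z ->
  differentiable (chart q \o ichart p) (chart p z).
Proof. by move=> pz qz; have [] := nbhs_singleton (transition_C2 pz qz). Qed.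

Lemma tchangeE p q z :
  tchange p q z = 'J (chart q \o ichart p) (chart p z).
Proof. by []. Qed.

Lemma tchange_id p z : dom p z -> tchange p p z = 1%:M.
Proof.
move=> pz; rewrite /tchange -(jacobian_id (chart p z)).
apply: near_eq_jacobian; last exact: transition_differentiable.
by apply: filterS (near_ichart pz) => u [_ /= ->].
Qed.

Lemma tchange_comp p q r z : dom p z -> dom q z -> dom r z ->
  tchange p q z *m tchange q r z = tchange p r z.
Proof.
move=> pz qz rz; rewrite /tchange; apply/esym.
have dpq := transition_differentiable pz qz.
have dqr := transition_differentiable qz rz.
have E : (chart q \o ichart p) (chart p z) = chart q z by rewrite /= chartK.
rewrite -E in dqr *; rewrite -(jacobian_comp dpq dqr).
apply: near_eq_jacobian; last exact: transition_differentiable.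
by apply: filterS (near_ichart2 pz qz) => u [pu qu _]; rewrite /= chartK.
Qed.

Lemma tchangeK p q z : dom p z -> dom q z ->
  tchange p q z *m tchange q p z = 1%:M.
Proof. by move=> pz qz; rewrite tchange_comp// tchange_id. Qed.

End SmoothManifold.

Local Opaque tchange.

Section Riemannian.
Context {R : realType} {n : nat} {M : riemannianManifold R n}.
Implicit Types (p q z : M) (gam : R -> M) (a b c e v w : 'rV[R]_n).

(** Differentiability is asked at the single time [t]: the image of a
    differentiable curve under a map that is only differentiable is then again
    such a curve, which lets the iterates of a diffeomorphism act on curves. *)
Definition dcurve gam (t : R) : Prop :=
  {for t, continuous gam} /\ derivable (chart (gam t) \o gam) t 1.

(** The velocity is a tangent vector: its coordinates change by [tchange]. *)
Lemma dcurve_chart gam t p : dcurve gam t -> dom p (gam t) ->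
  is_derive t 1 (chart p \o gam) (velocity gam t *m tchange (gam t) p (gam t)).
Proof.
move=> [cg dg] pt; have qt := dom_self (gam t).
have dv : is_derive t 1 (chart (gam t) \o gam) (velocity gam t).
  by rewrite /velocity derive1E; exact: derivableP.
have dT := transition_differentiable qt pt.
rewrite tchangeE -(deriveEjacobian _ dT).
apply: near_eq_is_derive (is_derive_comp_curve dv dT).
have : \forall s \near t, dom (gam t) (gam s) by apply: cg; exact: nbhs_dom.
by apply: filterS => s ts; rewrite /= chartK.
Qed.

Notation lmetric := (local_metric (@metric R n M)).

Lemma local_metric_at p z : dom p z ->
  lmetric p (chart p z) = tchange p z z *m metric z *m (tchange p z z)^T.
Proof. by move=> pz; rewrite /local_metric chartK. Qed.

(** The metric tensor is a pullback under transition maps. The identity is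
    needed on a neighbourhood, since it is going to be differentiated. *)
Lemma local_metric_transition p q z : dom p z -> dom q z ->
  \forall u \near chart p z, lmetric p u =
    'J (chart q \o ichart p) u *m lmetric q ((chart q \o ichart p) u) *m
      ('J (chart q \o ichart p) u)^T.
Proof.
move=> pz qz; apply: filterS (near_ichart2 pz qz) => u [pu qu uE].
set w := ichart p u in pu qu uE *.
have -> : (chart q \o ichart p) u = chart q w by [].
have -> : 'J (chart q \o ichart p) u = tchange p q w.
  by rewrite tchangeE uE.
rewrite (local_metric_at qu) -{1}uE (local_metric_at pu).
rewrite -(tchange_comp pu qu (dom_self w)) trmx_mul.
by rewrite !mulmxA.
Qed.

Lemma local_metric_tchange p q z : dom p z -> dom q z ->
  lmetric p (chart p z) =
    tchange p q z *m lmetric q (chart q z) *m (tchange p q z)^T.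
Proof.
move=> pz qz; rewrite (local_metric_at qz) (local_metric_at pz).
by rewrite -(tchange_comp pz qz (dom_self z)) trmx_mul !mulmxA.
Qed.

Lemma local_metric_C2 p z : dom p z -> C2_near (lmetric p) (chart p z).
Proof.
move=> pz; apply: (@smooth_on_C2_near _ _ _ (chart p @` dom p)).
  by apply: open_nbhs_nbhs; split; [exact: chart_open|exists z].
exact: metric_smooth.
Qed.

Lemma local_metric_sym p z : dom p z -> (lmetric p (chart p z))^T = lmetric p (chart p z).
Proof.
by move=> pz; rewrite (local_metric_at pz) !trmx_mul trmxK Defs.metric_sym mulmxA.
Qed.

Lemma local_metric_pos p z v : dom p z -> v != 0 ->
  0 < (v *m lmetric p (chart p z) *m v^T) 0 0.
Proof.
move=> pz v0; rewrite (local_metric_at pz).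
have -> : v *m (tchange p z z *m metric z *m (tchange p z z)^T) *m v^T =
  (v *m tchange p z z) *m metric z *m (v *m tchange p z z)^T.
  by rewrite trmx_mul !mulmxA.
apply: metric_pos; apply: contra_neq v0 => E.
by rewrite -[v]mulmx1 -(tchangeK pz (dom_self z)) mulmxA E mul0mx.
Qed.

Lemma local_metric_unit p z : dom p z -> lmetric p (chart p z) \in unitmx.
Proof.
move=> pz; rewrite -row_free_unit -kermx_eq0; apply/rowV0P => v /sub_kermxP vG.
apply/eqP; apply: contraT => v0; have := local_metric_pos pz v0.
by rewrite vG mul0mx mxE ltxx.
Qed.

End Riemannian.

(** * The Levi-Civita connection under a change of coordinates *)

Lemma mx11_form (R : realType) n (v w : 'rV[R]_n) (A : 'M[R]_n) :
  (v *m A *m w^T) 0 0 = \sum_i \sum_j v 0 i * A i j * w 0 j.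
Proof.
rewrite mxE exchange_big/=; apply: eq_bigr => j _.
by rewrite !mxE mulr_suml.
Qed.

(** The right-hand side of the Koszul formula for constant vector fields: the
    Christoffel symbols of the metric [G], with the upper index lowered,
    contracted with [a], [b] and [c]. *)
Definition koszul (R : realType) n (G : 'rV[R]_n -> 'M[R]_n) (u a b c : 'rV[R]_n) : R :=
  2^-1 * ((b *m 'D_a G u *m c^T) 0 0 + (a *m 'D_b G u *m c^T) 0 0
          - (a *m 'D_c G u *m b^T) 0 0).

Lemma derive_dir_sum (R : realType) n m p (G : 'rV[R]_n -> 'M[R]_(m, p)) u a :
  differentiable G u -> 'D_a G u = \sum_i a 0 i *: 'D_(delta_mx 0 i) G u.
Proof.
move=> dG; rewrite (deriveE _ dG) {1}[a]row_sum_delta linear_sum/=.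
by apply: eq_bigr => i _; rewrite linearZ/= (deriveE _ dG).
Qed.

Lemma koszul_sum (R : realType) n (G : 'rV[R]_n -> 'M[R]_n) u a b c
    (dG : 'I_n -> 'M[R]_n) :
  (forall v, 'D_v G u = \sum_i v 0 i *: dG i) ->
  koszul G u a b c = \sum_l (2^-1 * \sum_i \sum_j
    (dG i j l + dG j i l - dG l i j) * a 0 i * b 0 j) * c 0 l.
Proof.
move=> DG; rewrite /koszul !DG !mx11_form.
have E1 (x y z : 'rV[R]_n) : \sum_j \sum_l y 0 j * (\sum_i x 0 i *: dG i) j l * z 0 l =
    \sum_l \sum_i \sum_j dG i j l * x 0 i * y 0 j * z 0 l.
  rewrite exchange_big/=; apply: eq_bigr => l _.
  rewrite exchange_big/=; apply: eq_bigr => j _.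
  rewrite summxE mulr_sumr mulr_suml; apply: eq_bigr => i _.
  by rewrite !mxE; ring.
rewrite (E1 a b c) (E1 b a c) (E1 c a b).
have E2 : \sum_l \sum_i \sum_j dG i j l * c 0 i * a 0 j * b 0 l =
          \sum_l \sum_i \sum_j dG l i j * a 0 i * b 0 j * c 0 l.
  rewrite exchange_big/=; apply: eq_bigr => l _.
  rewrite exchange_big/=; apply: eq_bigr => i _.
  by apply: eq_bigr => j _; ring.
rewrite E2 -big_split/= -sumrB mulr_sumr; apply: eq_bigr => l _.
rewrite -mulrA; congr (_ * _).
have E3 : \sum_i \sum_j dG i j l * b 0 i * a 0 j * c 0 l =
          \sum_i \sum_j dG j i l * a 0 i * b 0 j * c 0 l.
  rewrite exchange_big/=; apply: eq_bigr => i _.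
  by apply: eq_bigr => j _; ring.
rewrite E3 -big_split/= -sumrB mulr_suml; apply: eq_bigr => i _.
rewrite -big_split/= -sumrB mulr_suml; apply: eq_bigr => j _.
by ring.
Qed.

Lemma koszul_bound (R : realType) n (G : 'rV[R]_n -> 'M[R]_n) u B a b c :
  0 <= B -> (forall v, `|'D_v G u| <= B * `|v|) ->
  `|koszul G u a b c| <= 2 * n%:R ^+ 2 * B * `|a| * `|b| * `|c|.
Proof.
move=> B0 DB.
have E (x y z : 'rV[R]_n) : `|(y *m 'D_x G u *m z^T) 0 0| <= n%:R ^+ 2 * B * `|x| * `|y| * `|z|.
  rewrite (le_trans (mx_norm_entry _ _ _))// (le_trans (mx_norm_mul _ _))//.
  rewrite mx_norm_tr ler_wpM2r//.
  rewrite (@le_trans _ _ (n%:R * (n%:R * `|y| * (B * `|x|))))//; last first.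
    by rewrite le_eqVlt; apply/orP; left; apply/eqP; ring.
  rewrite ler_wpM2l// (le_trans (mx_norm_mul _ _))// ler_wpM2l//.
have H (x y z k : R) : `|x| <= k -> `|y| <= k -> `|z| <= k ->
    `|2^-1 * (x + y - z)| <= 2 * k.
  by rewrite !ler_norml => /andP[? ?] /andP[? ?] /andP[? ?]; apply/andP; split; lra.
rewrite (_ : 2 * n%:R ^+ 2 * B * `|a| * `|b| * `|c| =
  2 * (n%:R ^+ 2 * B * `|a| * `|b| * `|c|)); last by ring.
apply: H; first exact: E.
  by apply: (le_trans (E b a c)); rewrite le_eqVlt; apply/orP; left; apply/eqP; ring.
by apply: (le_trans (E c a b)); rewrite le_eqVlt; apply/orP; left; apply/eqP; ring.
Qed.

Lemma form_sym (R : realType) n (G : 'M[R]_n) (v w : 'rV[R]_n) :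
  G^T = G -> (v *m G *m w^T) 0 0 = (w *m G *m v^T) 0 0.
Proof.
move=> GT; rewrite -[v *m G *m w^T]trmxK mxE; congr (_ 0 0).
by rewrite !trmx_mul trmxK GT mulmxA.
Qed.

(** The transformation law of the lowered Christoffel symbols. Differentiating
    the pullback [J G J^T] in the direction [a] gives a tensorial term and two
    terms in the second derivative [T]; in the Koszul combination the latter
    cancel, by symmetry of [T] and of [G], except for one copy of [b T(a) G (c
    J)^T]. *)
Lemma koszul_pullback (R : realType) n (G J : 'M[R]_n) (T P Q : 'rV[R]_n -> 'M[R]_n) :
  G^T = G -> (forall a b, b *m T a = a *m T b) ->
  (forall a, P a = T a *m G *m J^T + J *m Q (a *m J) *m J^T + J *m G *m (T a)^T) ->
  forall a b c, 2^-1 * ((b *m P a *m c^T) 0 0 + (a *m P b *m c^T) 0 0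
          - (a *m P c *m b^T) 0 0) =
    2^-1 * ((b *m J *m Q (a *m J) *m (c *m J)^T) 0 0 +
            (a *m J *m Q (b *m J) *m (c *m J)^T) 0 0 -
            (a *m J *m Q (c *m J) *m (b *m J)^T) 0 0) +
    (b *m T a *m G *m (c *m J)^T) 0 0.
Proof.
move=> GT TC PE a b c.
have E x y z : (y *m P x *m z^T) 0 0 = (y *m T x *m G *m (z *m J)^T) 0 0 +
    (y *m J *m Q (x *m J) *m (z *m J)^T) 0 0 + (y *m J *m G *m (z *m T x)^T) 0 0.
  by rewrite PE !mulmxDr !mulmxDl !trmx_mul !mulmxA !mxE.
rewrite !E (TC b a) (TC c a) (TC c b).
rewrite (form_sym (b *m J) (c *m T a) GT).
by lra.
Qed.

Section LeviCivita.
Context {R : realType} {n : nat} {M : riemannianManifold R n}.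
Implicit Types (p q z : M) (gam : R -> M) (a b c e v w : 'rV[R]_n).
Notation lmetric := (local_metric (@metric R n M)).

Lemma christoffel_koszul p z a b c : dom p z ->
  ((\row_k \sum_i \sum_j christoffel p (chart p z) k i j * a 0 i * b 0 j)
    *m lmetric p (chart p z) *m c^T) 0 0 = koszul (lmetric p) (chart p z) a b c.
Proof.
move=> pz; have [dG _ _] := nbhs_singleton (local_metric_C2 pz).
have uG := local_metric_unit pz; have sG := local_metric_sym pz.
set u := chart p z in dG uG sG *; set G := lmetric p in dG uG sG *.
pose D i := 'D_(delta_mx 0 i) G u.
have DE i j k : 'D_(delta_mx 0 i) (fun w => G w j k) u = D i j k.
  rewrite /D derive_mx ?mxE//; exact: diff_derivable.
rewrite (@koszul_sum _ _ G u a b c D); last by move=> v; exact: derive_dir_sum.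
pose X : 'rV[R]_n := \row_l (2^-1 * \sum_i \sum_j
    (D i j l + D j i l - D l i j) * a 0 i * b 0 j).
have -> : \row_k \sum_i \sum_j christoffel p u k i j * a 0 i * b 0 j =
    X *m invmx (G u).
  have sGi : (invmx (G u))^T = invmx (G u) by rewrite trmx_inv sG.
  apply/rowP => k; rewrite !mxE.
  under [RHS]eq_bigr => l _.
    rewrite !mxE -sGi mxE.
    rewrite mulr_sumr mulr_suml.
    under eq_bigr do rewrite mulr_sumr mulr_suml.
    over.
  rewrite [RHS]exchange_big/=; apply: eq_bigr => i _.
  rewrite [RHS]exchange_big/=; apply: eq_bigr => j _.
  rewrite /christoffel -/G mulr_sumr !mulr_suml; apply: eq_bigr => l _.
  by rewrite !DE; ring.
rewrite mulmxKV// mxE; apply: eq_bigr => l _.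
by rewrite [X 0 l]mxE mxE.
Qed.

(** Besides transporting the connection between charts, this identity expresses
    the second derivatives of a transition map through first derivatives of the
    metrics in the two charts. *)
Lemma koszul_transition p q z a b c : dom p z -> dom q z ->
  koszul (lmetric p) (chart p z) a b c =
  koszul (lmetric q) (chart q z) (a *m tchange p q z) (b *m tchange p q z)
    (c *m tchange p q z) +
  (b *m 'D_a (jacobian (chart q \o ichart p)) (chart p z) *m
    lmetric q (chart q z) *m (c *m tchange p q z)^T) 0 0.
Proof.
move=> pz qz.
have [dJ JE] := C2_near_jacobian (transition_C2 pz qz).
have phiE : (chart q \o ichart p) (chart p z) = chart q z by rewrite /= chartK.
have dphi := transition_differentiable pz qz.
have [dG _ _] := nbhs_singleton (local_metric_C2 qz).
pose T a := 'D_a (jacobian (chart q \o ichart p)) (chart p z).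
rewrite /koszul; apply: (@koszul_pullback _ _ _ _ T (fun a => 'D_a (lmetric p) (chart p z))
  (fun a => 'D_a (lmetric q) (chart q z))).
- exact: local_metric_sym.
- move=> v w; rewrite /T; apply: (etrans (JE v w)); apply: (etrans _ (esym (JE w v))).
  exact: C2_near_comm (transition_C2 pz qz).
move=> v.
have D1 : is_derive (chart p z) v (jacobian (chart q \o ichart p)) (T v).
  by apply: derivableP; exact: diff_derivable.
have D2 : is_derive (chart p z) v (lmetric q \o (chart q \o ichart p))
    ('D_(v *m tchange p q z) (lmetric q) (chart q z)).
  have dG' : differentiable (lmetric q) ((chart q \o ichart p) (chart p z)).
    by rewrite phiE.
  rewrite tchangeE -(deriveEjacobian v dphi) -phiE.
  exact: is_derive_comp_dir dphi dG'.
have D := is_derive_mulmx (is_derive_mulmx D1 D2) (is_derive_trmx D1).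
have N := local_metric_transition pz qz.
apply: (etrans (near_eq_derive v N)).
case: D => _ DE; apply: (etrans DE).
rewrite -(tchangeE p q z); move: ('D_(v *m _) _ _) (T v) => Qv Tv.
by rewrite [(lmetric q \o _) _]/= chartK// mulmxDl.
Qed.

(** [parallel_at] is written at each time in the chart attached to the current
    point of the curve, and these charts are unrelated to each other. By the
    transformation law the same equation holds in any fixed chart. It is stated
    against test vectors [e], so that the Christoffel symbols of the fixed
    chart never have to be written. *)
Lemma parallel_chart gam (V : R -> 'rV[R]_n) (t : R) p :
  dcurve gam t -> parallel_at gam V t -> dom p (gam t) ->
  exists2 dW : 'rV[R]_n,
    is_derive t 1 (fun s => V s *m tchange (gam s) p (gam s)) dW &
    forall e, (dW *m lmetric p (chart p (gam t)) *m e^T) 0 0 =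
      - koszul (lmetric p) (chart p (gam t))
          (velocity gam t *m tchange (gam t) p (gam t))
          (V t *m tchange (gam t) p (gam t)) e.
Proof.
move=> dg Vt pt; set q := gam t; set z := gam t.
have qt : dom q z := dom_self (gam t).
have [cg _] := dg.
have dq := dcurve_chart dg qt.
rewrite -/q -/z (tchange_id qt) mulmx1 in dq.
have [dJ JE] := C2_near_jacobian (transition_C2 qt pt).
have DJ := is_derive_comp_curve dq dJ.
pose Gam := \row_k \sum_i \sum_j
  christoffel q (chart q z) k i j * velocity gam t 0 i * V t 0 j.
have Vt' : is_derive t 1 (fun s => V s *m tchange (gam s) q (gam s)) (- Gam) := Vt.
have D := is_derive_mulmx Vt' DJ.
pose S := V t *m 'D_(velocity gam t) (jacobian (chart p \o ichart q)) (chart q z).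
exists (- Gam *m tchange q p z + S).
  have -> : - Gam *m tchange q p z + S = - Gam *m (jacobian (chart p \o ichart q) \o (chart q \o gam)) t +
    V t *m tchange (gam t) (gam t) (gam t) *m
      'D_(velocity gam t) (jacobian (chart p \o ichart q)) ((chart q \o gam) t).
    by rewrite (tchange_id qt) mulmx1.
  apply: near_eq_is_derive D.
  have : \forall s \near t, dom q (gam s) by apply: cg; exact: nbhs_dom.
  have : \forall s \near t, dom p (gam s) by apply: cg; exact: nbhs_dom.
  apply: filterS2 => s ps qs /=.
  rewrite -mulmxA; congr (_ *m _).
  by rewrite -(tchange_comp (dom_self (gam s)) qs ps).
move=> e; have [e' ->] : exists e', e = e' *m tchange q p z.
  by exists (e *m tchange p q z); rewrite -mulmxA (tchangeK pt qt) mulmx1.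
rewrite mulmxDl mulmxDl mxE mulNmx mulNmx mulNmx mxE.
have K1 := christoffel_koszul (velocity gam t) (V t) e' qt.
have K2 := koszul_transition (velocity gam t) (V t) e' qt pt.
rewrite (local_metric_tchange qt pt) in K1.
have -> : Gam *m tchange q p z *m lmetric p (chart p z) *m (e' *m tchange q p z)^T =
  Gam *m (tchange q p z *m lmetric p (chart p z) *m (tchange q p z)^T) *m e'^T.
  by rewrite trmx_mul !mulmxA.
have H (x k s : R) : x = k + s -> - x + s = - k by move=> ->; ring.
exact: (H _ _ _ (etrans K1 K2)).
Qed.

End LeviCivita.

(** * Euclidean geometry of the tangent spaces *)

Lemma form_le (R : realType) n (G : 'M[R]_n) (v w : 'rV[R]_n) :
  `|(v *m G *m w^T) 0 0| <= n%:R ^+ 2 * `|G| * `|v| * `|w|.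
Proof.
rewrite (le_trans (mx_norm_entry _ _ _))// (le_trans (mx_norm_mul _ _))//.
rewrite mx_norm_tr ler_wpM2r//.
rewrite (_ : n%:R ^+ 2 * `|G| * `|v| = n%:R * (n%:R * `|v| * `|G|)); last by ring.
by rewrite ler_wpM2l// mx_norm_mul.
Qed.

Section MatrixLimits.
Context {R : realType} {T : Type} (F : set_system T) {FF : Filter F}.

Lemma cvg_mxP m n (A : T -> 'M[R]_(m, n)) (a : 'M[R]_(m, n)) :
  (A x @[x --> F] --> a) <-> (forall i j, A x i j @[x --> F] --> a i j).
Proof.
split=> [Aa i j|Aa].
  apply/cvgrPdist_le => e e0; move/cvgrPdist_le : Aa => /(_ e e0).
  apply: filterS => x; apply: le_trans.
  by have := mx_norm_entry (a - A x) i j; rewrite !mxE.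
apply/cvgrPdist_le => e e0.
have H : \forall x \near F, forall i j, `|a i j - A x i j| <= e.
  apply: filter_forall => i; apply: filter_forall => j.
  exact: (cvgrPdist_le _ _).1 (Aa i j) e e0.
apply: filterS H => x Hx; apply: mx_norm_le => [|i j]; first exact: ltW.
by rewrite !mxE.
Qed.

Lemma cvg_mulmx m n p (A : T -> 'M[R]_(m, n)) (B : T -> 'M[R]_(n, p))
    (a : 'M[R]_(m, n)) (b : 'M[R]_(n, p)) :
  A x @[x --> F] --> a -> B x @[x --> F] --> b ->
  (A x *m B x) @[x --> F] --> a *m b.
Proof.
move=> /cvg_mxP Aa /cvg_mxP Bb; apply/cvg_mxP => i j.
under eq_cvg do rewrite mxE.
rewrite mxE; apply: (@cvg_big R _ _ _ _ add_continuous) => k _.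
by apply: cvgM; [exact: Aa|exact: Bb].
Qed.

Lemma cvg_trmx m n (A : T -> 'M[R]_(m, n)) (a : 'M[R]_(m, n)) :
  A x @[x --> F] --> a -> (A x)^T @[x --> F] --> a^T.
Proof.
move=> /cvg_mxP Aa; apply/cvg_mxP => i j; rewrite mxE.
by under eq_cvg do rewrite mxE; exact: Aa.
Qed.

End MatrixLimits.

(** The quadratic form attains a positive minimum on the unit sphere. *)
Lemma posdef_lower (R : realType) n (G : 'M[R]_n) :
  (forall v : 'rV[R]_n, v != 0 -> 0 < (v *m G *m v^T) 0 0) ->
  exists2 m, 0 < m & forall v : 'rV[R]_n, m * `|v| ^+ 2 <= (v *m G *m v^T) 0 0.
Proof.
move=> Gpos.
pose f (v : 'rV[R]_n) := (v *m G *m v^T) 0 0.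
have cf : continuous f.
  move=> v.
  have H : (w *m G *m w^T) @[w --> v] --> v *m G *m v^T.
    apply: (@cvg_mulmx _ _ (nbhs v)).
      by apply: (@cvg_mulmx _ _ (nbhs v)); [exact: cvg_id|exact: cvg_cst].
    by apply: (@cvg_trmx _ _ (nbhs v)); exact: cvg_id.
  by have /(@cvg_mxP _ _ (nbhs v)) := H; apply.
pose A := [set v : 'rV[R]_n | `|v| = 1].
have cA : compact A.
  apply: bounded_closed_compact.
    by exists 1; split => // x x1 v /= ->; exact: ltW.
  have -> : A = (fun v : 'rV[R]_n => `|v|) @^-1` [set 1] by [].
  apply: closed_comp; last exact: closed_eq.
  by move=> v _; exact: norm_continuous.
have [[v0 Av0]|A0] := pselect (A !=set0); last first.
  exists 1 => // v; have [->|vn0] := eqVneq v 0.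
    by rewrite normr0 expr0n mulr0 mul0mx mul0mx mxE.
  exfalso; apply: A0; exists (`|v|^-1 *: v) => /=.
  by rewrite /A/= normrZ ger0_norm ?invr_ge0// mulVf// normr_eq0.
have A0 : A !=set0 by exists v0.
have cfA : {within A, continuous f} by exact: continuous_subspaceT.
have [c cA1 cmin] := EVT_min_rV A0 cA cfA.
rewrite inE in cA1.
have c0 : c != 0 by rewrite -normr_eq0 cA1 oner_neq0.
exists (f c); first exact: Gpos.
move=> v; have [->|vn0] := eqVneq v 0.
  by rewrite normr0 expr0n mulr0 mul0mx mul0mx mxE.
have nv0 : `|v| != 0 by rewrite normr_eq0.
have : f c <= f (`|v|^-1 *: v).
  apply: cmin; rewrite inE /A /= normrZ ger0_norm ?invr_ge0// mulVf//.
rewrite /f -!scalemxAl linearZ/= -scalemxAr !mxE mulrA => H.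
rewrite -ler_pdivlMr ?exprn_gt0 ?normr_gt0//.
by apply: (le_trans H); rewrite [leRHS]mulrC expr2 invfM.
Qed.

Section TangentSpace.
Context {R : realType} {n : nat} {M : riemannianManifold R n}.
Implicit Types (p q z : M) (v w : 'rV[R]_n) (E F A : 'M[R]_n).

Definition ip p v w : R := (v *m metric p *m w^T) 0 0.

Lemma ipC p v w : ip p v w = ip p w v.
Proof. exact: form_sym (Defs.metric_sym p). Qed.

Lemma ipDl p v v' w : ip p (v + v') w = ip p v w + ip p v' w.
Proof. by rewrite /ip !mulmxDl mxE. Qed.

Lemma ipZl p k v w : ip p (k *: v) w = k * ip p v w.
Proof. by rewrite /ip -!scalemxAl mxE. Qed.

Lemma ipNl p v w : ip p (- v) w = - ip p v w.
Proof. by rewrite -scaleN1r ipZl mulN1r. Qed.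

Lemma ipBl p v v' w : ip p (v - v') w = ip p v w - ip p v' w.
Proof. by rewrite ipDl ipNl. Qed.

Lemma ipBr p v w w' : ip p v (w - w') = ip p v w - ip p v w'.
Proof. by rewrite ipC ipBl !(ipC p v). Qed.

Lemma ip_ge0 p v : 0 <= ip p v v.
Proof.
have [->|v0] := eqVneq v 0; first by rewrite /ip !mul0mx mxE.
exact/ltW/Defs.metric_pos.
Qed.

Lemma tnorm_ge0 p v : 0 <= tnorm p v. Proof. exact: sqrtr_ge0. Qed.

Lemma tnorm_sqr p v : tnorm p v ^+ 2 = ip p v v.
Proof. by rewrite sqr_sqrtr// ip_ge0. Qed.

Lemma tnorm_eq0 p v : tnorm p v = 0 -> v = 0.
Proof.
move=> v0; apply/eqP; apply: contraT => /(@metric_pos _ _ M p).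
by rewrite -/(ip p v v) -tnorm_sqr v0 expr0n ltxx.
Qed.

Lemma tnormZ p k v : tnorm p (k *: v) = `|k| * tnorm p v.
Proof.
apply/eqP; rewrite -(@eqrXn2 _ 2)// ?mulr_ge0 ?tnorm_ge0//.
by rewrite exprMn !tnorm_sqr ipZl ipC ipZl real_normK ?num_real// mulrA -expr2.
Qed.

Lemma tnorm0 p : tnorm p 0 = 0.
Proof. by rewrite -(scale0r 0) tnormZ normr0 mul0r. Qed.

Lemma tnormN p v : tnorm p (- v) = tnorm p v.
Proof. by rewrite -scaleN1r tnormZ normrN1 mul1r. Qed.

(** The form is nonnegative at [v - t w] for [t = <v, w> / <w, w>]. *)
Lemma ip_cauchy_schwarz p v w : ip p v w <= tnorm p v * tnorm p w.
Proof.
have [->|w0] := eqVneq w 0; first by rewrite ipC /ip !mul0mx mxE mulr_ge0 ?tnorm_ge0.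
have ww : 0 < ip p w w by exact: Defs.metric_pos.
pose t := ip p v w / ip p w w.
have E : ip p (v - t *: w) (v - t *: w) = ip p v v - ip p v w ^+ 2 / ip p w w.
  rewrite ipBl !ipBr (ipC p v (t *: w)) !ipZl (ipC p w (t *: w)) ipZl (ipC p w v).
  by rewrite /t; field; rewrite gt_eqF.
have H : ip p v w ^+ 2 <= ip p v v * ip p w w.
  by have := ip_ge0 p (v - t *: w); rewrite E subr_ge0 ler_pdivrMr.
rewrite (le_trans (ler_norm _))//.
rewrite -(@ler_pXn2r _ 2)// ?nnegrE ?mulr_ge0 ?tnorm_ge0//.
by rewrite real_normK ?num_real// exprMn !tnorm_sqr.
Qed.

Lemma tnormD p v w : tnorm p (v + w) <= tnorm p v + tnorm p w.
Proof.
rewrite -(@ler_pXn2r _ 2)// ?nnegrE ?addr_ge0 ?tnorm_ge0//.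
rewrite tnorm_sqr ipDl (ipC p v) (ipC p w) !ipDl sqrrD !tnorm_sqr (ipC p w v).
have := ip_cauchy_schwarz p v w; lra.
Qed.

Lemma tnormB p v w : tnorm p (v - w) <= tnorm p v + tnorm p w.
Proof. by rewrite -[tnorm p w]tnormN tnormD. Qed.

Lemma tnorm_lower p : exists2 m, 0 < m & forall v, m * `|v| <= tnorm p v.
Proof.
have [m m0 H] := posdef_lower (@metric_pos _ _ M p).
exists (Num.sqrt m); first by rewrite sqrtr_gt0.
move=> v; rewrite -(@ler_pXn2r _ 2)// ?nnegrE ?mulr_ge0 ?sqrtr_ge0 ?tnorm_ge0//.
by rewrite exprMn sqr_sqrtr ?(ltW m0)// tnorm_sqr; exact: H.
Qed.

Lemma tnorm_upper p : exists2 K, 0 < K & forall v, tnorm p v <= K * `|v|.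
Proof.
exists (1 + n%:R ^+ 2 * `|metric p|).
  by rewrite ltr_wpDr// mulr_ge0.
move=> v; rewrite -(@ler_pXn2r _ 2)// ?nnegrE ?tnorm_ge0 ?mulr_ge0 ?addr_ge0 ?mulr_ge0//.
rewrite tnorm_sqr (le_trans (ler_norm _))// (le_trans (form_le _ _ _))//.
have k0 : 0 <= n%:R ^+ 2 * `|metric p| by rewrite mulr_ge0.
rewrite -mulrA -expr2 exprMn ler_wpM2r ?exprn_ge0//.
by move: (n%:R ^+ 2 * _) k0 => k k0; nra.
Qed.

Lemma lin_bounded p q A : exists2 K, 0 < K &
  forall v, tnorm q (v *m A) <= K * tnorm p v.
Proof.
have [m m0 Hm] := tnorm_lower p; have [K K0 HK] := tnorm_upper q.
exists (K * (1 + n%:R * `|A|) / m).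
  by rewrite divr_gt0// mulr_gt0// ltr_wpDr// mulr_ge0.
move=> v; rewrite (le_trans (HK _))// -!mulrA ler_pM2l//.
rewrite (le_trans (mx_norm_mul _ _))//.
rewrite (@le_trans _ _ (n%:R * `|A| * `|v|))//; first by rewrite mulrAC.
rewrite ler_pM ?mulr_ge0// ?lerDr//.
by rewrite mulrC ler_pdivlMr// mulrC.
Qed.

Lemma opnorm_bound p q A v : tnorm q (v *m A) <= opnorm p q A * tnorm p v.
Proof.
have [K K0 HK] := lin_bounded p q A.
set S := [set tnorm q (v *m A) | v in [set v | tnorm p v <= 1]].
have supS : has_sup S.
  split; first by exists (tnorm q (0 *m A)), 0 => //=; rewrite tnorm0.
  exists K => _ [w /= w1 <-]; rewrite (le_trans (HK _))//.
  by rewrite -[leRHS]mulr1 ler_pM2l.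
have [->|v0] := eqVneq v 0; first by rewrite mul0mx !tnorm0 mulr0.
have nv : 0 < tnorm p v.
  rewrite lt_neqAle tnorm_ge0 andbT eq_sym.
  by apply: contra_neq v0; exact: tnorm_eq0.
rewrite -ler_pdivrMr//.
have E : tnorm q (v *m A) / tnorm p v = tnorm q (((tnorm p v)^-1 *: v) *m A).
  by rewrite -scalemxAl tnormZ ger0_norm ?invr_ge0 ?tnorm_ge0// mulrC.
rewrite E; apply: (sup_upper_bound supS); exists ((tnorm p v)^-1 *: v) => //=.
by rewrite tnormZ ger0_norm ?invr_ge0 ?tnorm_ge0// mulVf ?gt_eqF.
Qed.

Lemma opnorm_ge0 p q A : 0 <= opnorm p q A.
Proof.
have [K K0 HK] := lin_bounded p q A.
apply: ub_le_sup; last by exists 0 => /=; rewrite ?mul0mx ?tnorm0.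
exists K => _ [w /= w1 <-]; rewrite (le_trans (HK _))//.
by rewrite -[leRHS]mulr1 ler_pM2l.
Qed.

Lemma opnorm_le p q A K : 0 <= K ->
  (forall v, tnorm q (v *m A) <= K * tnorm p v) -> opnorm p q A <= K.
Proof.
move=> K0 HK; apply: ge_sup.
  by exists (tnorm q (0 *m A)), 0 => //=; rewrite tnorm0.
move=> _ [w /= w1 <-]; rewrite (le_trans (HK _))//.
by rewrite -[leRHS]mulr1 ler_wpM2l.
Qed.

Section OrthogonalProjection.
Context (p : M) (E : 'M[R]_n).
Let K := kermx (metric p *m E^T).

Lemma orthogonal_kermx v w : (v <= K)%MS -> (w <= E)%MS -> ip p v w = 0.
Proof.
move=> /sub_kermxP vK /submxP[d ->].
by rewrite /ip trmx_mul !mulmxA -(mulmxA v) vK mul0mx mxE.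
Qed.

Lemma metric_unit : metric p \in unitmx.
Proof.
rewrite -row_free_unit -kermx_eq0; apply/rowV0P => v /sub_kermxP vG.
apply/eqP; apply: contraT => v0; have := @metric_pos _ _ M p v v0.
by rewrite vG mul0mx mxE ltxx.
Qed.

Lemma orthogonal_capmx0 : (E :&: K)%MS = 0.
Proof.
apply/eqP/rowV0P => v; rewrite sub_capmx => /andP[vE vK].
by apply: (@tnorm_eq0 p); rewrite /tnorm -/(ip p v v) orthogonal_kermx// sqrtr0.
Qed.

(** The orthogonal complement has complementary dimension because the metric is
    invertible, and it meets [E] trivially. *)
Lemma orthogonal_full v : (v <= E + K)%MS.
Proof.
apply: submx_full; rewrite /row_full.
have : \rank (E + K) = (\rank E + \rank K)%N.
  have := mxrank_sum_cap E K; rewrite orthogonal_capmx0 mxrank0 addn0 => //.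
move=> ->; rewrite mxrank_ker -(mxrank_tr (metric p *m E^T)) trmx_mul trmxK.
rewrite (mxrankMfree E); last by rewrite row_free_unit unitmx_tr metric_unit.
by rewrite subnKC// rank_leq_row.
Qed.

Lemma oproj_sub v : (v *m oproj p E <= E)%MS.
Proof. exact: proj_mx_sub. Qed.

Lemma oproj_orthogonal v w : (w <= E)%MS -> ip p (v - v *m oproj p E) w = 0.
Proof.
by apply: orthogonal_kermx; apply: proj_mx_compl_sub; exact: orthogonal_full.
Qed.

Lemma oproj_pythagoras v : tnorm p v ^+ 2 =
  tnorm p (v *m oproj p E) ^+ 2 + tnorm p (v - v *m oproj p E) ^+ 2.
Proof.
set w := v *m _; have H := oproj_orthogonal v (oproj_sub v); rewrite -/w in H.
rewrite !tnorm_sqr [ip p (v - w) (v - w)]ipBr H subr0.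
have -> : ip p (v - w) v = ip p v v - ip p w w - ip p (v - w) w.
  by rewrite !ipBl (ipC p w v); ring.
by rewrite H; ring.
Qed.

Lemma oproj_tnorm_le v : tnorm p (v *m oproj p E) <= tnorm p v.
Proof.
rewrite -(@ler_pXn2r _ 2)// ?nnegrE ?tnorm_ge0//.
by rewrite [leRHS]oproj_pythagoras lerDl sqr_ge0.
Qed.

Lemma oproj_compl_tnorm_le v : tnorm p (v - v *m oproj p E) <= tnorm p v.
Proof.
rewrite -(@ler_pXn2r _ 2)// ?nnegrE ?tnorm_ge0//.
by rewrite [leRHS]oproj_pythagoras lerDr sqr_ge0.
Qed.

Lemma oproj_best v w : (w <= E)%MS ->
  tnorm p (v - v *m oproj p E) <= tnorm p (v - w).
Proof.
move=> wE.
have wP : w *m oproj p E = w by apply: proj_mx_id => //; exact: orthogonal_capmx0.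
have := oproj_compl_tnorm_le (v - w); rewrite mulmxBl wP.
by rewrite opprB addrA subrK.
Qed.

End OrthogonalProjection.

Lemma dG_le2 p E F : dG p E F <= 2.
Proof.
apply: opnorm_le => // v; rewrite mulmxBr (le_trans (tnormB _ _ _))//.
by have := oproj_tnorm_le p E v; have := oproj_tnorm_le p F v; lra.
Qed.

(** The difference of the projections at [v] splits along [v = a + b], with [a]
    the projection of [v] to [F]: the part of [a] is controlled by the second
    hypothesis, and the projection of [b] to [E] has norm squared [<c - w, b>]
    with [c] in [E] and [w] in [F], because [b] is orthogonal to [F]; so the
    first hypothesis controls it. *)
Lemma dG_gap p E F delta : 0 <= delta ->
  (forall v, (v <= E)%MS -> exists2 w, (w <= F)%MS & tnorm p (v - w) <= delta * tnorm p v) ->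
  (forall v, (v <= F)%MS -> exists2 w, (w <= E)%MS & tnorm p (v - w) <= delta * tnorm p v) ->
  dG p E F <= 2 * delta.
Proof.
move=> d0 EF FE; apply: opnorm_le => [|v]; first by rewrite mulr_ge0.
set a := v *m oproj p F; set b := v - a.
have aE : tnorm p (a - a *m oproj p E) <= delta * tnorm p v.
  have [w wE aw] := FE _ (oproj_sub p F v).
  rewrite (le_trans (oproj_best p a wE))// (le_trans aw)// ler_wpM2l//.
  exact: oproj_tnorm_le.
have bE : tnorm p (b *m oproj p E) <= delta * tnorm p v.
  set c := b *m oproj p E.
  have [c0|c0] := eqVneq (tnorm p c) 0; first by rewrite c0 mulr_ge0 ?tnorm_ge0.
  have cp : 0 < tnorm p c by rewrite lt_neqAle eq_sym c0 tnorm_ge0.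
  have [w wF cw] := EF _ (oproj_sub p E b).
  have E1 : ip p c c = ip p (c - w) b.
    have h1 : ip p (b - c) c = 0 by apply: oproj_orthogonal; exact: oproj_sub.
    have h2 : ip p b w = 0 by exact: oproj_orthogonal.
    rewrite ipBl (ipC p w) h2 subr0 (ipC p c b).
    by apply/eqP; rewrite eq_sym -subr_eq0 -ipBl h1.
  rewrite -(ler_pM2l cp) -expr2 tnorm_sqr E1 (le_trans (ip_cauchy_schwarz _ _ _))//.
  rewrite mulrA ler_pM ?tnorm_ge0//; first by rewrite mulrC.
  exact: oproj_compl_tnorm_le.
rewrite mulmxBr -/a.
have -> : v *m oproj p E - a = b *m oproj p E - (a - a *m oproj p E).
  by rewrite /b mulmxBl opprB addrA subrK.
rewrite (le_trans (tnormB _ _ _))//; lra.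
Qed.

End TangentSpace.

(** * Pieces of charts with bounded geometry *)

Section GoodPiece.
Context {R : realType} {n : nat} {M : riemannianManifold R n}.
Implicit Types (p q z : M) (gam : R -> M) (a b c e v w : 'rV[R]_n) (C : set M).
Notation lmetric := (local_metric (@metric R n M)).

Lemma formB (A B : 'M[R]_n) v w :
  (v *m (A - B) *m w^T) 0 0 = (v *m A *m w^T) 0 0 - (v *m B *m w^T) 0 0.
Proof. by rewrite mulmxBr mulmxBl mxE [X in _ + X]mxE. Qed.

Lemma tnorm_chart p z v : dom p z -> tnorm z v ^+ 2 =
  ((v *m tchange z p z) *m lmetric p (chart p z) *m (v *m tchange z p z)^T) 0 0.
Proof.
move=> pz; have zz := dom_self z; rewrite tnorm_sqr /ip (local_metric_at pz).
congr (_ 0 0); rewrite trmx_mul.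
have E : tchange z p z *m tchange p z z = 1%:M by exact: tchangeK.
have E' : (tchange p z z)^T *m (tchange z p z)^T = 1%:M by rewrite -trmx_mul E trmx1.
move: (tchange z p z) (tchange p z z) E E' => T T' E E'.
rewrite !mulmxA -[in RHS](mulmxA v) E mulmx1.
by rewrite -[in RHS](mulmxA _ T'^T) E' mulmx1.
Qed.

Lemma tnorm_chart_inv p z w : dom p z -> tnorm z (w *m tchange p z z) ^+ 2 =
  (w *m lmetric p (chart p z) *m w^T) 0 0.
Proof.
move=> pz.
have E : w *m tchange p z z *m tchange z p z = w.
  by rewrite -mulmxA (tchangeK pz (dom_self z)) mulmx1.
apply: (etrans (tnorm_chart (w *m tchange p z z) pz)).
exact: (congr1 (fun w' => (w' *m lmetric p (chart p z) *m w'^T) 0 0) E).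
Qed.

(** A part of a manifold where the coordinates of [chart p] distort norms by at
    most [K] and the Christoffel symbols are bounded, through the first
    derivatives of the metric. Second derivatives of transition maps are not
    mentioned: on the intersection of two good pieces they are bounded
    automatically. *)
Definition good_piece p C (K : R) : Prop := 1 <= K /\ forall z, C z ->
  [/\ dom p z, forall v, `|v *m tchange z p z| <= K * tnorm z v,
    forall v, tnorm z v <= K * `|v *m tchange z p z| &
    forall a, `|'D_a (lmetric p) (chart p z)| <= K * `|a|].

Lemma good_piece_le p C K K' : K <= K' -> good_piece p C K -> good_piece p C K'.
Proof.
move=> KK [K1 H]; split; first exact: le_trans KK.
move=> z /H[pz H1 H2 H3]; split => // v.
- by rewrite (le_trans (H1 v))// ler_wpM2r// tnorm_ge0.
- by rewrite (le_trans (H2 v))// ler_wpM2r.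
- by rewrite (le_trans (H3 v))// ler_wpM2r.
Qed.

Lemma good_piece_sub p C C' K : C' `<=` C -> good_piece p C K -> good_piece p C' K.
Proof. by move=> CC [K1 H]; split => // z /CC; exact: H. Qed.

(** At [p] itself the bounds hold by finite-dimensionality; they persist nearby
    since the metric is of class C^1. *)
Lemma good_piece_near p : exists (K : R) (C : set M), nbhs p C /\ good_piece p C K.
Proof.
have pp := dom_self p; set u0 := chart p p.
have C2 := local_metric_C2 pp.
have [m m0 Hm] := posdef_lower (fun v => @local_metric_pos _ _ M p p v pp).
have n20 : 0 <= n%:R ^+ 2 :> R by rewrite exprn_ge0.
pose e := m / 2 / (n%:R ^+ 2 + 1).
have e0 : 0 < e by rewrite !divr_gt0// ltr_wpDl.
have cG : {for u0, continuous (lmetric p)}.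
  by apply: differentiable_continuous; have [] := nbhs_singleton C2.
have nG : \forall u \near u0, `|lmetric p u0 - lmetric p u| <= e.
  by move/cvgrPdist_le : cG; exact.
pose B i := `|'D_(delta_mx 0 i) (lmetric p) u0| + 1.
have nD : \forall u \near u0, forall i, `|'D_(delta_mx 0 i) (lmetric p) u| <= B i.
  apply: (@filter_forall _ _ _ _ (nbhs_filter u0)) => i.
  have [_ d2 _] := nbhs_singleton C2.
  have /cvgrPdist_le/(_ 1 ltr01) := differentiable_continuous (d2 (delta_mx 0 i)).
  apply: filterS => u; rewrite /B; move: ('D_ _ _ u0) ('D_ _ _ u) => x y xy.
  have -> : y = x - (x - y) by rewrite opprB addrC subrK.
  by rewrite (le_trans (ler_normB _ _))// lerD2l.
pose N : R := n%:R ^+ 2 * (`|lmetric p u0| + e).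
pose K := 1 + 2 / m + N + \sum_i B i.
have N0 : 0 <= N by rewrite mulr_ge0// addr_ge0// ltW.
have B0 i : 0 <= B i by rewrite addr_ge0.
have SB0 : 0 <= \sum_i B i by exact: sumr_ge0.
have m20 : 0 <= 2 / m by rewrite divr_ge0// ltW.
have A4 (x y w : R) : 0 <= x -> 0 <= y -> 0 <= w -> [/\ 1 <= 1 + x + y + w,
    x <= 1 + x + y + w, y <= 1 + x + y + w & w <= 1 + x + y + w].
  by move=> *; split; lra.
have [K1 Km KN KB] := A4 _ _ _ m20 N0 SB0; rewrite -/K in K1 Km KN KB.
have K0 : 0 <= K by rewrite (le_trans _ K1).
have KK : K <= K ^+ 2 by rewrite expr2 ler_peMl.
exists K, [set z | [/\ dom p z, `|lmetric p u0 - lmetric p (chart p z)| <= e,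
  forall i, `|'D_(delta_mx 0 i) (lmetric p) (chart p z)| <= B i &
  differentiable (lmetric p) (chart p z)]]; split.
  have cp : {for p, continuous (chart p)} := chart_continuous pp.
  have n1 : \forall z \near p, `|lmetric p u0 - lmetric p (chart p z)| <= e.
    exact: cp _ nG.
  have n2 : \forall z \near p,
      forall i, `|'D_(delta_mx 0 i) (lmetric p) (chart p z)| <= B i.
    exact: cp _ nD.
  have n3 : \forall u \near u0, differentiable (lmetric p) u.
    by apply: filterS C2 => u [].
  have n4 : \forall z \near p, differentiable (lmetric p) (chart p z).
    exact: cp _ n3.
  have n5 := nbhs_dom pp.
  apply: filterS (filterI (filterI n1 n2) (filterI n4 n5)).
  by move=> z [[h1 h2] [h4 h5]]; exact: And4 h5 h1 h2 h4.
split=> // z [pz zG zD zd].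
have arith (g0 g1 d x : R) : m * x ^+ 2 <= g0 ->
    g0 - g1 <= n%:R ^+ 2 * d * x * x -> d <= e -> x ^+ 2 <= K ^+ 2 * g1.
  move=> h h2 de.
  have h3 : m / 2 * x ^+ 2 <= g1.
    have : n%:R ^+ 2 * d * x * x <= m / 2 * x ^+ 2.
      rewrite -mulrA -expr2 ler_wpM2r ?sqr_ge0//.
      rewrite (le_trans (ler_wpM2l n20 de))// /e mulrC mulrAC ler_pdivrMr ?ltr_wpDl//.
      by rewrite ler_wpM2l ?divr_ge0 ?(ltW m0)// lerDl.
    by lra.
  have h4 : x ^+ 2 <= 2 / m * g1.
    have := ler_wpM2l m20 h3; rewrite mulrA (_ : 2 / m * (m / 2) = 1) ?mul1r//.
    by field; rewrite gt_eqF.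
  have g10 : 0 <= g1.
    by rewrite (le_trans _ h3)// mulr_ge0 ?sqr_ge0// divr_ge0// ltW.
  rewrite (le_trans h4)// ler_wpM2r//; exact: le_trans KK.
have low w : `|w| ^+ 2 <= K ^+ 2 * (w *m lmetric p (chart p z) *m w^T) 0 0.
  have h := Hm w.
  have h2 := form_le (lmetric p u0 - lmetric p (chart p z)) w w.
  rewrite formB in h2; have {}h2 := le_trans (ler_norm _) h2.
  exact: (arith _ _ _ _ h h2 zG).
have upp w : (w *m lmetric p (chart p z) *m w^T) 0 0 <= K ^+ 2 * `|w| ^+ 2.
  rewrite (le_trans (ler_norm _))// (le_trans (form_le _ _ _))//.
  rewrite -mulrA -expr2 ler_wpM2r ?sqr_ge0// (@le_trans _ _ N)//.
    rewrite ler_wpM2l// -[lmetric p (chart p z)](subrK (lmetric p u0)).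
    by rewrite (le_trans (ler_normD _ _))// addrC lerD2l distrC.
  exact: le_trans KK.
split=> //.
- move=> v; rewrite -(@ler_pXn2r _ 2)// ?nnegrE ?mulr_ge0 ?tnorm_ge0//.
  by rewrite exprMn (tnorm_chart v pz); exact: low.
- move=> v; rewrite -(@ler_pXn2r _ 2)// ?nnegrE ?mulr_ge0 ?tnorm_ge0//.
  by rewrite exprMn (tnorm_chart v pz); exact: upp.
move=> a; rewrite (derive_dir_sum a zd) (le_trans (ler_norm_sum _ _ _))//.
rewrite (@le_trans _ _ (\sum_i B i * `|a|))//.
  apply: ler_sum => i _; rewrite normrZ mulrC ler_pM//.
  exact: mx_norm_entry.
by rewrite -mulr_suml ler_wpM2r.
Qed.

Section Bounds.
Context (K : R) (p q : M) (Cp Cq : set M).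
Context (gp : good_piece p Cp K) (gq : good_piece q Cq K).

Let K1 : 1 <= K. Proof. by case: gp. Qed.
Let K0 : 0 <= K. Proof. exact: le_trans K1. Qed.

Lemma good_piece_tchange z b : Cp z -> Cq z ->
  `|b *m tchange p q z| <= K ^+ 2 * `|b|.
Proof.
move=> zp zq; have [pz _ p2 _] := gp.2 z zp; have [qz q1 _ _] := gq.2 z zq.
have zz := dom_self z.
rewrite -(tchange_comp pz zz qz) mulmxA (le_trans (q1 _))// expr2 -mulrA.
rewrite ler_wpM2l// (le_trans (p2 _))//.
by rewrite -mulmxA (tchangeK pz zz) mulmx1.
Qed.

Lemma good_piece_form z w : Cp z ->
  `|w| ^+ 2 <= K ^+ 2 * (w *m lmetric p (chart p z) *m w^T) 0 0.
Proof.
move=> zp; have [pz p1 _ _] := gp.2 z zp.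
rewrite -(tnorm_chart_inv w pz) -exprMn.
rewrite ler_pXn2r// ?nnegrE ?mulr_ge0 ?tnorm_ge0//.
by have := p1 (w *m tchange p z z); rewrite -mulmxA (tchangeK pz (dom_self z)) mulmx1.
Qed.

Lemma good_piece_koszul z a b c : Cp z ->
  `|koszul (lmetric p) (chart p z) a b c| <= 2 * n%:R ^+ 2 * K * `|a| * `|b| * `|c|.
Proof. by move=> zp; have [_ _ _ p3] := gp.2 z zp; exact: koszul_bound. Qed.

End Bounds.

End GoodPiece.

(** * Curves and parallel transport in a fixed chart *)

Lemma le_of_eqD (R : realType) (x y s k l : R) :
  x = y + s -> `|x| <= k -> `|y| <= l -> s <= k + l.
Proof. by move=> ->; rewrite !ler_norml => /andP[_ ?] /andP[? _]; lra. Qed.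

Lemma normN_le (R : realType) (x k : R) : `|x| <= k -> - x <= k.
Proof. by rewrite ler_norml => /andP[? _]; rewrite lerNl. Qed.

Lemma absorb_half (R : realType) (x y z k : R) :
  y <= k -> x <= y + z -> k <= 2^-1 * x -> x <= 2 * z.
Proof. lra. Qed.

Lemma zero_in01 (R : realType) : (0 : R) <= (0 : R) <= 1.
Proof. by apply/andP; split => //; exact: ler01. Qed.

Lemma one_in01 (R : realType) : (0 : R) <= (1 : R) <= 1.
Proof. by apply/andP; split => //; exact: ler01. Qed.

Lemma mulmx_cancel4 (R : realType) n (A B C D : 'M[R]_n) :
  B *m C = 1%:M -> A *m D = 1%:M -> A *m B *m (C *m D) = 1%:M.
Proof. by move=> BC AD; rewrite mulmxA -(mulmxA A) BC mulmx1. Qed.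

Lemma mulmx_cancel3 (R : realType) m n (v : 'M[R]_(m, n)) (A B C : 'M[R]_n) :
  B *m C = 1%:M -> v *m (A *m B) *m C = v *m A.
Proof. by move=> BC; rewrite -!mulmxA BC mulmx1. Qed.

Section CurvesInCharts.
Context {R : realType} {n : nat} {M : riemannianManifold R n}.
Implicit Types (p q x y z : M) (gam : R -> M) (a b c e v w : 'rV[R]_n) (C : set M).
Notation lmetric := (local_metric (@metric R n M)).

Definition transition_const (K : R) : R :=
  K ^+ 2 * ((2 * n%:R ^+ 2 * K) * (K ^+ 2 + K ^+ 4)).

(** In [koszul_transition] take [c] such that its image is the second
    derivative [S] itself: the remaining term is the squared norm of [S], and
    the Koszul terms are linear in [S]. *)
Lemma good_piece_transition K p q Cp Cq z a b :
  good_piece p Cp K -> good_piece q Cq K -> Cp z -> Cq z ->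
  `|b *m 'D_a (jacobian (chart q \o ichart p)) (chart p z)| <=
    transition_const K * `|a| * `|b|.
Proof.
move=> gp gq zp zq.
have [pz _ _ _] := gp.2 z zp; have [qz _ _ _] := gq.2 z zq.
have K1 : 1 <= K by case: gp.
have K0 : 0 <= K by exact: le_trans K1.
have KT v : `|v *m tchange p q z| <= K ^+ 2 * `|v| by exact: (good_piece_tchange gp gq).
have KT' v : `|v *m tchange q p z| <= K ^+ 2 * `|v| by exact: (good_piece_tchange gq gp).
have Kp := fun c => good_piece_koszul gp a b c zp.
have Kq := fun c => good_piece_koszul gq (a *m tchange p q z) (b *m tchange p q z) c zq.
have H := fun c => koszul_transition a b c pz qz.
move: (_ *m 'D_a _ _) H => S H.
have [->|S0] := eqVneq S 0; first by rewrite normr0 !mulr_ge0// addr_ge0 ?exprn_ge0.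
have Sp : 0 < `|S| by rewrite normr_gt0.
have {}H := H (S *m tchange q p z).
have E : S *m tchange q p z *m tchange p q z = S.
  by rewrite -mulmxA (tchangeK qz pz) mulmx1.
rewrite E in H.
have F := good_piece_form gq S zq.
have kp := Kp (S *m tchange q p z); have kq := Kq S.
have ES : (S *m lmetric q (chart q z) *m S^T) 0 0 <=
   2 * n%:R ^+ 2 * K * `|a| * `|b| * `|S *m tchange q p z| +
   2 * n%:R ^+ 2 * K * `|a *m tchange p q z| * `|b *m tchange p q z| * `|S|.
  exact: (le_of_eqD H kp kq).
have {}KT a : `|a *m tchange p q z| <= K ^+ 2 * `|a| := KT a.
have k0 : 0 <= 2 * n%:R ^+ 2 * K by rewrite !mulr_ge0 ?exprn_ge0.
have B1 : 2 * n%:R ^+ 2 * K * `|a| * `|b| * `|S *m tchange q p z| <=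
   2 * n%:R ^+ 2 * K * `|a| * `|b| * (K ^+ 2 * `|S|).
  by rewrite ler_wpM2l ?mulr_ge0// KT'.
have B2 : 2 * n%:R ^+ 2 * K * `|a *m tchange p q z| * `|b *m tchange p q z| * `|S| <=
   2 * n%:R ^+ 2 * K * (K ^+ 2 * `|a|) * (K ^+ 2 * `|b|) * `|S|.
  rewrite ler_wpM2r// ler_pM ?KT ?mulr_ge0//.
  by rewrite ler_wpM2l ?KT.
have {B1 B2}ES := le_trans ES (lerD B1 B2).
have {ES}F := le_trans F (ler_wpM2l (exprn_ge0 2 K0) ES).
rewrite -(ler_pM2r Sp) -expr2; apply: (le_trans F).
rewrite /transition_const le_eqVlt; apply/orP; left; apply/eqP.
by move: (`|a|) (`|b|) (`|S|) => x y s; ring.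
Qed.

(** [h] only bounds the speed: for an iterate [iter k f \o gam] of a
    differentiable map the bound is a multiple of the speed of [gam], and no
    regularity of the new speed is required. *)
Definition speed_le gam (h H : R -> R) : Prop :=
  [/\ primitive01 h H, forall t, 0 <= t <= 1 -> dcurve gam t &
    forall t, 0 <= t <= 1 -> tnorm (gam t) (velocity gam t) <= h t].

Lemma speed_le_ge0 gam h H : speed_le gam h H ->
  forall t, 0 < t < 1 -> 0 <= h t.
Proof.
move=> [_ _ hs] t /andP[t0 t1]; apply: le_trans (hs t _); first exact: tnorm_ge0.
by rewrite !ltW.
Qed.

Lemma speed_le_length_ge0 gam h H : speed_le gam h H -> 0 <= H 1 - H 0.
Proof.
move=> sp; have [pH _ _] := sp.
by rewrite subr_ge0 (primitive01_le pH (speed_le_ge0 sp)).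
Qed.

Lemma good_piece_velocity K p C gam h H (t : R) : good_piece p C K ->
  speed_le gam h H -> 0 <= t <= 1 -> C (gam t) ->
  exists2 c, is_derive t 1 (chart p \o gam) c & `|c| <= K * h t.
Proof.
move=> gp [_ dg hs] t01 Ct; have [pz p1 _ _] := gp.2 _ Ct.
exists (velocity gam t *m tchange (gam t) p (gam t)).
  by apply: dcurve_chart => //; exact: dg.
rewrite (le_trans (p1 _))// ler_wpM2l ?hs//.
by case: gp => + _; exact: le_trans.
Qed.

(** The derivative of [tchange] along the curve is a second derivative of the
    transition map. *)
Lemma transition_lipschitz K p q Cp Cq gam h H b :
  good_piece p Cp K -> good_piece q Cq K -> speed_le gam h H ->
  (forall t, 0 <= t <= 1 -> Cp (gam t)) -> (forall t, 0 <= t <= 1 -> Cq (gam t)) ->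
  forall s t, 0 <= s <= 1 -> 0 <= t <= 1 ->
  `|b *m tchange p q (gam t) - b *m tchange p q (gam s)| <=
     transition_const K * K * `|b| * (H 1 - H 0).
Proof.
move=> gp gq sp Cpt Cqt.
have K1 : 1 <= K by case: gp.
have K0 : 0 <= K by exact: le_trans K1.
have [pH _ _] := sp.
have T0 : 0 <= transition_const K by rewrite !mulr_ge0 ?addr_ge0 ?exprn_ge0.
have D (t : R) : exists c, 0 <= t <= 1 ->
    is_derive t 1 (fun t => b *m tchange p q (gam t)) c /\
    `|c| <= transition_const K * K * `|b| * h t.
  have [t01|] := boolP (0 <= t <= 1); last by exists 0.
  have [pz _ _ _] := gp.2 _ (Cpt t t01); have [qz _ _ _] := gq.2 _ (Cqt t t01).
  have [c dc cK] := good_piece_velocity gp sp t01 (Cpt t t01).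
  have [dJ _] := C2_near_jacobian (transition_C2 pz qz).
  have DJ := is_derive_comp_curve dc dJ.
  have Db : is_derive t 1 (fun _ : R => b) 0 by exact: is_derive_cst.
  have := is_derive_mulmx Db DJ; rewrite mul0mx add0r => DD.
  exists (b *m 'D_c (jacobian (chart q \o ichart p)) (chart p (gam t))) => _; split.
    exact: DD.
  rewrite (le_trans (good_piece_transition _ _ gp gq (Cpt t t01) (Cqt t t01)))//.
  have -> : transition_const K * K * `|b| * h t =
    transition_const K * (K * h t) * `|b| by ring.
  by rewrite ler_wpM2r// ler_wpM2l.
have [dg Hdg] := choice D.
apply: (mvt_primitive (dg := dg) pH _ (speed_le_ge0 sp)) => [|t t01|t /andP[t0 t1]].
- by apply: mulr_ge0 => //; exact: mulr_ge0.
- by have [] := Hdg t t01.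
- by have [|_] := Hdg t; first by rewrite !ltW.
Qed.

(** The identification of the tangent spaces at [x] and [y] under which vectors
    with equal coordinates in [chart p] correspond. *)
Definition chart_transport p x y : 'M[R]_n := tchange x p x *m tchange p y y.

Lemma chart_transportK p x y : dom p x -> dom p y ->
  chart_transport p x y *m chart_transport p y x = 1%:M.
Proof.
move=> px py; exact: mulmx_cancel4 (tchangeK py (dom_self y)) (tchangeK (dom_self x) px).
Qed.

Lemma good_piece_transport K p C x y v : good_piece p C K -> C x -> C y ->
  tnorm y (v *m chart_transport p x y) <= K ^+ 2 * tnorm x v.
Proof.
move=> gp Cx Cy; have [px p1 _ _] := gp.2 _ Cx; have [py _ p2 _] := gp.2 _ Cy.
have K0 : 0 <= K by case: gp => + _; exact: le_trans.
have E := mulmx_cancel3 v (tchange x p x) (tchangeK py (dom_self y)).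
have := p2 (v *m chart_transport p x y); rewrite E => p2v.
apply: (le_trans p2v); rewrite expr2 -mulrA; apply: ler_wpM2l => //; exact: p1.
Qed.

Definition parallel_const (K : R) : R := K ^+ 2 * (2 * n%:R ^+ 2 * K) * K.

(** In the coordinates of [chart p] a parallel field satisfies [|W'| <= K h
    |W|]. Comparing with the maximum of [|W|] over the curve, which is at most
    twice the initial value when the curve is short, bounds the variation of
    [W] by the length. *)
Lemma parallel_transport_near K p C gam h H A v :
  good_piece p C K -> speed_le gam h H ->
  (forall t, 0 <= t <= 1 -> C (gam t)) -> parallel_transport gam A ->
  parallel_const K * (H 1 - H 0) <= 2^-1 ->
  tnorm (gam 1) (v *m A - v *m chart_transport p (gam 0) (gam 1)) <=
    2 * parallel_const K * K ^+ 2 * (H 1 - H 0) * tnorm (gam 0) v.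
Proof.
move=> gp sp Ct PA small.
have K1 : 1 <= K by case: gp.
have K0 : 0 <= K by exact: le_trans K1.
have P0 : 0 <= parallel_const K by rewrite !mulr_ge0 ?exprn_ge0.
have [pH dg _] := sp.
have l0 := speed_le_length_ge0 sp.
have [V [PV V0 V1]] := PA v.
pose W (t : R) := V t *m tchange (gam t) p (gam t).
have D (t : R) : exists c, 0 <= t <= 1 ->
    is_derive t 1 W c /\ `|c| <= parallel_const K * `|W t| * h t.
  have [t01|] := boolP (0 <= t <= 1); last by exists 0.
  have [pz p1 _ _] := gp.2 _ (Ct t t01).
  have [c Dc cE] := parallel_chart (dg t t01) (PV t t01) pz.
  exists c => _; split=> //.
  have [->|c0] := eqVneq c 0.
    rewrite normr0 !mulr_ge0 ?exprn_ge0//.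
    by case: sp => _ _ /(_ t t01); exact/le_trans/tnorm_ge0.
  have cp : 0 < `|c| by rewrite normr_gt0.
  have F := good_piece_form gp c (Ct t t01).
  rewrite cE in F.
  have B := good_piece_koszul gp (velocity gam t *m tchange (gam t) p (gam t))
    (V t *m tchange (gam t) p (gam t)) c (Ct t t01).
  have vh : `|velocity gam t *m tchange (gam t) p (gam t)| <= K * h t.
    by rewrite (le_trans (p1 _))// ler_wpM2l//; case: sp => _ _; exact.
  have {}B := normN_le B.
  rewrite -(ler_pM2r cp) -expr2; apply: (le_trans F).
  apply: (le_trans (ler_wpM2l (exprn_ge0 2 K0) B)).
  have -> : parallel_const K * `|W t| * h t * `|c| =
    K ^+ 2 * (2 * n%:R ^+ 2 * K * (K * h t) * `|W t| * `|c|).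
    by rewrite /parallel_const; ring.
  by rewrite ler_wpM2l ?exprn_ge0// !ler_wpM2r// ler_wpM2l// !mulr_ge0 ?exprn_ge0.
have W0E : W 0 = v *m tchange (gam 0) p (gam 0).
  exact: (congr1 (fun x : 'rV[R]_n => x *m tchange (gam 0) p (gam 0)) V0).
have W1E : W 1 = v *m A *m tchange (gam 1) p (gam 1).
  exact: (congr1 (fun x : 'rV[R]_n => x *m tchange (gam 1) p (gam 1)) V1).
clearbody W.
have [dW HdW] := choice D.
have W01 (t : R) : 0 <= t <= 1 -> is_derive t 1 W (dW t).
  by move=> t01; have [] := HdW t t01.
have cW : {within `[0, 1], continuous (fun t => `|W t|)}.
  have cW' : {within `[0, 1], continuous W}.
    apply: derivable_within_continuous => t; rewrite in_itv/= => t01.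
    by have [] := W01 t t01.
  by move=> t; apply: cvg_norm; exact: cW'.
have [m + mmax] := EVT_max ler01 cW; rewrite in_itv/= => m01.
have bW t : 0 < t < 1 -> `|dW t| <= parallel_const K * `|W m| * h t.
  move=> /andP[t0 t1]; have t01 : 0 <= t <= 1 by rewrite !ltW.
  have [_ dWt] := HdW t t01; apply: (le_trans dWt).
  apply: ler_wpM2r; first by apply: (speed_le_ge0 sp); rewrite t0.
  by apply: ler_wpM2l => //; apply: mmax; rewrite in_itv.
have z01 := @zero_in01 R; have o01 := @one_in01 R.
have PW : 0 <= parallel_const K * `|W m| by rewrite mulr_ge0.
have near0 t : 0 <= t <= 1 -> `|W t - W 0| <= parallel_const K * `|W m| * (H 1 - H 0).
  by move=> t01; apply: (mvt_primitive pH PW (speed_le_ge0 sp) W01 bW).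
have Wm : `|W m| <= 2 * `|W 0|.
  have Wm0 := near0 m m01.
  have : parallel_const K * `|W m| * (H 1 - H 0) <= 2^-1 * `|W m|.
    by rewrite mulrAC ler_wpM2r.
  have := ler_normD (W m - W 0) (W 0); rewrite subrK.
  exact: absorb_half Wm0.
have [p0 q1 _ _] := gp.2 _ (Ct 0 z01); have [p1 _ q2 _] := gp.2 _ (Ct 1 o01).
have E := mulmx_cancel3 v (tchange (gam 0) p (gam 0)) (tchangeK p1 (dom_self (gam 1))).
have := q2 (v *m A - v *m chart_transport p (gam 0) (gam 1)).
rewrite mulmxBl E -W1E -W0E => q2v; apply: (le_trans q2v).
have -> : 2 * parallel_const K * K ^+ 2 * (H 1 - H 0) * tnorm (gam 0) v =
  K * (parallel_const K * (2 * (K * tnorm (gam 0) v)) * (H 1 - H 0)) by ring.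
apply: (ler_wpM2l K0); apply: (le_trans (near0 1 o01)).
apply: (ler_wpM2r l0); apply: (ler_wpM2l P0); apply: (le_trans Wm).
by apply: ler_wpM2l; [|rewrite W0E; exact: q1].
Qed.

End CurvesInCharts.

(** * Short curves stay in one chart *)

Lemma is_derive_sqr (R : realType) (f : R -> R) (x df : R) :
  is_derive x 1 f df -> is_derive x 1 (fun y => f y ^+ 2) (2 * f x * df).
Proof.
move=> D; have -> : (fun y => f y ^+ 2) = (fun y => f y * f y).
  by apply/funext => y; rewrite expr2.
have D2 := @is_deriveM R R f f x 1 _ _ D D.
apply: (is_derive_eq D2).
by rewrite /GRing.scale/=; ring.
Qed.

(** The squared positive part is differentiable also at the origin, so it
    yields a differentiable cutoff. *)
Lemma is_derive_sqr_max (R : realType) (x : R) :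
  is_derive x 1 (fun y : R => Num.max 0 y ^+ 2) (2 * Num.max 0 x).
Proof.
have sq : is_derive x 1 (fun y : R => y ^+ 2) (2 * x).
  have := is_derive_sqr (is_derive_id x 1).
  by rewrite mulr1.
have [x0|x0|x0] := ltgtP x 0; last first.
- rewrite x0 mulr0.
  have H : (fun h : R => h^-1 *: (((fun y : R => Num.max 0 y ^+ 2) \o shift 0) (h *: 1) -
      Num.max 0 0 ^+ 2)) @ 0^' --> (0 : R).
    apply/cvgrPdist_le => e e0; near=> h.
    have h0 : h != 0 by near: h; exact: nbhs_dnbhs_neq.
    rewrite /= maxxx expr0n subr0 sub0r normrN addr0 scaler1.
    rewrite /GRing.scale/= normrM normfV ler_pdivrMl ?normr_gt0//.
    rewrite ger0_norm ?sqr_ge0//.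
    have hm : Num.max 0 h <= `|h| by rewrite ge_max normr_ge0 ler_norm.
    have m0 : 0 <= Num.max 0 h by rewrite le_max lexx.
    rewrite expr2 ler_pM// (le_trans hm)//.
    by near: h; exact: dnbhs0_le.
  by apply: DeriveDef; [apply/cvg_ex; exists 0|exact/cvg_lim].
- have N : \forall y \near x, y ^+ 2 = Num.max 0 y ^+ 2.
    near=> y; rewrite max_r//.
    by apply: ltW; near: y; exact: lt_nbhsr.
  exact: near_eq_is_derive N sq.
- rewrite mulr0.
  have N : \forall y \near x, 0 = Num.max 0 y ^+ 2.
    near=> y; rewrite max_l ?expr0n//.
    by apply: ltW; near: y; exact: lt_nbhsl.
  exact: near_eq_is_derive N (is_derive_cst _ _ _).
Unshelve. all: by end_near. Qed.

Lemma is_derive_sqr_max_comp (R : realType) (f : R -> R) (x df : R) :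
  is_derive x 1 f df ->
  is_derive x 1 (fun y => Num.max 0 (f y) ^+ 2) (2 * Num.max 0 (f x) * df).
Proof. exact: is_derive1_comp (is_derive_sqr_max (f x)). Qed.

Section Cutoff.
Context {R : realType} {n : nat} {M : riemannianManifold R n}.
Implicit Types (p q x y z : M) (gam : R -> M) (C : set M).

Definition sqdist (u0 u : 'rV[R]_n) : R := \sum_i (u 0 i - u0 0 i) ^+ 2.

Lemma sqdist_ge0 u0 u : 0 <= sqdist u0 u.
Proof. by apply: sumr_ge0 => i _; exact: sqr_ge0. Qed.

Lemma sqdist_norm u0 u r : 0 <= r -> sqdist u0 u <= r ^+ 2 -> `|u - u0| <= r.
Proof.
move=> r0 ur; apply: mx_norm_le => // i j; rewrite !mxE ord1.
rewrite -(@ler_pXn2r _ 2)// ?nnegrE// real_normK ?num_real//.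
by apply: le_trans ur; rewrite /sqdist (bigD1 j)//= lerDl sumr_ge0// => k _; exact: sqr_ge0.
Qed.

Lemma is_derive_sqdist u0 (g : R -> 'rV[R]_n) (t : R) dg : is_derive t 1 g dg ->
  is_derive t 1 (fun s => sqdist u0 (g s)) (\sum_i 2 * (g t 0 i - u0 0 i) * dg 0 i).
Proof.
move=> /is_derive_mxP Dg.
have D i : is_derive t 1 (fun s => (g s 0 i - u0 0 i) ^+ 2)
    (2 * (g t 0 i - u0 0 i) * dg 0 i).
  have D1 : is_derive t 1 (fun s => g s 0 i - u0 0 i) (dg 0 i).
    have := @is_deriveB R R R (fun s => g s 0 i) (fun _ => u0 0 i) t 1 _ _ (Dg 0 i) (is_derive_cst _ _ _).
    by rewrite subr0.
  exact: is_derive_sqr D1.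
have := @is_derive_sum R R R n _ t 1 _ D.
by rewrite fct_sumE.
Qed.

(** The square of the positive part of [r^2 - |u - u0|^2] in the coordinates of
    a chart, extended by zero. At a point outside the chart domain it vanishes
    nearby, because the closed coordinate ball is compact, hence closed in a
    Hausdorff space. Along a curve its derivative is bounded by the speed. *)
Lemma cutoff_exists p C : nbhs p C ->
  exists psi : M -> R, exists B : R,
  [/\ 0 <= B, exists2 c, 0 < c & \forall z \near p, c <= psi z,
    (forall z, psi z != 0 -> C z) &
    forall gam (t : R), dcurve gam t -> exists2 d, is_derive t 1 (psi \o gam) d &
      `|d| <= B * tnorm (gam t) (velocity gam t)].
Proof.
move=> pC; have pp := dom_self p; set u0 := chart p p.
have [K [C' [pC' gp]]] := good_piece_near p.
have K0 : 0 <= K by case: gp => + _; exact: le_trans.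
have : \forall u \near u0, (dom p (ichart p u) /\ chart p (ichart p u) = u) /\
    (C `&` C') (ichart p u).
  by apply: filterI (near_ichart pp) (near_ichart_pred pp _); exact: filterI.
move=> /nbhs_ballP[r' /= r'0 Hr'].
pose r := r' / 2; have r0 : 0 < r by rewrite divr_gt0.
have rr' : r < r' by rewrite /r ltr_pdivrMr// ltr_pMr// ltr1n.
clearbody r; have r0' := ltW r0.
have Hr u : sqdist u0 u <= r ^+ 2 ->
    (dom p (ichart p u) /\ chart p (ichart p u) = u) /\ (C `&` C') (ichart p u).
  move=> ur; apply: Hr'; rewrite -ball_normE/= distrC.
  exact: le_lt_trans (sqdist_norm r0' ur) rr'.
pose k u := r ^+ 2 - sqdist u0 u.
pose psi (z : M) : R := if `[< dom p z >] then Num.max 0 (k (chart p z)) ^+ 2 else 0.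
have psiE z : dom p z -> psi z = Num.max 0 (k (chart p z)) ^+ 2.
  by move=> pz; rewrite /psi asboolT.
have psi_supp z : psi z != 0 -> dom p z /\ sqdist u0 (chart p z) <= r ^+ 2.
  rewrite /psi; case: (asboolP (dom p z)) => [pz k0|_ /eqP//].
  split=> //; rewrite leNgt; apply/negP => H.
  by move/eqP: k0; apply; rewrite max_l ?expr0n// /k subr_le0 ltW.
have psi_C z : psi z != 0 -> (C `&` C') z.
  by move=> /psi_supp[pz /Hr[_]]; rewrite chartK.
have B0 : 0 <= 2 * r ^+ 2 * (n%:R * (2 * r * K)).
  by rewrite !mulr_ge0 ?exprn_ge0.
exists psi, (2 * r ^+ 2 * (n%:R * (2 * r * K))).
split; first exact: B0.
- pose delta := r / (n%:R + 2).
  have n2 : 0 < n%:R + 2 :> R by rewrite ltr_wpDl.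
  have d0 : 0 < delta by rewrite divr_gt0.
  exists ((r ^+ 2 / 2) ^+ 2); first by rewrite exprn_gt0// divr_gt0// exprn_gt0.
  have cp : {for p, continuous (chart p)} := chart_continuous pp.
  have /cvgrPdist_le/(_ delta d0) nd := cp.
  apply: filterS (filterI nd (nbhs_dom pp)) => z [zd pz].
  rewrite psiE// ler_pXn2r ?nnegrE ?divr_ge0 ?exprn_ge0 ?(ltW r0)//; last first.
    by rewrite le_max lexx.
  rewrite le_max; apply/orP; right; rewrite /k.
  have sz : sqdist u0 (chart p z) <= n%:R * delta ^+ 2.
    rewrite /sqdist mulr_natl -[n in _ *+ n]card_ord -sumr_const ler_sum// => i _.
    have xd : `|chart p z 0 i - u0 0 i| <= delta.
      rewrite distrC; apply: le_trans zd.
      by have := mx_norm_entry (u0 - chart p z) 0 i; rewrite !mxE.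
    rewrite -(real_normK (num_real (_ - _))).
    by rewrite ler_pXn2r ?nnegrE ?(ltW d0).
  rewrite lerBrDr -lerBrDl (le_trans sz)// (_ : r ^+ 2 - r ^+ 2 / 2 = r ^+ 2 / 2); last by field.
  rewrite /delta expr_div_n mulrCA ler_wpM2l ?sqr_ge0// ler_pdivrMr ?exprn_gt0//.
  by have : 0 <= n%:R :> R by []; move: (n%:R : R) => x x0; nra.
- by move=> z /psi_C[].
move=> gam t dg; have [cg _] := dg.
have [pt|npt] := pselect (dom p (gam t)).
  have Dc := dcurve_chart dg pt.
  have [cK|] := pselect (`|velocity gam t *m tchange (gam t) p (gam t)| <=
      K * tnorm (gam t) (velocity gam t) \/ sqdist u0 (chart p (gam t)) > r ^+ 2); last first.
    move=> H; exfalso; apply: H.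
    have [sr|sr] := leP (sqdist u0 (chart p (gam t))) (r ^+ 2); last by right.
    left; have [_] := Hr _ sr; rewrite chartK// => -[_ C't].
    by have [_ H _ _] := gp.2 _ C't; exact: H.
  move: (velocity gam t *m _) Dc cK => c Dc cK.
  have Dq := is_derive_sqdist u0 Dc.
  have Dk := @is_deriveB R R R _ _ t 1 _ _ (is_derive_cst (r ^+ 2) t 1) Dq.
  set S := \sum_i _ in Dq Dk.
  have D := is_derive_sqr_max_comp Dk.
  exists (2 * Num.max 0 (k (chart p (gam t))) * (0 - S)).
    have Np : \forall s \near t, dom p (gam s) by apply: cg; exact: nbhs_dom.
    apply: (near_eq_is_derive _ D).
    by apply: filterS Np => s ps; rewrite /= psiE.
  have s0 := tnorm_ge0 (gam t) (velocity gam t).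
  have [k0|k0] := leP (k (chart p (gam t))) 0.
    by rewrite mulr0 mul0r normr0 mulr_ge0.
  have sr : sqdist u0 (chart p (gam t)) <= r ^+ 2 by rewrite -subr_ge0 ltW.
  have {}cK : `|c| <= K * tnorm (gam t) (velocity gam t).
    by case: cK => //; rewrite ltNge sr.
  have kr : k (chart p (gam t)) <= r ^+ 2 by rewrite /k lerBlDr lerDl sqdist_ge0.
  have SB : `|S| <= n%:R * (2 * r * K) * tnorm (gam t) (velocity gam t).
    rewrite (le_trans (ler_norm_sum _ _ _))//.
    have -> : n%:R * (2 * r * K) * tnorm (gam t) (velocity gam t) =
        \sum_(i < n) 2 * r * (K * tnorm (gam t) (velocity gam t)).
      by rewrite sumr_const card_ord -[RHS]mulr_natl; ring.
    apply: ler_sum => i _.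
    rewrite !normrM ger0_norm// -!mulrA ler_wpM2l// ler_pM//.
      apply: le_trans (sqdist_norm r0' sr).
      by have := mx_norm_entry (chart p (gam t) - u0) 0 i; rewrite !mxE.
    exact: le_trans (mx_norm_entry _ _ _) cK.
  rewrite sub0r mulrN normrN normrM -[leRHS]mulrA; apply: ler_pM => //.
  by rewrite normrM !ger0_norm ?(ltW k0)// ler_wpM2l.
pose B := [set u : 'rV[R]_n | `|u0 - u| <= r].
have BE u : B u -> dom p (ichart p u) /\ chart p (ichart p u) = u.
  move=> Bu; have [] := Hr' u => //.
  by rewrite -ball_normE/=; exact: le_lt_trans Bu rr'.
pose Z := ichart p @` B.
have cB : compact B.
  apply: bounded_closed_compact; last exact: closed_closed_ball_.
  exists (`|u0| + r); split; first exact: num_real.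
  move=> x ux u Bu.
  have uu : `|u| <= `|u - u0| + `|u0| by rewrite -{1}[u](subrK u0) ler_normD.
  apply: (le_trans uu); apply: (le_trans _ (ltW ux)).
  by rewrite addrC lerD2l distrC.
have cZ : closed Z.
  apply: compact_closed; first exact: (@manifold_hausdorff _ _ M).
  apply: continuous_compact => //.
  apply: continuous_in_subspaceT => u; rewrite inE => Bu.
  apply: ichart_continuous; have [h1 h2] := BE u Bu.
  by exists (ichart p u).
have nZ : \forall s \near t, ~ Z (gam s).
  have N : nbhs (gam t) (~` Z).
    apply: open_nbhs_nbhs; split; first exact: closed_openC.
    by move=> [u /BE[pu _] uE]; apply: npt; rewrite -uE.
  exact: cg _ N.
have ZE : \forall s \near t, 0 = (psi \o gam) s.
  apply: filterS nZ => s Zs; apply/esym/eqP; rewrite /=.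
  apply: contraT => /psi_supp[ps sr]; exfalso; apply: Zs.
  exists (chart p (gam s)); last exact: chartK.
  by rewrite /B/= distrC; exact: sqdist_norm (ltW r0) sr.
exists 0; first exact: near_eq_is_derive ZE (is_derive_cst _ _ _).
by rewrite normr0; apply: mulr_ge0 => //; exact: tnorm_ge0.
Qed.

End Cutoff.

Lemma mvt_primitive_scalar (R : realType) (g dg : R -> R) (h H : R -> R) K :
  primitive01 h H -> 0 <= K -> (forall t, 0 < t < 1 -> 0 <= h t) ->
  (forall t : R, 0 <= t <= 1 -> is_derive t 1 g (dg t)) ->
  (forall t, 0 < t < 1 -> `|dg t| <= K * h t) ->
  forall s t, 0 <= s <= 1 -> 0 <= t <= 1 -> `|g t - g s| <= K * (H 1 - H 0).
Proof.
move=> pH K0 h0 Dg gK s t s01 t01.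
have D (x : R) : 0 <= x <= 1 ->
    is_derive x 1 (fun x => const_mx (g x) : 'M[R]_1) (const_mx (dg x)).
  move=> x01; apply/is_derive_mxP => i j; rewrite mxE.
  by under eq_fun do rewrite mxE; exact: Dg.
have B x : 0 < x < 1 -> `|const_mx (dg x) : 'M[R]_1| <= K * h x.
  move=> x01; apply: mx_norm_le => [|i j]; last by rewrite mxE; exact: gK.
  by rewrite mulr_ge0// h0.
have := mvt_primitive pH K0 h0 D B s01 t01.
apply: le_trans; have := mx_norm_entry (const_mx (g t) - const_mx (g s) : 'M[R]_1) 0 0.
by rewrite !mxE.
Qed.

(** A curve that starts where a cutoff function is at least [c] and is too
    short for the function to drop to zero stays in the support, hence in the
    piece. Compactness is used to choose all constants uniformly in the
    starting point; the pieces themselves may be infinitely many. *)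
Lemma short_curve_piece (R : realType) (n : nat) (M : riemannianManifold R n)
    (Q : M -> set M -> R -> Prop) :
  compact [set: M] ->
  (forall p C K K', K <= K' -> Q p C K -> Q p C K') ->
  (forall p, exists C K, nbhs p C /\ Q p C K) ->
  exists2 K, 1 <= K & forall gam h H, speed_le gam h H -> H 1 - H 0 <= K^-1 ->
    exists p C, Q p C K /\ forall t, 0 <= t <= 1 -> C (gam t).
Proof.
move=> cM Qmono Qex.
pose P (K : R) (z : M) := exists p C (psi : M -> R) B c,
  [/\ Q p C K, 0 <= B /\ B < c * K, c <= psi z, (forall z, psi z != 0 -> C z) &
    forall gam (t : R), dcurve gam t -> exists2 d, is_derive t 1 (psi \o gam) d &
      `|d| <= B * tnorm (gam t) (velocity gam t)].
have : \forall K \near +oo, [set: M] `<=` P K.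
  apply: ((compact_near_coveringP _).1 cM) => z _.
  have [C [K0 [zC QC]]] := Qex z.
  have [psi [B [B0 [c c0 nc] supp der]]] := cutoff_exists zC.
  exists ([set z | c <= psi z], [set K | Num.max K0 (B / c) < K]) => /=.
    by split => //; exact: nbhs_pinfty_gt (num_real _).
  move=> [z' K] /= [cz']; rewrite gt_max => /andP[K0K BK].
  exists z, C, psi, B, c; split=> //.
    by apply: Qmono QC; exact: ltW.
  by split=> //; rewrite mulrC -ltr_pdivrMr.
move=> nP.
have nK : \forall K \near +oo, 1 <= K :> R by exact: nbhs_pinfty_ge (num_real _).
have FF : ProperFilter (pinfty_nbhs R) by exact: proper_pinfty_nbhs.
have [K [PK K1]] := @filter_ex _ _ FF _ (@filterI _ _ FF _ _ nP nK).
exists K => // gam h H sp small.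
have [p [C [psi [B [c [QC [B0 Bc] cpsi supp der]]]]]] := PK (gam 0) I.
exists p, C; split=> // t t01; apply: supp.
have [pH dg hs] := sp.
have D (s : R) : exists d, 0 <= s <= 1 -> is_derive s 1 (psi \o gam) d /\ `|d| <= B * h s.
  have [s01|] := boolP (0 <= s <= 1); last by exists 0.
  have [d Dd dB] := der gam s (dg s s01); exists d => _; split=> //.
  by apply: (le_trans dB); apply: ler_wpM2l => //; exact: hs.
have [d Hd] := choice D.
have K0 : 0 < K by exact: lt_le_trans K1.
have E : `|psi (gam t) - psi (gam 0)| <= B * (H 1 - H 0).
  have h1 (s : R) : 0 <= s <= 1 -> is_derive s 1 (psi \o gam) (d s).
    by move=> s01; have [] := Hd s s01.
  have h2 s : 0 < s < 1 -> `|d s| <= B * h s.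
    by move=> /andP[s0 s1]; have [|_] := Hd s; first by rewrite !ltW.
  exact: mvt_primitive_scalar pH B0 (speed_le_ge0 sp) h1 h2 _ _ (zero_in01 R) t01.
have {}E : `|psi (gam t) - psi (gam 0)| < c.
  apply: (le_lt_trans E); apply: (le_lt_trans (ler_wpM2l B0 small)).
  by rewrite ltr_pdivrMr.
apply/eqP => p0; move: E; rewrite p0 sub0r normrN ltNge => /negP; apply.
by apply: (le_trans cpsi); exact: ler_norm.
Qed.

(** * Derivatives of maps between manifolds *)

Section DifferentiableMaps.
Context {R : realType} {n : nat} {M : riemannianManifold R n}.
Implicit Types (p q x y z : M) (gam : R -> M) (f g : M -> M) (C : set M).

Definition dmap f z : Prop :=
  {for z, continuous f} /\ differentiable (local_rep f z) (chart z z).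

(** The chain rule, for charts that are not those attached to the point and to
    its image. *)
Lemma dmap_chart f z p q : dmap f z -> dom p z -> dom q (f z) ->
  differentiable (chart q \o f \o ichart p) (chart p z) /\
  'J (chart q \o f \o ichart p) (chart p z) =
    tchange p z z *m D f z *m tchange (f z) q (f z).
Proof.
move=> [cf df] pz qfz.
have d1 := transition_differentiable pz (dom_self z).
have d3 := transition_differentiable (dom_self (f z)) qfz.
have E1 : (chart z \o ichart p) (chart p z) = chart z z by rewrite /= chartK.
have E2 : local_rep f z (chart z z) = chart (f z) (f z).
  by rewrite /local_rep /= chartK//; exact: dom_self.
have d2 : differentiable (local_rep f z) ((chart z \o ichart p) (chart p z)) by rewrite E1.
have d12 := differentiable_comp d1 d2.
have E12 : (local_rep f z \o (chart z \o ichart p)) (chart p z) = chart (f z) (f z).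
  by rewrite -E2 -E1.
have d3' : differentiable (chart q \o ichart (f z))
    ((local_rep f z \o (chart z \o ichart p)) (chart p z)) by rewrite E12.
have d123 := differentiable_comp d12 d3'.
have N : \forall u \near chart p z,
    ((chart q \o ichart (f z)) \o (local_rep f z \o (chart z \o ichart p))) u =
    (chart q \o f \o ichart p) u.
  have nf : nbhs z [set w | dom (f z) (f w)].
    by apply: cf; apply: nbhs_dom; exact: dom_self.
  have H1 := near_ichart_pred pz (nbhs_dom (dom_self z)).
  have H2 := near_ichart_pred pz nf.
  apply: filterS2 H1 H2 => u zu fu.
  by rewrite /local_rep /= (chartK zu) (chartK fu).
split; first exact: near_eq_differentiable N d123.
apply: (etrans (esym (near_eq_jacobian N d123))).
apply: (etrans (jacobian_comp d12 d3')).
rewrite E12; apply: (congr2 (@mulmx _ _ _ _)); last exact/esym/tchangeE.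
apply: (etrans (jacobian_comp d1 d2)); rewrite E1.
by apply: (congr2 (@mulmx _ _ _ _)) => //; exact/esym/tchangeE.
Qed.

Lemma dmap_comp f g z : dmap f z -> dmap g (f z) ->
  dmap (g \o f) z /\ D (g \o f) z = D f z *m D g (f z).
Proof.
move=> [cf df] [cg dg].
have cgf : {for z, continuous (g \o f)} by exact: continuous_comp cf cg.
have E : local_rep f z (chart z z) = chart (f z) (f z).
  by rewrite /local_rep /= chartK//; exact: dom_self.
have dg' : differentiable (local_rep g (f z)) (local_rep f z (chart z z)) by rewrite E.
have N : \forall u \near chart z z,
    (local_rep g (f z) \o local_rep f z) u = local_rep (g \o f) z u.
  have nf : nbhs z [set w | dom (f z) (f w)].
    by apply: cf; apply: nbhs_dom; exact: dom_self.
  have H2 := near_ichart_pred (dom_self z) nf.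
  by apply: filterS H2 => u fu; rewrite /local_rep /= (chartK fu).
have d := differentiable_comp df dg'.
split; first by split => //; exact: near_eq_differentiable N d.
rewrite /D; apply: (etrans (esym (near_eq_jacobian N d))).
apply: (etrans (jacobian_comp df dg')).
by rewrite E.
Qed.

Lemma dmap_id z : dmap id z /\ D id z = 1%:M.
Proof.
have N : \forall u \near chart z z, id u = local_rep id z u.
  by apply: filterS (near_ichart (dom_self z)) => u [_ E]; rewrite /local_rep/= E.
have d : differentiable (@id 'rV[R]_n) (chart z z) by [].
split; first by split; [exact: cvg_id|exact: near_eq_differentiable N d].
rewrite /D; apply: (etrans (esym (near_eq_jacobian N d))).
exact: jacobian_id.
Qed.

Lemma dmap_iter f k z : (forall z, dmap f z) -> dmap (iter k f) z /\
  D (iter k.+1 f) z = D (iter k f) z *m D f (iter k f z).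
Proof.
move=> df; have dk z' : dmap (iter k f) z'.
  elim: k => [|k IH]; first by have [] := dmap_id z'.
  by have [] := dmap_comp IH (df _).
by split=> //; have [_] := dmap_comp (dk z) (df _).
Qed.

Lemma dmap_inverse f g z : (forall z, dmap f z) -> (forall z, dmap g z) ->
  cancel f g -> D f z *m D g (f z) = 1%:M.
Proof.
move=> df dg fg; have [_ <-] := dmap_comp (df z) (dg (f z)).
have -> : g \o f = id by apply/funext => w; exact: fg.
by have [] := dmap_id z.
Qed.

Lemma dcurve_map f gam (t : R) : dcurve gam t -> dmap f (gam t) ->
  dcurve (f \o gam) t /\ velocity (f \o gam) t = velocity gam t *m D f (gam t).
Proof.
move=> dg df; have [cg _] := dg; have [cf df'] := df.
have Dc := dcurve_chart dg (dom_self (gam t)).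
rewrite (tchange_id (dom_self (gam t))) mulmx1 in Dc.
have DD := is_derive_comp_curve Dc df'.
have N : \forall s \near t, (local_rep f (gam t) \o (chart (gam t) \o gam)) s =
    (chart ((f \o gam) t) \o (f \o gam)) s.
  have H : \forall s \near t, dom (gam t) (gam s).
    by apply: cg; apply: nbhs_dom; exact: dom_self.
  by apply: filterS H => s ts; rewrite /local_rep /= (chartK ts).
have [d1 d2] := near_eq_is_derive N DD.
split; first by split; [exact: continuous_comp cg cf|exact: d1].
rewrite /velocity derive1E; apply: (etrans d2).
exact: (deriveEjacobian _ df').
Qed.

Lemma C1holder_dmap beta f z : C1holder beta f -> dmap f z.
Proof.
move=> [cf /(_ z)[K [U Uz [dU _]]]]; split; first exact: cf.
by apply: dU; exact: nbhs_singleton.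
Qed.

End DifferentiableMaps.

(** * Hölder derivatives read in charts *)

Lemma powR_le1 (R : realType) (x b : R) : 0 <= x <= 1 -> 0 <= b -> x `^ b <= 1.
Proof.
move=> /andP[x0 x1] b0; have -> : 1 = 1 `^ b :> R by rewrite powR1.
by apply: ge0_ler_powR; rewrite ?nnegrE.
Qed.

Lemma ler_powR1 (R : realType) (x b : R) : 0 <= x <= 1 -> b <= 1 -> x <= x `^ b.
Proof.
move=> /andP[x0 x1] b1; have [->|xn0] := eqVneq x 0; first exact: powR_ge0.
have x_gt0 : 0 < x by rewrite lt_neqAle eq_sym xn0.
by apply: ger1_powR => //; rewrite x_gt0.
Qed.

Lemma powR_mul_le (R : realType) (K x b : R) : 1 <= K -> 0 <= x -> 0 <= b <= 1 ->
  (K * x) `^ b <= K * x `^ b.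
Proof.
move=> K1 x0 /andP[b0 b1]; have K0 : 0 <= K by exact: le_trans K1.
rewrite powRM// ler_wpM2r ?powR_ge0//; exact: ler1_powR.
Qed.

Lemma ler_norm_dist (R : realType) (V : normedModType R) (x y : V) k :
  `|x - y| <= k -> `|y| <= `|x| + k.
Proof.
move=> xy; rewrite -[y in leLHS](subrK x) (le_trans (ler_normD _ _))//.
by rewrite addrC lerD2l distrC.
Qed.

Section HolderPiece.
Context {R : realType} {n : nat} {M : riemannianManifold R n}.
Implicit Types (p q i j x y z : M) (gam : R -> M) (f g : M -> M) (C : set M).

(** The target chart is always [chart (f i)], the one in which [C1holder]
    expresses the derivative at [i]. *)
Definition holder_piece (beta : R) f i C K : Prop :=
  [/\ good_piece i C K, good_piece (f i) (f @` C) K,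
    forall z, C z -> `|'J (local_rep f i) (chart i z)| <= K &
    forall z z', C z -> C z' ->
      `|'J (local_rep f i) (chart i z) - 'J (local_rep f i) (chart i z')| <=
        K * `|chart i z - chart i z'| `^ beta].

Lemma holder_piece_le beta f i C K K' : K <= K' ->
  holder_piece beta f i C K -> holder_piece beta f i C K'.
Proof.
move=> KK [g1 g2 g3 g4]; split.
- exact: good_piece_le g1.
- exact: good_piece_le g2.
- by move=> z /g3 H; exact: le_trans KK.
- move=> z z' Cz Cz'; apply: (le_trans (g4 z z' Cz Cz')).
  by rewrite ler_wpM2r// powR_ge0.
Qed.

Lemma holder_piece_near beta f i : 0 <= beta -> C1holder beta f ->
  exists C K, nbhs i C /\ holder_piece beta f i C K.
Proof.
move=> b0 [cf /(_ i)[K3 [U Ui [_ HU]]]].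
have [K1 [C1 [n1 g1]]] := good_piece_near i.
have [K2 [C2 [n2 g2]]] := good_piece_near (f i).
have K10 : 0 <= K1 by case: g1 => + _; exact: le_trans.
have K20 : 0 <= K2 by case: g2 => + _; exact: le_trans.
have cc : {for i, continuous (chart i)} := chart_continuous (dom_self i).
have n3 : \forall z \near i, U (chart i z) by exact: cc _ Ui.
have n4 : \forall z \near i, `|chart i i - chart i z| <= 1.
  by move/cvgrPdist_le : cc => /(_ 1 ltr01).
have n5 : \forall z \near i, C2 (f z) by exact: cf _ n2.
pose J0 := `|'J (local_rep f i) (chart i i)|.
pose K := K1 + K2 + `|K3| + J0.
have KE : [/\ K1 <= K, K2 <= K, `|K3| <= K & J0 + `|K3| <= K].
  have A4 (a b c d : R) : 0 <= a -> 0 <= b -> 0 <= c -> 0 <= d ->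
      [/\ a <= a + b + c + d, b <= a + b + c + d, c <= a + b + c + d &
          d + c <= a + b + c + d] by move=> *; split; lra.
  exact: (A4 _ _ _ _ K10 K20 (normr_ge0 _) (normr_ge0 _)).
have [KK1 KK2 KK3 KK4] := KE; clearbody K.
exists [set z | [/\ C1 z, C2 (f z), U (chart i z) & `|chart i i - chart i z| <= 1]], K.
split.
  apply: filterS (filterI (filterI n1 n5) (filterI n3 n4)).
  by move=> z [[h1 h2] [h3 h4]]; exact: And4 h1 h2 h3 h4.
split.
- by apply: good_piece_sub (good_piece_le KK1 g1) => z [].
- by apply: good_piece_sub (good_piece_le KK2 g2) => _ [z [_ + _ _] <-].
- move=> z [_ _ Uz z1]; apply: le_trans KK4.
  have H := HU _ _ (nbhs_singleton Ui) Uz.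
  apply: (le_trans (ler_norm_dist H)); rewrite lerD2l.
  apply: (le_trans (ler_wpM2r (powR_ge0 _ _) (ler_norm _))).
  by rewrite ler_piMr// powR_le1// z1 andbT.
- move=> z z' [_ _ Uz _] [_ _ Uz' _]; apply: (le_trans (HU _ _ Uz Uz')).
  by rewrite ler_wpM2r ?powR_ge0// (le_trans (ler_norm _)).
Qed.

(** This bounds the derivative uniformly on the piece, which makes [Dnorm f] a
    genuine supremum. *)
Lemma holder_piece_tnorm beta f i C K z v : (forall z, dmap f z) ->
  holder_piece beta f i C K -> C z ->
  tnorm (f z) (v *m D f z) <= n%:R * K ^+ 3 * tnorm z v.
Proof.
move=> df [gi gf gJ _] Cz.
have [iz i1 _ _] := gi.2 z Cz.
have [fz _ f2 _] := gf.2 (f z) (ex_intro2 _ _ z Cz erefl).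
have K0 : 0 <= K by case: gi => + _; exact: le_trans.
have [_ JE] := dmap_chart (df z) iz fz.
have E : v *m D f z *m tchange (f z) (f i) (f z) =
    (v *m tchange z i z) *m 'J (local_rep f i) (chart i z).
  apply: (etrans _ (congr1 (mulmx (v *m tchange z i z)) (esym JE))).
  have := tchangeK (dom_self z) iz.
  move: (tchange z i z) (tchange i z z) (tchange (f z) (f i) (f z)) => A B T AB.
  by rewrite !mulmxA -[in RHS](mulmxA v) AB mulmx1.
have := f2 (v *m D f z); rewrite E => H; apply: (le_trans H).
have -> : n%:R * K ^+ 3 * tnorm z v = K * (n%:R * (K * tnorm z v) * K) by ring.
apply: (ler_wpM2l K0); apply: (le_trans (mx_norm_mul _ _)).
apply: (ler_pM _ (normr_ge0 _) _ (gJ z Cz)).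
  exact: mulr_ge0 (ler0n _ _) (normr_ge0 _).
exact: ler_wpM2l (ler0n _ _) _ _ (i1 v).
Qed.

End HolderPiece.

Lemma mulmx_cocycle (R : realType) n (v : 'rV[R]_n) (A B Df P T U J : 'M[R]_n) :
  J = B *m Df *m P -> P *m T = U ->
  v *m (A *m B) *m Df *m U = v *m A *m J *m T.
Proof. by move=> -> <-; rewrite !mulmxA. Qed.

Lemma mulmx_cocycle_inv (R : realType) n (v : 'rV[R]_n)
    (A B Df P T U W V J : 'M[R]_n) :
  J = B *m Df *m P -> P *m T = U -> A *m B = 1%:M -> W *m V = 1%:M ->
  v *m Df *m (U *m W) *m V = v *m A *m J *m T.
Proof.
move=> -> <- AB WV; rewrite !mulmxA -[in RHS](mulmxA v) AB mulmx1.
by rewrite -(mulmxA _ W) WV mulmx1.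
Qed.

Lemma mulmx_diff_le (R : realType) n (a : 'rV[R]_n) (J J' T T' : 'M[R]_n) (k l : R) :
  (forall b : 'rV[R]_n, `|b *m T| <= k * `|b|) -> 0 <= k ->
  `|a *m J' *m T - a *m J' *m T'| <= l ->
  `|a *m J *m T - a *m J' *m T'| <= k * (n%:R * `|a| * `|J - J'|) + l.
Proof.
move=> HT k0 Hl.
have -> : a *m J *m T - a *m J' *m T' = a *m (J - J') *m T + (a *m J' *m T - a *m J' *m T').
  by rewrite mulmxBr mulmxBl addrA subrK.
rewrite (le_trans (ler_normD _ _))// lerD// (le_trans (HT _))// ler_wpM2l//.
exact: mx_norm_mul.
Qed.

Lemma le_chain2 (R : realType) (V : normedModType R) (T K X0 : R) (A B A' B' : V) :
  0 <= K -> T <= K * `|A - B| -> A = A' -> B = B' -> `|A' - B'| <= X0 ->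
  T <= K * X0.
Proof.
by move=> K0 TA AA BB H; rewrite AA BB in TA; exact: le_trans TA (ler_wpM2l K0 H).
Qed.

Lemma step_arith (R : realType) (K Dn nn TC sg l lb xa xJ xaJ : R) :
  0 <= K -> 0 <= Dn -> 0 <= nn -> 0 <= TC -> 0 <= sg -> 0 <= l -> 0 <= xa -> 0 <= xJ ->
  0 <= xaJ -> xa <= K * sg -> xJ <= K * (K * lb) -> xaJ <= nn * (K * sg) * K -> l <= lb ->
  K * (K ^+ 2 * (nn * xa * xJ) + TC * K * xaJ * (Dn * l)) <=
  K * (K ^+ 2 * (nn * K * (K * K)) + TC * K * (nn * K * K) * Dn) * lb * sg.
Proof.
move=> K0 Dn0 nn0 TC0 sg0 l0 xa0 xJ0 xaJ0 h1 h2 h3 h4.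
have -> : K * (K ^+ 2 * (nn * K * (K * K)) + TC * K * (nn * K * K) * Dn) * lb * sg =
  K * (K ^+ 2 * (nn * (K * sg) * (K * (K * lb))) +
       TC * K * (nn * (K * sg) * K) * (Dn * lb)) by ring.
rewrite ler_wpM2l// lerD//.
  by apply: ler_wpM2l; [exact: exprn_ge0|apply: ler_pM => //;
    [exact: mulr_ge0|exact: ler_wpM2l]].
apply: ler_pM; [|exact: mulr_ge0| |exact: ler_wpM2l].
  by apply: mulr_ge0 => //; exact: mulr_ge0.
by apply: ler_wpM2l => //; exact: mulr_ge0.
Qed.

Section TransportHolder.
Context {R : realType} {n : nat} {M : riemannianManifold R n}.
Implicit Types (p q i j x y z : M) (gam : R -> M) (f g : M -> M) (C : set M).

Lemma chart_lipschitz K p C gam h H : good_piece p C K -> speed_le gam h H ->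
  (forall t, 0 <= t <= 1 -> C (gam t)) ->
  forall s t, 0 <= s <= 1 -> 0 <= t <= 1 ->
  `|chart p (gam t) - chart p (gam s)| <= K * (H 1 - H 0).
Proof.
move=> gp sp Ct.
have K0 : 0 <= K by case: gp => + _; exact: le_trans.
have D (t : R) : exists c, 0 <= t <= 1 ->
    is_derive t 1 (chart p \o gam) c /\ `|c| <= K * h t.
  have [t01|] := boolP (0 <= t <= 1); last by exists 0.
  by have [c Dc cK] := good_piece_velocity gp sp t01 (Ct t t01); exists c.
have [c Hc] := choice D.
have h1 (s : R) : 0 <= s <= 1 -> is_derive s 1 (chart p \o gam) (c s).
  by move=> s01; have [] := Hc s s01.
have h2 s : 0 < s < 1 -> `|c s| <= K * h s.
  by move=> /andP[s0 s1]; have [|_] := Hc s; first by rewrite !ltW.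
have [pH _ _] := sp.
exact: mvt_primitive pH K0 (speed_le_ge0 sp) h1 h2.
Qed.

Definition step_const (K Dn : R) : R :=
  K * (K ^+ 2 * (n%:R * K * (K * K)) + @transition_const R n K * K * (n%:R * K * K) * Dn).

(** The derivative of [f] almost commutes with the identifications of tangent
    spaces at the two ends of a curve. In charts, [Df] is the Jacobian of
    [local_rep f i] followed by the change from [chart (f i)] to [chart j]; the
    first factor is Hölder in the base point by assumption and the second is
    Lipschitz along the image curve. *)
Lemma chart_transport_holder beta f i j Ci Cj K Dn gam h H :
  0 <= beta <= 1 -> (forall z, dmap f z) -> 0 <= Dn ->
  holder_piece beta f i Ci K -> good_piece j Cj K ->
  speed_le gam h H -> speed_le (f \o gam) (fun t => Dn * h t) (fun t => Dn * H t) ->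
  (forall t, 0 <= t <= 1 -> Ci (gam t)) -> (forall t, 0 <= t <= 1 -> Cj (f (gam t))) ->
  H 1 - H 0 <= 1 ->
  forall s t v, 0 <= s <= 1 -> 0 <= t <= 1 ->
  tnorm (f (gam s)) (v *m chart_transport i (gam t) (gam s) *m D f (gam s) -
      v *m D f (gam t) *m chart_transport j (f (gam t)) (f (gam s))) <=
    step_const K Dn * (H 1 - H 0) `^ beta * tnorm (gam t) v.
Proof.
move=> b01 df Dn0 [gi gf gJ gH] gj sp spf Ct Cft l1 s t v s01 t01.
have K1 : 1 <= K by case: gi.
have K0 : 0 <= K by exact: le_trans K1.
have l0 := speed_le_length_ge0 sp.
set l := H 1 - H 0 in l0 l1 *.
have [b0 b1] := andP b01.
have lb : l <= l `^ beta by apply: ler_powR1 => //; rewrite l0.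
have Cff r : 0 <= r <= 1 -> (f @` Ci) (f (gam r)).
  by move=> r01; exists (gam r) => //; exact: Ct.
have [is_ _ _ _] := gi.2 _ (Ct s s01); have [it it1 _ _] := gi.2 _ (Ct t t01).
have [fs _ _ _] := gf.2 _ (Cff s s01); have [ft _ _ _] := gf.2 _ (Cff t t01).
have [js _ js2 _] := gj.2 _ (Cft s s01); have [jt _ _ _] := gj.2 _ (Cft t t01).
have zs := dom_self (f (gam s)); have zt := dom_self (f (gam t)).
have [_ Js] := dmap_chart (df (gam s)) is_ fs.
have [_ Jt] := dmap_chart (df (gam t)) it ft.
have Es : v *m chart_transport i (gam t) (gam s) *m D f (gam s) *m
    tchange (f (gam s)) j (f (gam s)) =
    v *m tchange (gam t) i (gam t) *m 'J (local_rep f i) (chart i (gam s)) *m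
      tchange (f i) j (f (gam s)).
  exact (mulmx_cocycle v (tchange (gam t) i (gam t)) Js (tchange_comp zs fs js)).
have Et : v *m D f (gam t) *m chart_transport j (f (gam t)) (f (gam s)) *m
    tchange (f (gam s)) j (f (gam s)) =
    v *m tchange (gam t) i (gam t) *m 'J (local_rep f i) (chart i (gam t)) *m
      tchange (f i) j (f (gam t)).
  exact (mulmx_cocycle_inv v Jt (tchange_comp zt ft jt)
    (tchangeK (dom_self (gam t)) it) (tchangeK js zs)).
have TK (b : 'rV[R]_n) : `|b *m tchange (f i) j (f (gam s))| <= K ^+ 2 * `|b|.
  exact: (good_piece_tchange gf gj b (Cff s s01) (Cft s s01)).
have a1 := it1 v.
have LT := transition_lipschitz
  (v *m tchange (gam t) i (gam t) *m 'J (local_rep f i) (chart i (gam t)))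
  gf gj spf Cff Cft t01 s01.
have JJ := gH _ _ (Ct s s01) (Ct t t01).
have Jb := gJ _ (Ct t t01).
have uu := chart_lipschitz gi sp Ct t01 s01.
have X := mulmx_diff_le ('J (local_rep f i) (chart i (gam s))) TK (exprn_ge0 2 K0) LT.
have Y := js2 (v *m chart_transport i (gam t) (gam s) *m D f (gam s) -
      v *m D f (gam t) *m chart_transport j (f (gam t)) (f (gam s))).
rewrite mulmxBl in Y.
have Z := le_chain2 K0 Y Es Et X.
apply: (le_trans Z).
have -> : Dn * H 1 - Dn * H 0 = Dn * l by rewrite /l; ring.
have TC0 : 0 <= @transition_const R n K.
  by rewrite /transition_const !mulr_ge0 ?addr_ge0 ?exprn_ge0.
apply: (step_arith K0 Dn0 (ler0n _ n) TC0 (tnorm_ge0 _ _) l0 (normr_ge0 _)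
  (normr_ge0 _) (normr_ge0 _) a1 _ _ lb).
- apply: (le_trans JJ); apply: (ler_wpM2l K0).
  apply: le_trans (powR_mul_le K1 l0 b01).
  by apply: (ge0_ler_powR b0 _ _ uu); rewrite nnegrE; [exact: normr_ge0|exact: mulr_ge0].
- apply: (le_trans (mx_norm_mul _ _)).
  apply: (ler_pM (mulr_ge0 (ler0n _ _) (normr_ge0 _)) (normr_ge0 _) _ Jb).
  exact: (ler_wpM2l (ler0n _ _) a1).
Qed.

End TransportHolder.

(** * Hyperbolic estimates *)

Lemma angle_arith (R : realType) (c l d a b s : R) : 0 <= c ->
  c ^+ 2 * l <= 2^-1 -> a <= s + b -> l <= 1 -> 0 <= l -> 0 <= s -> 0 <= b ->
  0 <= d -> b <= c * l * (d * s + c * l * a) -> b <= 2 * (c * d + 1) * s.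
Proof.
move=> c0 H H5 l1 l0 s0 b0 d0 Hb.
have h1 : c * l * (d * s) <= c * d * s.
  by rewrite -!mulrA ler_wpM2l// ler_piMl// mulr_ge0.
have h2 : c * l * (c * l * a) <= 2^-1 * (s + b).
  have : c * l * (c * l * a) <= c * l * (c * l * (s + b)).
    by rewrite ler_wpM2l ?mulr_ge0// ler_wpM2l// mulr_ge0.
  move=> /le_trans; apply.
  rewrite mulrA ler_wpM2r ?addr_ge0// (le_trans _ H)//.
  by rewrite (_ : c * l * (c * l) = c ^+ 2 * l * l); [rewrite ler_piMr// mulr_ge0// exprn_ge0|ring].
have {}Hb := Hb; rewrite mulrDr in Hb.
lra.
Qed.

Lemma stable_near_arith (R : realType) (c l B K2 I v w a b q r : R) :
  0 <= c -> 0 <= l -> l <= 1 -> 0 <= B -> 0 <= w ->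
  w <= K2 * v -> b <= B * w -> a <= w + b -> r <= I * v + q ->
  q <= c * l * a -> b <= c * l * r ->
  b <= c * (I + c * ((1 + B) * K2)) * l * v.
Proof.
move=> c0 l0 l1 B0 w0 h1 h2 h3 h4 h5 h6; apply: (le_trans h6).
have -> : c * (I + c * ((1 + B) * K2)) * l * v =
  c * l * (I * v + c * ((1 + B) * (K2 * v))) by ring.
rewrite ler_wpM2l ?mulr_ge0// (le_trans h4)// lerD2l (le_trans h5)//.
have a1 : a <= (1 + B) * w by rewrite (le_trans h3)// mulrDl mul1r lerD2l.
have a2 : (1 + B) * w <= (1 + B) * (K2 * v) by rewrite ler_wpM2l// addr_ge0.
have X0 : 0 <= (1 + B) * (K2 * v) by rewrite (le_trans _ a2)// mulr_ge0// addr_ge0.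
rewrite -mulrA ler_wpM2l// (le_trans (ler_wpM2l l0 (le_trans a1 a2)))//.
exact: ler_piMl.
Qed.

Lemma small_length_arith (R : realType) (K pc l : R) :
  1 <= K -> 0 <= pc -> 0 <= l -> l <= (4 * (pc + 1) * K ^+ 4)^-1 ->
  pc * l <= 2^-1 /\ K ^+ 2 * (2 * pc * K ^+ 2 * l) <= 2^-1.
Proof.
move=> K1 pc0 l0 hl.
have K41 : 1 <= K ^+ 4 by exact: exprn_ege1.
have K40 : 0 < K ^+ 4 by exact: lt_le_trans K41.
have H : 4 * (pc + 1) * K ^+ 4 * l <= 1.
  have p1 : 0 < pc + 1 by lra.
  have den : 0 < 4 * (pc + 1) * K ^+ 4 by apply: mulr_gt0 => //; exact: mulr_gt0.
  by rewrite mulrC -ler_pdivlMr// mul1r.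
have e : K ^+ 2 * (2 * pc * K ^+ 2 * l) = 2 * pc * (K ^+ 4 * l) by ring.
have h1 : l <= K ^+ 4 * l by rewrite ler_peMl.
have h2 : 0 <= K ^+ 4 * l by rewrite mulr_ge0// ltW.
have h3 : 4 * (pc + 1) * (K ^+ 4 * l) <= 1 by rewrite [leLHS]mulrA.
rewrite e; move: (K ^+ 4 * l) h1 h2 h3 => y h1 h2 h3.
have h4 : pc * l <= pc * y by rewrite ler_wpM2l.
split; lra.
Qed.

Lemma gap_arith1 (R : realType) (K2 K7 P lm l w v x y z : R) :
  0 <= K2 -> 0 <= K7 -> 0 <= P -> 0 <= lm -> 0 <= l -> 0 <= w -> 0 <= v ->
  K2 * (P * l) <= 2^-1 -> x <= y + z -> y <= P * l * w -> z <= K7 * lm * w ->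
  forall t, w <= K2 * t -> t <= v + y ->
  x <= (2 * K2 * (K7 + P) + (K2 * K7 + P * (K2 + K7))) * (lm + l) * v.
Proof.
move=> K20 K70 P0 lm0 l0 w0 v0 small hx hy hz t h1 h2.
have w2 : w <= 2 * K2 * v.
  have e1 : K2 * t <= K2 * v + K2 * (P * l * w).
    by rewrite -mulrDr ler_wpM2l// (le_trans h2)// lerD2l.
  have e2 : K2 * (P * l * w) <= 2^-1 * w by rewrite mulrA ler_wpM2r.
  lra.
have Pl0 : 0 <= P * l by exact: mulr_ge0.
have Kl0 : 0 <= K7 * lm by exact: mulr_ge0.
have e3 : x <= (P * l + K7 * lm) * (2 * K2 * v).
  apply: (le_trans hx); apply: (le_trans (lerD hy hz)).
  by rewrite -mulrDl ler_wpM2l// addr_ge0.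
apply: (le_trans e3); rewrite mulrA ler_wpM2r//.
have q1 : 0 <= K2 * (K7 * l) by rewrite !mulr_ge0.
have q2 : 0 <= K2 * (P * lm) by rewrite !mulr_ge0.
have q3 : 0 <= (K2 * K7 + P * (K2 + K7)) * (lm + l).
  by rewrite mulr_ge0 ?addr_ge0 ?mulr_ge0 ?addr_ge0.
rewrite [leRHS]mulrDl -[leLHS]addr0 lerD//.
have -> : 2 * K2 * (K7 + P) * (lm + l) =
  (P * l + K7 * lm) * (2 * K2) + 2 * (K2 * (K7 * l) + K2 * (P * lm)) by ring.
by rewrite lerDl mulr_ge0// addr_ge0.
Qed.

Lemma gap_arith2 (R : realType) (K2 K7 P lm l v x a b w y : R) :
  0 <= K2 -> 0 <= K7 -> 0 <= P -> 0 <= lm -> lm <= 1 -> 0 <= l -> 0 <= v ->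
  x <= a + b -> a <= K2 * y -> b <= P * l * w -> y <= K7 * lm * v ->
  forall t, t <= K2 * v -> w <= t + y ->
  x <= (2 * K2 * (K7 + P) + (K2 * K7 + P * (K2 + K7))) * (lm + l) * v.
Proof.
move=> K20 K70 P0 lm0 lm1 l0 v0 hx ha hb hy t ht hw.
have w1 : w <= (K2 + K7) * v.
  apply: (le_trans hw); rewrite mulrDl lerD//; apply: (le_trans hy).
  by rewrite ler_wpM2r// ler_piMr.
have Pl0 : 0 <= P * l by exact: mulr_ge0.
have e1 : x <= (K2 * (K7 * lm) + P * l * (K2 + K7)) * v.
  apply: (le_trans hx); rewrite mulrDl lerD//.
    have -> : K2 * (K7 * lm) * v = K2 * (K7 * lm * v) by ring.
    by apply: (le_trans ha); rewrite ler_wpM2l.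
  have -> : P * l * (K2 + K7) * v = P * l * ((K2 + K7) * v) by ring.
  by apply: (le_trans hb); rewrite ler_wpM2l.
apply: (le_trans e1); rewrite ler_wpM2r//.
have q1 : 0 <= K2 * K7 * l by rewrite !mulr_ge0.
have q2 : 0 <= P * (K2 + K7) * lm by rewrite !mulr_ge0// addr_ge0.
have q3 : 0 <= 2 * K2 * (K7 + P) * (lm + l) by rewrite !mulr_ge0 ?addr_ge0.
rewrite [leRHS]mulrDl -[leLHS]add0r lerD//.
have -> : (K2 * K7 + P * (K2 + K7)) * (lm + l) =
  (K2 * (K7 * lm) + P * l * (K2 + K7)) + (K2 * K7 * l + P * (K2 + K7) * lm) by ring.
by rewrite lerDl addr_ge0.
Qed.

Lemma step_const_ge0 (R : realType) n (K Dn : R) : 0 <= K -> 0 <= Dn ->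
  0 <= @step_const R n K Dn.
Proof.
move=> K0 D0; rewrite /step_const /transition_const.
have K20 : 0 <= K ^+ 2 by exact: exprn_ge0.
have K40 : 0 <= K ^+ 4 by exact: exprn_ge0.
have n0 : 0 <= n%:R :> R by [].
have n20 : 0 <= n%:R ^+ 2 :> R by exact: exprn_ge0.
by apply: mulr_ge0 => //; apply: addr_ge0; rewrite !mulr_ge0// addr_ge0.
Qed.

Section DnormBound.
Context {R : realType} {n : nat} {M : riemannianManifold R n}.
Implicit Types (p q i j x y z : M) (gam : R -> M) (f g : M -> M) (C : set M).

Lemma speed_le_cst z : speed_le (fun _ : R => z) (fun _ => 0) (fun _ => 0).
Proof.
split.
- split; first by move=> t _; exact: is_derive_cst.
  by apply: continuous_subspaceT => t; exact: cvg_cst.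
- move=> t _; split; first exact: cvg_cst.
  exact: derivable_cst.
move=> t _; rewrite (_ : velocity _ _ = 0) ?tnorm0//.
by rewrite /velocity derive1E; exact: derive_cst.
Qed.

(** A constant curve is short, so every point lies in a piece with uniform
    constants. *)
Lemma Dnorm_bound beta f : compact [set: M] -> 0 <= beta -> C1holder beta f ->
  0 <= Dnorm f /\
  forall z v, tnorm (f z) (v *m D f z) <= Dnorm f * tnorm z v.
Proof.
move=> cM b0 Cf.
have df z : dmap f z := C1holder_dmap z Cf.
have [K K1 HK] := short_curve_piece cM (@holder_piece_le _ _ M beta f)
  (fun i => holder_piece_near i b0 Cf).
have K0 : 0 <= K by exact: le_trans K1.
have Kn0 : 0 <= n%:R * K ^+ 3 by rewrite mulr_ge0// exprn_ge0.
have B z : opnorm z (f z) (D f z) <= n%:R * K ^+ 3.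
  have [|p [C [hp Cz]]] := HK _ _ _ (speed_le_cst z).
    by rewrite subrr invr_ge0.
  apply: (opnorm_le Kn0) => v.
  exact: (holder_piece_tnorm v df hp (Cz 0 (zero_in01 R))).
have sup_ub : has_ubound [set opnorm p (f p) (D f p) | p in [set: M]].
  by exists (n%:R * K ^+ 3) => _ [z _ <-].
have le z : opnorm z (f z) (D f z) <= Dnorm f by apply: ub_le_sup => //; exists z.
split.
  have [[z _]|nM] := pselect (exists z : M, True).
    by apply: le_trans (le z); exact: opnorm_ge0.
  rewrite /Dnorm (_ : [set opnorm p (f p) (D f p) | p in [set: M]] = set0) ?sup0//.
  by rewrite -subset0 => t [z zM tE]; apply: nM; exists z.
move=> z v; apply: (le_trans (opnorm_bound z (f z) (D f z) v)).
by apply: ler_wpM2r (le z); exact: tnorm_ge0.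
Qed.

End DnormBound.

Section Hyperbolic.
Context {R : realType} {n : nat} {M : riemannianManifold R n}.
Context (f finv : M -> M) (lam c : R) (Lam : set M) (Es Eu : M -> 'M[R]_n).
Context (df : forall z, dmap f z) (dfinv : forall z, dmap finv z).
Context (fK : cancel f finv) (lam01 : 0 < lam < 1) (c1 : 1 <= c).
Context (LamS : forall x, Lam x -> Lam (f x)).
Context (split : forall x, Lam x -> (Es x + Eu x :=: 1%:M)%MS).
Context (inv_u : forall x, Lam x -> (Eu x *m D f x <= Eu (f x))%MS).
Context (rate_s : forall x k v, Lam x -> (v <= Es x)%MS ->
  tnorm (iter k f x) (v *m D (iter k f) x) <= c * lam ^+ k * tnorm x v).
Context (rate_u : forall x k v, Lam x -> (v <= Eu x)%MS ->
  tnorm (iter k finv x) (v *m D (iter k finv) x) <= c * lam ^+ k * tnorm x v).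
Context (Dn : R) (Dn0 : 0 <= Dn).
Context (fDn : forall z v, tnorm (f z) (v *m D f z) <= Dn * tnorm z v).
Implicit Types (x y z : M) (v w : 'rV[R]_n).

Lemma Lam_iter x k : Lam x -> Lam (iter k f x).
Proof. by move=> Lx; elim: k => //= k; exact: LamS. Qed.

Lemma mulmx_D_iterS v k z :
  v *m D (iter k.+1 f) z = v *m D (iter k f) z *m D f (iter k f z).
Proof.
have [_ E] := dmap_iter k z df.
exact: etrans (congr1 (mulmx v) E) (mulmxA _ _ _).
Qed.

Lemma invariant_iter (E : M -> 'M[R]_n) x k v :
  (forall x, Lam x -> (E x *m D f x <= E (f x))%MS) -> Lam x ->
  (v <= E x)%MS -> (v *m D (iter k f) x <= E (iter k f x))%MS.
Proof.
move=> invE Lx vE; elim: k => [|k IH].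
  by have [_ ->] := dmap_id x; rewrite mulmx1.
rewrite mulmx_D_iterS.
exact: submx_trans (submxMr _ IH) (invE _ (Lam_iter k Lx)).
Qed.

Lemma tnorm_iter_le z k v :
  tnorm (iter k f z) (v *m D (iter k f) z) <= Dn ^+ k * tnorm z v.
Proof.
elim: k => [|k IH].
  by have [_ ->] := dmap_id z; rewrite mulmx1 mul1r.
rewrite mulmx_D_iterS.
apply: (le_trans (fDn _ _)); rewrite exprS -mulrA.
exact: ler_wpM2l.
Qed.

Lemma iter_cancel k : cancel (iter k f) (iter k finv).
Proof.
elim: k => [//|k IH] x.
by rewrite iterSr iterS fK IH.
Qed.

(** The contraction rate of the inverse, read backwards. *)
Lemma unstable_expansion x k v : Lam x -> (v <= Eu x)%MS ->
  tnorm x v <= c * lam ^+ k * tnorm (iter k f x) (v *m D (iter k f) x).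
Proof.
move=> Lx vE.
have vE' := invariant_iter k inv_u Lx vE.
have := rate_u k (Lam_iter k Lx) vE'.
have di g : (forall z, dmap g z) -> forall z, dmap (iter k g) z.
  by move=> dg z; have [] := dmap_iter k z dg.
have E := dmap_inverse x (di _ df) (di _ dfinv) (iter_cancel k).
by rewrite -mulmxA E mulmx1 iter_cancel.
Qed.

Lemma splitting_sum x v : Lam x -> exists v1 v2,
  [/\ (v1 <= Es x)%MS, (v2 <= Eu x)%MS & v = v1 + v2].
Proof.
move=> Lx; have vS : (v <= Es x + Eu x)%MS by rewrite (split Lx) submx1.
have /sub_addsmxP[[u1 u2] /= ->] := vS.
by exists (u1 *m Es x), (u2 *m Eu x); split => //; exact: submxMl.
Qed.

(** The angle between the two distributions is bounded below by the rates
    alone: after [N] steps with [c^2 lam^N <= 1/2] the unstable component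
    dominates the stable one, while the sum has grown by at most [Dn^N]. *)
Lemma splitting_angle : exists2 B, 0 <= B & forall x v1 v2, Lam x ->
  (v1 <= Es x)%MS -> (v2 <= Eu x)%MS -> tnorm x v2 <= B * tnorm x (v1 + v2).
Proof.
have [lam0 lam1] := andP lam01.
have c0 : 0 <= c by exact: le_trans c1.
have [N HN] : exists N, c ^+ 2 * lam ^+ N <= 2^-1.
  have e0 : 0 < 2^-1 / (c ^+ 2) by rewrite divr_gt0// exprn_gt0// (lt_le_trans _ c1).
  have : lam ^+ k @[k --> \oo] --> 0 by apply: cvg_expr; rewrite ger0_norm ?(ltW lam0).
  move/cvgrPdist_le => /(_ _ e0)[N _ HN]; exists N.
  have := HN N (leqnn N); rewrite /= sub0r normrN ger0_norm ?exprn_ge0 ?(ltW lam0)//.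
  by rewrite ler_pdivlMr ?exprn_gt0 ?(lt_le_trans _ c1)// mulrC.
exists (2 * (c * Dn ^+ N + 1)).
  by rewrite mulr_ge0// addr_ge0// mulr_ge0// exprn_ge0.
move=> x v1 v2 Lx v1E v2E.
have H2 := unstable_expansion N Lx v2E.
have H1 := rate_s N Lx v1E.
have H3 := tnorm_iter_le x N (v1 + v2).
have H4 : tnorm (iter N f x) (v2 *m D (iter N f) x) <=
    Dn ^+ N * tnorm x (v1 + v2) + c * lam ^+ N * tnorm x v1.
  have -> : v2 *m D (iter N f) x = (v1 + v2) *m D (iter N f) x - v1 *m D (iter N f) x.
    by rewrite mulmxDl addrC addKr.
  exact: le_trans (tnormB _ _ _) (lerD H3 H1).
have H5 : tnorm x v1 <= tnorm x (v1 + v2) + tnorm x v2.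
  by have := tnormB x (v1 + v2) v2; rewrite addrK.
have l1 : lam ^+ N <= 1 by rewrite exprn_ile1 ?(ltW lam0) ?(ltW lam1).
have l0 : 0 <= lam ^+ N by rewrite exprn_ge0 ?(ltW lam0).
have n1 := tnorm_ge0 x (v1 + v2); have n2 := tnorm_ge0 x v2.
have D0 : 0 <= Dn ^+ N by rewrite exprn_ge0.
have {H1 H3} := le_trans H2 (ler_wpM2l (mulr_ge0 c0 l0) H4).
exact: angle_arith c0 HN H5 l1 l0 n1 n2 D0.
Qed.

Lemma speed_le_map (gam : R -> M) (h H : R -> R) : speed_le gam h H ->
  speed_le (f \o gam) (fun t => Dn * h t) (fun t => Dn * H t).
Proof.
move=> [[dH cH] dg hs]; split.
- split; first by move=> t t01; exact: (@is_deriveZ R R R H Dn t 1 _ (dH t t01)).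
  by move=> t; apply: cvgM; [exact: cvg_cst|exact: cH].
- by move=> t t01; have [] := dcurve_map (dg t t01) (df _).
move=> t t01; have [_ E] := dcurve_map (dg t t01) (df _).
rewrite E; apply: (le_trans (fDn _ _)); apply: (ler_wpM2l Dn0); exact: hs.
Qed.

Lemma speed_le_iter (gam : R -> M) (h H : R -> R) k : speed_le gam h H ->
  speed_le (iter k f \o gam) (fun t => Dn ^+ k * h t) (fun t => Dn ^+ k * H t).
Proof.
move=> sp; elim: k => [|k IH].
  have E (g : R -> R) : (fun t => Dn ^+ 0 * g t) = g.
    by apply/funext => t; rewrite expr0 mul1r.
  by rewrite !E.
have E (g : R -> R) : (fun t => Dn ^+ k.+1 * g t) = (fun t => Dn * (Dn ^+ k * g t)).
  by apply/funext => t; rewrite exprS mulrA.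
rewrite !E; exact: speed_le_map IH.
Qed.

Context (beta : R) (b01 : 0 <= beta <= 1) (Dn1 : 1 <= Dn) (K : R) (K1 : 1 <= K).
Context (HK : forall (gam : R -> M) h H, speed_le gam h H -> H 1 - H 0 <= K^-1 ->
  exists p C, holder_piece beta f p C K /\ forall t, 0 <= t <= 1 -> C (gam t)).

Definition iterate_const : R :=
  @step_const R n K Dn * c / (1 - lam) + K ^+ 2 * c.

(** One step of the recursion [N' <= Dn N + error]; the error at step [k]
    carries the factor [lam^k], so that the errors sum to a geometric series. *)
Lemma iterate_step_arith (A S N lk st lb tv x y : R) (k : nat) :
  0 <= A -> N <= A * Dn ^+ k * S -> A = st * c * lb * tv -> 0 <= st -> 0 <= lb ->
  0 <= tv -> x <= Dn * N -> y <= st * (Dn ^+ k * lb) * (c * lk * tv) -> 0 <= lk ->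
  x + y <= A * Dn ^+ k.+1 * (S + lk).
Proof.
move=> A0 HN AE st0 lb0 tv0 Hx Hy lk0; rewrite mulrDr; apply: lerD.
  by apply: (le_trans Hx); rewrite exprS mulrCA -mulrA; exact: ler_wpM2l.
apply: (le_trans Hy).
have -> : st * (Dn ^+ k * lb) * (c * lk * tv) = A * Dn ^+ k * lk by rewrite AE; ring.
rewrite ler_wpM2r// ler_wpM2l//; exact: ler_weXn2l.
Qed.

(** A vector [v] of the stable space at one end is compared with its copy at
    the other end along [m] iterates. With [e k] the difference of the two
    orbits, read through the charts chosen for the step [k], one has [|e (k+1)|
    <= Dn |e k| + C (Dn^k l)^beta c lam^k |v|]: the derivatives at
    corresponding points differ by a Hölder error, and it is applied to the
    orbit of [v], which decays. As [beta <= 1], this sums to [|e m| <= C Dn^m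
    l^beta |v|]. No chart has to be kept from one step to the next, because the
    errors are measured in the Riemannian norm. *)
Lemma iterate_close (gam : R -> M) (h H : R -> R) m : speed_le gam h H ->
  Dn ^+ m * (H 1 - H 0) <= K^-1 -> Dn ^+ m * (H 1 - H 0) `^ beta <= 1 ->
  exists i C, [/\ holder_piece beta f i C K, forall t, 0 <= t <= 1 -> C (gam t) &
    forall s t v, 0 <= s <= 1 -> 0 <= t <= 1 -> Lam (gam t) -> (v <= Es (gam t))%MS ->
      tnorm (iter m f (gam s))
        (v *m chart_transport i (gam t) (gam s) *m D (iter m f) (gam s)) <=
      iterate_const * tnorm (gam t) v].
Proof.
move=> sp small1 small2.
have K0 : 0 <= K by exact: le_trans K1.
have [lam0 lam1] := andP lam01.
have c0 : 0 <= c by exact: le_trans c1.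
have l0 := speed_le_length_ge0 sp; set l := H 1 - H 0 in l0 small1 small2 *.
have lk k : Dn ^+ k * H 1 - Dn ^+ k * H 0 = Dn ^+ k * l by rewrite /l; ring.
have Dk_le k : (k <= m)%N -> Dn ^+ k * l <= K^-1.
  by move=> km; apply: le_trans small1; rewrite ler_wpM2r// ler_weXn2l.
have ex k : exists iC : M * set M, (k <= m)%N -> holder_piece beta f iC.1 iC.2 K /\
    forall t, 0 <= t <= 1 -> iC.2 (iter k f (gam t)).
  have [km|mk] := leqP k m; last by exists (gam 0, set0).
  have [|p [C [hp Ct]]] := HK (speed_le_iter k sp); first by rewrite lk Dk_le.
  by exists (p, C).
have [idx Hidx] := choice ex.
have [h0 C0t] := Hidx 0%N (leq0n m).
exists (idx 0%N).1, (idx 0%N).2; split => // s t v s01 t01 Lt vE.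
pose w k := v *m chart_transport (idx 0%N).1 (gam t) (gam s) *m D (iter k f) (gam s).
pose u k := v *m D (iter k f) (gam t).
pose T k := chart_transport (idx k).1 (iter k f (gam t)) (iter k f (gam s)).
have st0 : 0 <= @step_const R n K Dn.
  exact: step_const_ge0.
have lb0 : 0 <= l `^ beta by exact: powR_ge0.
have tv0 := tnorm_ge0 (gam t) v.
pose A := @step_const R n K Dn * c * l `^ beta * tnorm (gam t) v.
have A0 : 0 <= A by exact: mulr_ge0 (mulr_ge0 (mulr_ge0 st0 c0) lb0) tv0.
have ub k : tnorm (iter k f (gam t)) (u k) <= c * lam ^+ k * tnorm (gam t) v.
  exact: rate_s.
have main k : (k <= m)%N ->
    tnorm (iter k f (gam s)) (w k - u k *m T k) <= A * Dn ^+ k * \sum_(j < k) lam ^+ j.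
  elim: k => [_|k IH km].
    have -> : w 0%N - u 0%N *m T 0%N = 0.
      rewrite /w /u /T; have [_ ->] := dmap_id (gam s); have [_ ->] := dmap_id (gam t).
      by rewrite !mulmx1 subrr.
    by rewrite tnorm0 big_ord0 mulr0.
  have {}IH := IH (ltnW km).
  have [hk Ck] := Hidx k (ltnW km); have [[hk1 _ _ _] Ck1] := Hidx k.+1 km.
  have E : w k.+1 - u k.+1 *m T k.+1 =
      (w k - u k *m T k) *m D f (iter k f (gam s)) +
      (u k *m T k *m D f (iter k f (gam s)) -
       u k *m D f (iter k f (gam t)) *m T k.+1).
    have Ew : w k.+1 = w k *m D f (iter k f (gam s)) by exact: mulmx_D_iterS.
    have Eu' : u k.+1 = u k *m D f (iter k f (gam t)) by exact: mulmx_D_iterS.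
    by rewrite Ew Eu' mulmxBl addrA subrK.
  rewrite E big_ord_recr.
  apply: (le_trans (tnormD _ _ _)).
  have spk := speed_le_iter k sp.
  have lk1 : Dn ^+ k * H 1 - Dn ^+ k * H 0 <= 1.
    by rewrite lk (le_trans (Dk_le k (ltnW km)))// invf_le1// (lt_le_trans _ K1).
  have Y := chart_transport_holder b01 df Dn0 hk hk1 spk (speed_le_map spk) Ck Ck1 lk1
    (u k) s01 t01.
  refine (iterate_step_arith A0 IH erefl st0 lb0 tv0 (fDn _ _) _ (exprn_ge0 k (ltW lam0))).
  apply: (le_trans Y); rewrite lk.
  apply: (ler_pM _ (tnorm_ge0 _ _) _ (ub k)).
    exact: mulr_ge0 st0 (powR_ge0 _ _).
  apply: (ler_wpM2l st0); apply: powR_mul_le => //; exact: exprn_ege1.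
have Em := main m (leqnn m).
have [hm Cm] := Hidx m (leqnn m).
have [gm _ _ _] := hm.
have Tm : tnorm (iter m f (gam s)) (u m *m T m) <= K ^+ 2 * (c * tnorm (gam t) v).
  apply: (le_trans (good_piece_transport (u m) gm (Cm t t01) (Cm s s01))).
  apply: (ler_wpM2l (exprn_ge0 2 K0)); apply: (le_trans (ub m)).
  apply: (ler_wpM2r tv0); rewrite ler_piMr// exprn_ile1 ?(ltW lam0) ?(ltW lam1)//.
have -> : v *m chart_transport (idx 0%N).1 (gam t) (gam s) *m D (iter m f) (gam s) =
    (w m - u m *m T m) + u m *m T m by rewrite subrK.
apply: (le_trans (tnormD _ _ _)); apply: (le_trans (lerD Em Tm)).
rewrite /iterate_const mulrDl; apply: lerD; last by rewrite mulrA.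
have gs : \sum_(j < m) lam ^+ j <= (1 - lam)^-1.
  have lam'0 : 0 < 1 - lam by rewrite subr_gt0.
  rewrite -[leRHS]mul1r ler_pdivlMr// mulrC.
  have -> : (1 - lam) * \sum_(j < m) lam ^+ j = 1 - lam ^+ m.
    by have := subrX1 lam m; rewrite -[1 - lam]opprB mulNr => <-; rewrite opprB.
  by rewrite gerBl exprn_ge0// ltW.
have -> : @step_const R n K Dn * c / (1 - lam) * tnorm (gam t) v =
  (@step_const R n K Dn * c * tnorm (gam t) v) * 1 * (1 - lam)^-1 by ring.
apply: ler_pM => //.
- by apply: mulr_ge0 => //; exact: exprn_ge0.
- by apply: sumr_ge0 => j _; rewrite exprn_ge0// ltW.
have -> : A * Dn ^+ m = (@step_const R n K Dn * c * tnorm (gam t) v) * (Dn ^+ m * l `^ beta).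
  by rewrite /A; ring.
apply: ler_wpM2l small2; exact: mulr_ge0 (mulr_ge0 st0 c0) tv0.
Qed.

(** The copy of [v] stays bounded for [m] steps, hence its unstable component,
    which would have expanded by [lam^-m] up to a constant, is of size [lam^m]. *)
Lemma stable_near : exists2 K7, 0 <= K7 &
  forall (gam : R -> M) (h H : R -> R) m, speed_le gam h H ->
  Dn ^+ m * (H 1 - H 0) <= K^-1 -> Dn ^+ m * (H 1 - H 0) `^ beta <= 1 ->
  exists i C, [/\ good_piece i C K, forall t, 0 <= t <= 1 -> C (gam t) &
    forall s t v, 0 <= s <= 1 -> 0 <= t <= 1 -> Lam (gam s) -> Lam (gam t) ->
      (v <= Es (gam t))%MS -> exists2 w, (w <= Es (gam s))%MS &
      tnorm (gam s) (v *m chart_transport i (gam t) (gam s) - w) <=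
        K7 * lam ^+ m * tnorm (gam t) v].
Proof.
have K0 : 0 <= K by exact: le_trans K1.
have [lam0 lam1] := andP lam01.
have c0 : 0 <= c by exact: le_trans c1.
have [B B0 HB] := splitting_angle.
have I0 : 0 <= iterate_const.
  apply: addr_ge0; last exact: mulr_ge0 (exprn_ge0 _ K0) c0.
  apply: mulr_ge0; first exact: mulr_ge0 (step_const_ge0 n K0 Dn0) c0.
  by rewrite invr_ge0 subr_ge0 ltW.
exists (c * (iterate_const + c * ((1 + B) * K ^+ 2))).
  by apply: mulr_ge0 => //; apply: addr_ge0 => //; rewrite !mulr_ge0 ?addr_ge0 ?exprn_ge0.
move=> gam h H m sp small1 small2.
have [i [C [[gi _ _ _] Ct It]]] := iterate_close sp small1 small2.
exists i, C; split => // s t v s01 t01 Ls Lt vE.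
have It' := It s t v s01 t01 Lt vE.
set x := gam s in Ls It' *.
have Bw : tnorm x (v *m chart_transport i (gam t) x) <= K ^+ 2 * tnorm (gam t) v.
  exact: good_piece_transport gi (Ct t t01) (Ct s s01).
have [v1 [v2 [v1E v2E vv]]] := splitting_sum (v *m chart_transport i (gam t) x) Ls.
exists v1 => //.
have -> : v *m chart_transport i (gam t) x - v1 = v2 by rewrite vv addrC addKr.
have U := unstable_expansion m Ls v2E.
have S := rate_s m Ls v1E.
have Ang := HB x v1 v2 Ls v1E v2E.
have T1 := tnormB x (v1 + v2) v2; rewrite addrK in T1.
have T2 := tnormB (iter m f x) ((v1 + v2) *m D (iter m f) x) (v1 *m D (iter m f) x).
have E2 : (v1 + v2) *m D (iter m f) x - v1 *m D (iter m f) x = v2 *m D (iter m f) x.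
  by rewrite mulmxDl addrC addKr.
rewrite E2 -vv in T2; rewrite -vv in Ang T1.
exact: (stable_near_arith c0 (exprn_ge0 m (ltW lam0)) (exprn_ile1 m (ltW lam0) (ltW lam1))
  B0 (tnorm_ge0 _ _) Bw Ang T1 (le_trans T2 (lerD It' (lexx _))) S U).
Qed.

Definition parallel_rate : R := 2 * @parallel_const R n K * K ^+ 2.

(** Replacing the chart identification by parallel transport costs an error of
    the order of the length. *)
Lemma stable_gap : exists2 K8, 0 <= K8 & exists2 eps, 0 < eps &
  forall (gam : R -> M) (h H : R -> R) m (A : 'M[R]_n), speed_le gam h H ->
  Dn ^+ m * (H 1 - H 0) <= K^-1 -> Dn ^+ m * (H 1 - H 0) `^ beta <= 1 ->
  H 1 - H 0 <= eps -> parallel_transport gam A ->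
  Lam (gam 0) -> Lam (gam 1) ->
  dG (gam 1) (Es (gam 0) *m A) (Es (gam 1)) <= K8 * (lam ^+ m + (H 1 - H 0)).
Proof.
have K0 : 0 <= K by exact: le_trans K1.
have Kp : 0 < K by exact: lt_le_trans K1.
have [lam0 lam1] := andP lam01.
have pc0 : 0 <= @parallel_const R n K.
  by rewrite /parallel_const !mulr_ge0 ?exprn_ge0.
have P10 : 0 <= parallel_rate by rewrite !mulr_ge0 ?exprn_ge0.
have [K7 K70 near] := stable_near.
have K20 : 0 <= K ^+ 2 by exact: exprn_ge0.
pose G := 2 * K ^+ 2 * (K7 + parallel_rate) + (K ^+ 2 * K7 + parallel_rate * (K ^+ 2 + K7)).
have G0 : 0 <= G by rewrite !addr_ge0 ?mulr_ge0 ?addr_ge0.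
exists (2 * G); first exact: mulr_ge0.
have pc1 : 0 < 4 * (@parallel_const R n K + 1) * K ^+ 4.
  by rewrite mulr_gt0 ?exprn_gt0// mulr_gt0// ltr_wpDl.
exists (4 * (@parallel_const R n K + 1) * K ^+ 4)^-1; first by rewrite invr_gt0.
move=> gam h H m A sp small1 small2 leps PA L0 L1.
have l0 := speed_le_length_ge0 sp.
have [i [C [gi Ct Hn]]] := near gam h H m sp small1 small2.
set l := H 1 - H 0 in l0 leps small1 small2 *.
have z01 := zero_in01 R; have o01 := one_in01 R.
have lm0 : 0 <= lam ^+ m by rewrite exprn_ge0// ltW.
have [s1 s2] : @parallel_const R n K * l <= 2^-1 /\
    K ^+ 2 * (parallel_rate * l) <= 2^-1.
  exact: small_length_arith K1 pc0 l0 leps.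
have PT v := parallel_transport_near v gi sp Ct PA s1.
rewrite -/l -/parallel_rate in PT.
have [d0 _ _ _] := gi.2 _ (Ct 0 z01); have [d1 _ _ _] := gi.2 _ (Ct 1 o01).
have TK := chart_transportK d0 d1; have TK' := chart_transportK d1 d0.
have T01 v : tnorm (gam 1) (v *m chart_transport i (gam 0) (gam 1)) <= K ^+ 2 * tnorm (gam 0) v.
  exact: good_piece_transport gi (Ct 0 z01) (Ct 1 o01).
have T10 v : tnorm (gam 0) (v *m chart_transport i (gam 1) (gam 0)) <= K ^+ 2 * tnorm (gam 1) v.
  exact: good_piece_transport gi (Ct 1 o01) (Ct 0 z01).
have N01 v := Hn 1 0 v o01 z01 L1 L0; have N10 v := Hn 0 1 v z01 o01 L0 L1.
move: (chart_transport i (gam 0) (gam 1)) (chart_transport i (gam 1) (gam 0))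
  TK TK' T01 T10 N01 N10 PT => T T' TK TK' T01 T10 N01 N10 PT.
rewrite -mulrA; apply: dG_gap.
- by apply: mulr_ge0 => //; apply: addr_ge0.
- move=> v /submxP[d vE].
  pose w := d *m Es (gam 0).
  have wE : (w <= Es (gam 0))%MS by exact: submxMl.
  have vw : v = w *m A by rewrite vE mulmxA.
  have [u uE wu] := N01 w wE; exists u => //; rewrite vw.
  have B1 : tnorm (gam 1) (w *m A - u) <= tnorm (gam 1) (w *m A - w *m T) + tnorm (gam 1) (w *m T - u).
    by rewrite -[w *m A - u](subrKA (w *m T)); exact: tnormD.
  have B2 : tnorm (gam 0) w <= K ^+ 2 * tnorm (gam 1) (w *m T).
    by have := T10 (w *m T); rewrite -mulmxA TK mulmx1.
  have B3 : tnorm (gam 1) (w *m T) <= tnorm (gam 1) (w *m A) + tnorm (gam 1) (w *m A - w *m T).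
    by have := tnormB (gam 1) (w *m A) (w *m A - w *m T); rewrite opprB addrC subrK.
  exact: (gap_arith1 K20 K70 P10 lm0 l0 (tnorm_ge0 _ _) (tnorm_ge0 _ _) s2 B1 (PT w) wu B2 B3).
move=> v vE; have [w wE vw] := N10 v vE.
exists (w *m A); first exact: submxMr.
have B1 : tnorm (gam 1) (v - w *m A) <=
    tnorm (gam 1) ((v *m T' - w) *m T) + tnorm (gam 1) (w *m A - w *m T).
  have -> : v - w *m A = (v *m T' - w) *m T - (w *m A - w *m T).
    by rewrite mulmxBl -mulmxA TK' mulmx1 opprB addrA subrK.
  exact: tnormB.
have B2 : tnorm (gam 0) w <= tnorm (gam 0) (v *m T') + tnorm (gam 0) (v *m T' - w).
  by have := tnormB (gam 0) (v *m T') (v *m T' - w); rewrite opprB addrC subrK.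
exact: (gap_arith2 K20 K70 P10 lm0 (exprn_ile1 m (ltW lam0) (ltW lam1)) l0
  (tnorm_ge0 _ _) B1 (T01 _) (PT w) vw (T10 v) B2).
Qed.

End Hyperbolic.

(** * Parallel transport along a whole geodesic *)

Section ParallelIsometry.
Context {R : realType} {n : nat} {M : riemannianManifold R n}.
Implicit Types (p q x y z : M) (gam : R -> M) (v w : 'rV[R]_n).
Notation lmetric := (local_metric (@metric R n M)).

(** The connection is metric: the symmetric part of the lowered Christoffel
    symbols is half the derivative of the metric. *)
Lemma koszul_diag (G : 'rV[R]_n -> 'M[R]_n) u c w :
  2 * koszul G u c w w = (w *m 'D_c G u *m w^T) 0 0.
Proof.
have H (x y : R) : 2 * (2^-1 * (x + y - y)) = x by rewrite addrK mulVKf.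
exact: H.
Qed.

Lemma parallel_ip gam (V : R -> 'rV[R]_n) (t : R) : dcurve gam t ->
  parallel_at gam V t -> is_derive t 1 (fun s => ip (gam s) (V s) (V s)) 0.
Proof.
move=> dg Vt; set p := gam t.
have pt : dom p (gam t) := dom_self p.
have [dW DW E] := parallel_chart dg Vt pt.
have Dc := dcurve_chart dg pt.
have [dG _ _] := nbhs_singleton (local_metric_C2 pt).
have DG := is_derive_comp_curve Dc dG.
have N : \forall s \near t, dom p (gam s).
  by have [cg _] := dg; apply: cg; exact: nbhs_dom.
have /is_derive_mxP/(_ 0 0) D00 :=
  is_derive_mulmx (is_derive_mulmx DW DG) (is_derive_trmx DW).
pose W (s : R) := V s *m tchange (gam s) p (gam s).
have NE : \forall s \near t, (W s *m (lmetric p \o (chart p \o gam)) s *m (W s)^T) 0 0 =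
    ip (gam s) (V s) (V s).
  apply: filterS N => s ps; apply: etrans (tnorm_sqr _ _).
  exact: esym (tnorm_chart (V s) ps).
have {}D00 := near_eq_is_derive NE D00.
apply: (is_derive_eq D00).
set c := velocity gam t *m _ in E *.
have sG := local_metric_sym pt.
have K2 := koszul_diag (lmetric p) (chart p (gam t)) c (W t).
have E1 := E (W t).
have E2 : (W t *m lmetric p (chart p (gam t)) *m dW^T) 0 0 =
    (dW *m lmetric p (chart p (gam t)) *m (W t)^T) 0 0 by exact: form_sym.
have A3 (a b k d : R) : a = - k -> b = a -> 2 * k = d -> a + d + b = 0.
  by move=> -> -> <-; ring.
apply: (etrans _ (A3 _ _ _ _ E1 E2 K2)).
by rewrite mulmxDl !mxE.
Qed.

Lemma parallel_transport_tnorm gam A v : (forall t, 0 <= t <= 1 -> dcurve gam t) ->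
  parallel_transport gam A -> tnorm (gam 1) (v *m A) = tnorm (gam 0) v.
Proof.
move=> dg PA; have [V [PV V0 V1]] := PA v.
pose e (s : R) := ip (gam s) (V s) (V s).
have De (t : R) : 0 <= t <= 1 -> is_derive t 1 e 0.
  by move=> t01; exact: parallel_ip (dg t t01) (PV t t01).
have p0 : primitive01 (fun _ : R => 0) (fun _ => 0 : R).
  split; first by move=> t _; exact: is_derive_cst.
  by apply: continuous_subspaceT => t; exact: cvg_cst.
have B (t : R) : 0 < t < 1 -> `|(0 : R)| <= 0 * 0 by rewrite normr0 mul0r.
have H := mvt_primitive_scalar p0 (lexx (0 : R)) (fun t _ => lexx 0) De B
  (zero_in01 R) (one_in01 R).
have E : e 1 = e 0.
  by apply/eqP; rewrite -subr_eq0 -normr_le0 (le_trans H)// mul0r.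
by move: E; rewrite /e V0 V1 -!tnorm_sqr => /eqP; rewrite eqrXn2 ?tnorm_ge0// => /eqP.
Qed.

(** For a curve of arbitrary length this is the only property of parallel
    transport that is used; it serves when the stable spaces are the whole
    tangent spaces. *)
Lemma parallel_transport_unit gam A : (forall t, 0 <= t <= 1 -> dcurve gam t) ->
  parallel_transport gam A -> A \in unitmx.
Proof.
move=> dg PA; rewrite -row_free_unit -kermx_eq0; apply/rowV0P => v /sub_kermxP vA.
apply: (@tnorm_eq0 _ _ _ (gam 0)).
by rewrite -(parallel_transport_tnorm v dg PA) vA tnorm0.
Qed.

End ParallelIsometry.

Section SpeedContinuity.
Context {R : realType} {n : nat} {M : riemannianManifold R n}.
Implicit Types (p q x y z : M) (gam : R -> M) (v w : 'rV[R]_n).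
Notation lmetric := (local_metric (@metric R n M)).

(** Away from [t] the curve is known to be continuous only in the coordinates
    of [chart (gam t)]; it is continuous because it stays in the domain of that
    chart near [t]. *)
Lemma C1_at_dcurve_near gam (t : R) : C1_at gam t -> \forall s \near t, dcurve gam s.
Proof.
move=> [cg dg _]; have pt := dom_self (gam t).
have N : \forall s \near t, dom (gam t) (gam s) by apply: cg; exact: nbhs_dom.
apply: filterS2 (near_join N) dg => s Ns ds; have ps := nbhs_singleton Ns.
have Ds : is_derive s 1 (chart (gam t) \o gam) ('D_1 (chart (gam t) \o gam) s).
  exact: derivableP.
have cs : {for s, continuous (chart (gam t) \o gam)}.
  by apply: differentiable_continuous; apply/derivable1_diffP.
split.
  have ci : {for (chart (gam t) \o gam) s, continuous (ichart (gam t))}.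
    by apply: ichart_continuous; exists (gam s).
  have := continuous_comp cs ci; rewrite /prop_for /continuous_at /= chartK//.
  by apply: cvg_trans; apply: near_eq_cvg; apply: filterS Ns => r pr /=; rewrite chartK.
have dT := transition_differentiable ps (dom_self (gam s)).
have D := is_derive_comp_curve Ds dT.
have NN : \forall r \near s, ((chart (gam s) \o ichart (gam t)) \o (chart (gam t) \o gam)) r =
    (chart (gam s) \o gam) r.
  by apply: filterS Ns => r pr; rewrite /= chartK.
by have [] := near_eq_is_derive NN D.
Qed.

Lemma C1_at_speed_continuous gam (t : R) : C1_at gam t ->
  {for t, continuous (fun s => tnorm (gam s) (velocity gam s))}.
Proof.
move=> C1; have Nd := C1_at_dcurve_near C1; have [cg _ cv] := C1.
set p := gam t in cv *; have pt : dom p (gam t) := dom_self p.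
have N : \forall s \near t, dom p (gam s) by apply: cg; exact: nbhs_dom.
pose w (s : R) : 'rV[R]_n := (chart p \o gam)^`()%classic s.
pose S (s : R) : R := Num.sqrt ((w s *m lmetric p (chart p (gam s)) *m (w s)^T) 0 0).
have SE : \forall s \near t, S s = tnorm (gam s) (velocity gam s).
  apply: filterS2 Nd N => s ds ps; rewrite /S.
  have [_ Ew] := dcurve_chart ds ps.
  have -> : w s = velocity gam s *m tchange (gam s) p (gam s) by rewrite /w derive1E.
  by rewrite -(tnorm_chart _ ps) sqrtr_sqr ger0_norm ?tnorm_ge0.
have cS : S s @[s --> t] --> S t.
  have cc : {for t, continuous (chart p \o gam)}.
    by apply: continuous_comp cg _; exact: chart_continuous.
  have [dG _ _] := nbhs_singleton (local_metric_C2 pt).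
  have cG : lmetric p (chart p (gam s)) @[s --> t] --> lmetric p (chart p (gam t)).
    exact: continuous_comp cc (differentiable_continuous dG).
  have cF : (w s *m lmetric p (chart p (gam s)) *m (w s)^T) @[s --> t] -->
      w t *m lmetric p (chart p (gam t)) *m (w t)^T.
    apply: (@cvg_mulmx _ _ (nbhs t)); last exact: (@cvg_trmx _ _ (nbhs t)).
    exact: (@cvg_mulmx _ _ (nbhs t)).
  have /(@cvg_mxP _ _ (nbhs t))/(_ 0 0) c0 := cF.
  exact: (continuous_cvg _ (@sqrt_continuous _ _) c0).
rewrite /prop_for /continuous_at -(nbhs_singleton SE).
exact: (cvg_trans (near_eq_cvg SE)).
Qed.

(** The geodesic is of class C^1, so its speed is continuous and its length is
    an increment of a primitive of the speed. *)
Lemma geodesic_speed gam : geodesic gam -> exists h H,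
  speed_le gam h H /\ length gam = (H 1 - H 0)%:E.
Proof.
move=> [C1 _].
have [H pH E] := primitive01_integral (fun t t01 => C1_at_speed_continuous (C1 t t01)).
exists (fun t => tnorm (gam t) (velocity gam t)), H; split; last exact: E.
split=> // t t01; exact: (nbhs_singleton (C1_at_dcurve_near (C1 t t01))).
Qed.

End SpeedContinuity.

(** * Hölder continuity of the stable distribution *)

(** [m] is the integer part of [beta ln (1/d) / (ln Dn + beta ln (1/lam))]. This
    choice of denominator makes [lam^m] comparable to [d^alpha], and leaves in
    the second bound the slack [d^(beta alpha)], from which the third one
    follows as [beta <= 1]. *)
Lemma iteration_count (R : realType) (Dn lam beta d : R) :
  0 < lam < 1 -> lam^-1 <= Dn -> 0 < beta <= 1 -> 0 < d <= 1 ->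
  let alpha := beta * ln lam^-1 / (ln Dn + beta * ln lam^-1) in
  exists m : nat, [/\ lam ^+ m <= lam^-1 * d `^ alpha, Dn ^+ m * d `^ beta <= 1 &
    Dn ^+ m * d <= d `^ alpha].
Proof.
move=> /andP[lam0 lam1] Dnl /andP[b0 b1] /andP[d0 d1] alpha.
have li1 : 1 < lam^-1 by rewrite invf_gt1.
set l := ln lam^-1 in alpha *; have l0 : 0 < l by exact: ln_gt0.
have Dn0 : 0 < Dn by apply: lt_le_trans Dnl; rewrite invr_gt0.
set L := ln Dn in alpha *.
have lL : l <= L by rewrite ler_ln// posrE invr_gt0.
have L0 : 0 < L by exact: lt_le_trans lL.
pose q := L + beta * l; have q0 : 0 < q by rewrite addr_gt0// mulr_gt0.
pose X := beta * (- ln d) / q.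
have nd0 : 0 <= - ln d by rewrite oppr_ge0 ln_le0.
have X0 : 0 <= X by rewrite /X divr_ge0 ?mulr_ge0// ltW.
have [mX Xm] : (Num.truncn X)%:R <= X /\ X < (Num.truncn X).+1%:R.
  by have /andP := truncn_itv X0.
exists (Num.truncn X); move: (Num.truncn X) mX Xm => m mX Xm.
have expX (a : R) k : 0 < a -> a ^+ k = expR (k%:R * ln a).
  by move=> a0; rewrite expRM_natl lnK.
have dE a : d `^ a = expR (a * ln d) by rewrite /powR gt_eqF.
have aX : alpha * ln d = - (X * l).
  by rewrite /alpha /X -/q; field; rewrite gt_eqF.
have bX : beta * ln d = - (X * q) by rewrite /X; field; rewrite gt_eqF.
clearbody X; have DmX : Dn ^+ m <= expR (X * L).
  by rewrite expX// ler_expR ler_wpM2r// ltW.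
split.
- rewrite expX// dE aX -[lam^-1 in leRHS](@lnK _ lam^-1) ?posrE ?invr_gt0// -/l -expRD ler_expR.
  have -> : ln lam = - l by rewrite /l lnV// opprK.
  by have := ltW Xm; rewrite -natr1; nra.
- rewrite dE bX; apply: (le_trans (ler_wpM2r (expR_ge0 _) DmX)).
  rewrite -expRD -[leRHS]expR0 ler_expR /q.
  have : 0 <= X * (beta * l) by rewrite !mulr_ge0 ?(ltW b0) ?(ltW l0).
  lra.
rewrite dE aX -{1}(lnK d0); apply: (le_trans (ler_wpM2r (expR_ge0 _) DmX)).
rewrite -expRD ler_expR.
rewrite -(ler_pM2l b0) mulrDr bX /q.
have : 0 <= (1 - beta) * (X * L) by rewrite !mulr_ge0 ?subr_ge0 ?(ltW L0).
lra.
Qed.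

(** Distances above [d0] are covered by the trivial bound [2]; distance zero is
    covered by letting [d] tend to zero. *)
Lemma holder_bound_limit (R : realType) (C alpha d0 l g : R) :
  0 < alpha -> 0 <= C -> 0 < d0 -> 0 <= l -> g <= 2 ->
  (forall d, 0 < d -> d <= d0 -> l <= d -> g <= C * d `^ alpha) ->
  g <= (C + 2 / d0 `^ alpha + 1) * l `^ alpha.
Proof.
move=> a0 C0 d00 l0 g2 H.
have p0 : 0 < d0 `^ alpha by exact: powR_gt0.
have q0 : 0 <= 2 / d0 `^ alpha by rewrite divr_ge0// ltW.
have la0 : 0 <= l `^ alpha by exact: powR_ge0.
have [ld|dl] := leP l d0; last first.
  apply: (le_trans g2); rewrite (@le_trans _ _ (2 / d0 `^ alpha * l `^ alpha))//.
    rewrite -mulrA ler_peMr// ler_pdivlMl// mulr1.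
    by apply: ge0_ler_powR; rewrite ?nnegrE ?(ltW a0) ?(ltW d00) ?(ltW dl).
  by rewrite ler_wpM2r//; lra.
have [l00|lp] := eqVneq l 0.
  rewrite l00 powR0 ?gt_eqF// mulr0 leNgt; apply/negP => g0.
  pose e := g / (2 * (C + 1)).
  have e0 : 0 < e by rewrite divr_gt0// mulr_gt0// ltr_wpDl.
  pose d := Num.min d0 (e `^ alpha^-1).
  have dp : 0 < d by rewrite lt_min d00 powR_gt0.
  have de : d `^ alpha <= e.
    have -> : e = (e `^ alpha^-1) `^ alpha.
      by rewrite -powRrM mulVf ?gt_eqF// powRr1// ltW.
    apply: ge0_ler_powR; rewrite ?nnegrE ?powR_ge0 ?(ltW a0) ?(ltW dp)//.
    by rewrite ge_min lexx orbT.
  have := H d dp; rewrite ge_min lexx l00 => /(_ isT (ltW dp)).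
  apply/negP; rewrite -ltNge (le_lt_trans (ler_wpM2l C0 de))//.
  rewrite /e mulrA ltr_pdivrMr ?mulr_gt0 ?ltr_wpDl//.
  by rewrite mulrC ltr_pM2l//; lra.
have lgt : 0 < l by rewrite lt_neqAle eq_sym lp.
apply: (le_trans (H l lgt ld (lexx l))).
by rewrite ler_wpM2r//; lra.
Qed.

(** Otherwise [c r^k] would tend to zero. *)
Lemma expansion_rate (R : realType) (c r : R) : 0 <= r ->
  (forall k, 1 <= c * r ^+ k) -> 1 <= r.
Proof.
move=> r0 H; rewrite leNgt; apply/negP => r1.
have c0 : 0 < c.
  by have := H 0%N; rewrite expr0 mulr1; exact: lt_le_trans.
have e0 : 0 < 2^-1 / c by rewrite divr_gt0.
have : r ^+ k @[k --> \oo] --> 0 by apply: cvg_expr; rewrite ger0_norm.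
move/cvgrPdist_le => /(_ _ e0)[N _ HN].
have := HN N (leqnn N); rewrite /= sub0r normrN ger0_norm ?exprn_ge0//.
rewrite ler_pdivlMr// mulrC => HN'.
have := le_trans (H N) HN'; lra.
Qed.

Section StableHolder.
Context {R : realType} {n : nat} {M : riemannianManifold R n}.

(** If all unstable spaces vanish, the stable spaces are the whole tangent
    spaces and the distance is zero. Otherwise [Dnorm f >= lam^-1], so that the
    exponent lies in [(0, 1]], and [stable_gap] applies with the number of
    iterations given by [iteration_count]. *)
Theorem stable_holder (beta : R) (f finv : M -> M) (lam c : R) (Lam : set M)
    (Es Eu : M -> 'M[R]_n) :
  compact [set: M] -> 0 < beta <= 1 -> C1holder beta f -> C1holder beta finv ->
  cancel f finv -> 0 < lam < 1 -> 1 <= c ->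
  (forall x, Lam x -> Lam (f x)) ->
  (forall x, Lam x -> (Es x + Eu x :=: 1%:M)%MS) ->
  (forall x, Lam x -> (Eu x *m D f x <= Eu (f x))%MS) ->
  (forall x k v, Lam x -> (v <= Es x)%MS ->
     tnorm (iter k f x) (v *m D (iter k f) x) <= c * lam ^+ k * tnorm x v) ->
  (forall x k v, Lam x -> (v <= Eu x)%MS ->
     tnorm (iter k finv x) (v *m D (iter k finv) x) <= c * lam ^+ k * tnorm x v) ->
  holder_distribution Lam Es
    (beta * ln lam^-1 / (ln (Dnorm f) + beta * ln lam^-1)).
Proof.
move=> cM b01 Cf Cfi fK lam01 c1 LamS split inv_u rate_s rate_u.
have [b0 b1] := andP b01; have [lam0 lam1] := andP lam01.
have b01' : 0 <= beta <= 1 by rewrite (ltW b0).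
have df z : dmap f z := C1holder_dmap z Cf.
have dfi z : dmap finv z := C1holder_dmap z Cfi.
have [Dn0 fDn] := Dnorm_bound cM (ltW b0) Cf.
set alpha := beta * _ / _.
have [[x0 [Lx0 Ex0]]|noU] := pselect (exists x, Lam x /\ Eu x != 0); last first.
  have full x : Lam x -> row_full (Es x).
    move=> Lx; have Eu0 : Eu x = 0.
      by apply/eqP; apply: contraT => E0; exfalso; apply: noU; exists x.
    by rewrite -sub1mx -(split x Lx) Eu0 addsmx0.
  exists 1 => // x y Lx Ly gam A [geo g0 g1 _] PA.
  have [h [H [sp _]]] := geodesic_speed geo; have [_ dg _] := sp.
  have uA := parallel_transport_unit dg PA.
  apply: (@le_trans _ _ 0%E); last by rewrite mul1e poweR_ge0.
  rewrite lee_fin -(mulr0 2); apply: dG_gap => // v _; exists v.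
  - exact: submx_full (full y Ly).
  - by rewrite subrr tnorm0 mul0r.
  - by apply: submx_full; rewrite /row_full mxrankMfree ?row_free_unit//; exact: full.
  - by rewrite subrr tnorm0 mul0r.
have Dnl : lam^-1 <= Dnorm f.
  have [v0 v0E v0n] : exists2 v : 'rV[R]_n, (v <= Eu x0)%MS & v != 0.
    by move/rowV0Pn : Ex0 => [v vE vn]; exists v.
  have t0 : 0 < tnorm x0 v0.
    rewrite lt_neqAle tnorm_ge0 andbT eq_sym.
    by apply: contra_neq v0n; exact: tnorm_eq0.
  rewrite -[leLHS]mul1r ler_pdivrMr//; apply: (@expansion_rate R c).
    by rewrite mulr_ge0// ltW.
  move=> k; rewrite -(ler_pM2r t0) mul1r.
  have := unstable_expansion df dfi fK LamS inv_u rate_u k Lx0 v0E.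
  move=> /le_trans; apply.
  have H := tnorm_iter_le df Dn0 fDn x0 k v0.
  have ck : 0 <= c * lam ^+ k by rewrite mulr_ge0 ?exprn_ge0 ?(ltW lam0)// (le_trans _ c1).
  by apply: (le_trans (ler_wpM2l ck H)); rewrite exprMn; rewrite le_eqVlt; apply/orP; left; apply/eqP; ring.
have Dn1 : 1 <= Dnorm f by apply: le_trans Dnl; rewrite invf_ge1// ltW.
have l0 : 0 < ln lam^-1 by apply: ln_gt0; rewrite invf_gt1.
have L0 : 0 <= ln (Dnorm f) by exact: ln_ge0.
have bl0 : 0 < beta * ln lam^-1 by rewrite mulr_gt0.
have a0 : 0 < alpha by rewrite divr_gt0// ltr_wpDl.
have a1 : alpha <= 1 by rewrite ler_pdivrMr ?mul1r ?lerDr// ltr_wpDl.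
have [K K1 HK] := short_curve_piece cM (@holder_piece_le _ _ M beta f)
  (fun i => holder_piece_near i (ltW b0) Cf).
have K0 : 0 < K by exact: lt_le_trans K1.
have [K8 K80 [eps eps0 gap]] := stable_gap df dfi fK lam01 c1 LamS split inv_u
  rate_s rate_u Dn0 fDn b01' Dn1 K1 HK.
pose d0 := Num.min 1 (Num.min eps (K^-1 `^ alpha^-1)).
have d00 : 0 < d0 by rewrite !lt_min ltr01 eps0 powR_gt0// invr_gt0.
pose C := K8 * (lam^-1 + 1).
have C0 : 0 <= C by rewrite mulr_ge0// addr_ge0// invr_ge0 ltW.
have q0 : 0 <= 2 / d0 `^ alpha by rewrite divr_ge0// powR_ge0.
exists (C + 2 / d0 `^ alpha + 1); first by rewrite ltr_wpDl// addr_ge0.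
move=> x y Lx Ly gam A [geo g0 g1 len] PA.
have [h [H [sp lenE]]] := geodesic_speed geo.
rewrite -len lenE poweR_EFin -EFinM lee_fin.
have lg0 := speed_le_length_ge0 sp.
apply: (holder_bound_limit a0 C0 d00 lg0); first exact: dG_le2.
move=> d dp; rewrite /d0 !le_min => /andP[d1 /andP[de dK]] ld.
have [m [m1 m2 m3]] : exists m : nat, [/\ lam ^+ m <= lam^-1 * d `^ alpha,
    Dnorm f ^+ m * d `^ beta <= 1 & Dnorm f ^+ m * d <= d `^ alpha].
  by apply: iteration_count => //; rewrite dp.
have dda : d <= d `^ alpha by apply: ler_powR1 => //; rewrite (ltW dp).
have Dm0 : 0 <= Dnorm f ^+ m by exact: exprn_ge0.
have dK' : d `^ alpha <= K^-1.
  have -> : K^-1 = (K^-1 `^ alpha^-1) `^ alpha.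
    by rewrite -powRrM mulVf ?gt_eqF// powRr1// invr_ge0 ltW.
  by apply: ge0_ler_powR; rewrite ?nnegrE ?powR_ge0 ?(ltW a0) ?(ltW dp).
have s1 : Dnorm f ^+ m * (H 1 - H 0) <= K^-1.
  by apply: (le_trans (ler_wpM2l Dm0 ld)); exact: le_trans m3 dK'.
have s2 : Dnorm f ^+ m * (H 1 - H 0) `^ beta <= 1.
  apply: le_trans m2; apply: ler_wpM2l => //.
  by apply: ge0_ler_powR; rewrite ?nnegrE ?(ltW b0) ?(ltW dp).
rewrite -g0 in Lx; rewrite -g1 in Ly; rewrite -g0 -g1.
apply: (le_trans (gap gam h H m A sp s1 s2 (le_trans ld de) PA Lx Ly)).
rewrite /C -mulrA; apply: ler_wpM2l => //.
by rewrite mulrDl mul1r lerD// (le_trans ld).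
Qed.

End StableHolder.

Theorem theorem3p9 (R : realType) (n : nat) (M : riemannianManifold R n)
    (compactM : compact [set: M])
    (beta : R) (beta01 : 0 < beta <= 1)
    (f finv : M -> M) (fdiffeo : diffeo_C1holder beta f finv)
    (lam : R) (Lam : set M) (Es Eu : M -> 'M[R]_n)
    (hyp : hyperbolic_set f finv lam Lam Es Eu) :
  holder_distribution Lam Es
    (beta * ln lam^-1 / (ln (Dnorm f) + beta * ln lam^-1)) /\
  holder_distribution Lam Eu
    (beta * ln lam^-1 / (ln (Dinvnorm f) + beta * ln lam^-1)).
Proof.
have [fK fiK Cf Cfi] := fdiffeo.
have [_ fLam split _ _ inv_s inv_u lam01 [c c0 rates]] := hyp.
have df z : dmap f z := C1holder_dmap z Cf.
have dfi z : dmap finv z := C1holder_dmap z Cfi.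
have [lam0 lam1] := andP lam01.
have LamS x : Lam x -> Lam (f x) by move=> Lx; rewrite -fLam; exists x.
have LamV x : Lam x -> Lam (finv x).
  by rewrite -{1}fLam => -[z Lz <-]; rewrite fK.
pose c' := Num.max 1 c.
have c'1 : 1 <= c' by rewrite le_max lexx.
have cc' k x v : c * lam ^+ k * tnorm x v <= c' * lam ^+ k * tnorm (M := M) x v.
  by rewrite !ler_wpM2r ?tnorm_ge0 ?exprn_ge0 ?(ltW lam0)// le_max lexx orbT.
have rate_s x k v : Lam x -> (v <= Es x)%MS ->
    tnorm (iter k f x) (v *m D (iter k f) x) <= c' * lam ^+ k * tnorm x v.
  by move=> Lx vE; apply: le_trans (cc' k x v); exact: (rates x Lx k v).1.
have rate_u x k v : Lam x -> (v <= Eu x)%MS ->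
    tnorm (iter k finv x) (v *m D (iter k finv) x) <= c' * lam ^+ k * tnorm x v.
  by move=> Lx vE; apply: le_trans (cc' k x v); exact: (rates x Lx k v).2.
split.
  apply: (stable_holder compactM beta01 Cf Cfi fK lam01 c'1 LamS _ _ rate_s rate_u).
  - by move=> x Lx; have [] := split x Lx.
  - by move=> x Lx; rewrite inv_u.
have -> : Dinvnorm f = Dnorm finv.
  have inv z : invmx (D f z) = D finv (f z).
    have E := dmap_inverse z df dfi fK.
    have [u _] := mulmx1_unit E.
    by rewrite -[RHS]mul1mx -(mulVmx u) -mulmxA E mulmx1.
  rewrite /Dinvnorm /Dnorm; congr (sup _); apply/seteqP; split => [_ [z _ <-]|_ [z _ <-]].
    by exists (f z) => //; rewrite inv fK.
  by exists (finv z) => //; rewrite inv fiK.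
have back (E : M -> 'M[R]_n) : (forall x, Lam x -> (E x *m D f x :=: E (f x))%MS) ->
    forall x, Lam x -> (E x *m D finv x <= E (finv x))%MS.
  move=> invE x Lx; have Lz := LamV x Lx.
  have H := invE _ Lz; have I := dmap_inverse (finv x) df dfi fK.
  rewrite fiK in H I.
  have HE : (E x *m D finv x <= E (finv x) *m D f (finv x) *m D finv x)%MS.
    by apply: submxMr; rewrite H.
  by move: HE; rewrite -mulmxA I mulmx1.
apply: (stable_holder compactM beta01 Cfi Cf fiK lam01 c'1 LamV _ _ rate_u rate_s).
- by move=> x Lx; have [+ _] := split x Lx; rewrite addsmxC.
- exact: back.
Qed.
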